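(* Let $k$ be an algebraically closed field of characteristic $0$, let $n,m,r,s\ge1$ be integers with $r+s\le n$, and let $\lambda,\mu$ be partitions with $|\lambda|=|\mu|=t$, $l(\mu)\le r$, $l(\lambda)\le s$. Let $\chi=[\lambda,\mu]\in\mathbb Z^n$ be the corresponding dominant weight in the root lattice. For $\nu$ an $m$-tuple of integers $\ge0$ with sum $t$, $P,Q$ ordered tableaux of shapes $\lambda$ and $\mu$ respectively, both of weight $\nu$, and $\alpha:\mu\to\lambda$ a diagram mapping such that $P\circ\alpha=Q$, put $$u_{\nu,P,Q,\alpha}=\sum_{\pi\in C_\mu,\ \sigma\in C_\lambda}\mathrm{sgn}(\pi)\,\mathrm{sgn}(\sigma)\prod_{a\in\mu}x(Q(a))_{r-\pi(a)_1+1,\ \sigma(\alpha(a))_1}\ \in k[\mathrm{Mat}_{rs}^m].$$ Then the pull-backs $u_{\nu,P,Q,\alpha}\circ\varphi_{r,s,n,m}$ along $\varphi_{r,s,n,m}:\mathcal N_{n,m}\to\mathrm{Mat}_{rs}^m$, where $\nu$ ranges over the $m$-tuples of integers $\ge0$ with sum $t$, $P,Q$ range over the ordered tableaux of shapes $\lambda$ and $\mu$ respectively, both of weight $\nu$, and for each $\nu,P,Q$ the map $\alpha$ goes through a set of representatives for the $m$-tuples of special semi-standard tableaux with shapes determined by $Q$ and weights determined by $P$, span the vector space $k[\mathcal N_{n,m}]^{U_n}_\chi$.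
   Context: Varieties and actions. $\mathrm{Mat}_{rs}^m$ is the space of $m$-tuples of $r\times s$ matrices over $k$; $x(l)_{ij}$ is the $(i,j)$ matrix entry function of the $l$-th matrix component. $\mathrm{Mat}_n$ is the space of $n\times n$ matrices, $\mathcal N_{n,m}=\{A\in\mathrm{Mat}_n\mid A^n=0,\ A^{m+1}=0\}$ (a closed subvariety, with reduced structure). $\mathrm{GL}_n$ acts on $\mathrm{Mat}_n$ and $\mathcal N_{n,m}$ by conjugation and on functions by $(S\cdot f)(A)=f(S^{-1}AS)$. $T_n,U_n\le\mathrm{GL}_n$ are the subgroups of diagonal and of upper uni-triangular matrices; characters of $T_n$ are identified with $\mathbb Z^n$ via $D\mapsto\prod_iD_{ii}^{\chi_i}$. $M^{U_n}_\chi$ is the space of $U_n$-invariants of $T_n$-weight $\chi$. $[\lambda,\mu]=(\lambda_1,\lambda_2,\ldots,0,\ldots,0,\ldots,-\mu_2,-\mu_1)\in\mathbb Z^n$. For $X\in\mathrm{Mat}_n$, $\varphi_{r,s,n,m}(X)\in\mathrm{Mat}_{rs}^m$ is the $m$-tuple whose $i$-th component is the lower left $r\times s$ corner of $X^i$, $i=1,\ldots,m$. Diagrams and tableaux. A partition $\lambda$ of length $l(\lambda)$ and with sum of parts $|\lambda|$ is identified with its Young diagram $\{(i,j)\mid1\le i\le l(\lambda),1\le j\le\lambda_i\}$, $i$ being the row index (rows numbered from top to bottom) and $j$ the column index. For a box $b=(i,j)$, $b_1=i$ denotes its row index. A skew diagram is a set $\lambda/\mu$ of boxes of $\lambda$ not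 in $\mu$, for partitions $\mu\subseteq\lambda$. A tableau of shape $E$ is a map $E\to\{1,2,\ldots\}$; it is ordered if its entries are weakly increasing along rows (left to right) and down columns, and semi-standard if its entries are weakly increasing along rows and strictly increasing down columns. Its weight is the tuple whose $i$-th component is the number of occurrences of $i$ (extended with zeros if necessary). $C_\lambda\le\mathrm{Sym}(\lambda)$ is the column stabiliser: the permutations of the boxes of $\lambda$ preserving each column. A diagram mapping is a bijection between (skew) diagrams. For a skew diagram $E$, $S_E$ is the tableau of shape $E$ with all boxes in the $i$-th row filled with $i$. Special tableaux and admissible maps. Let $E,F$ be skew diagrams with the same number of boxes. A semi-standard tableau $S$ of shape $F$ with the same weight as $S_E$ is called special (relative to $E$) if $S=S_E\circ\alpha$ for some diagram mapping $\alpha:F\to E$ such that: (b) if for $a,b\in F$, $\alpha(b)$ occurs strictly below $\alpha(a)$ in the same column, then $b$ occurs in a strictly lower row than $a$. A diagram mapping $\alpha:F\to E$ is called admissible if: (b') if for $a,b\in F$, $\alpha(b)$ occurs strictly below $\alpha(a)$ in the same column, then $b$ occurs in a strictly lower row than $a$ and in a column to the left of $a$ or in the same column. (Every special semi-standard tableau of shape $F$ and weight that of $S_E$ can be written as $S_E\circ\alpha$ with $\alpha$ admissible.) Representatives. Let $P,Q$ be ordered tableaux of shapes $\lambda,\mu$, both of weight $\nu$; then $P^{-1}(i)$ and $Q^{-1}(i)$ are skew diagrams with $\nu_i$ boxes. An $m$-tuple of special semi-standard tableaux with shapes determined by $Q$ and weights determined by $P$ is a tuple $(S_1,\ldots,S_m)$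 where $S_i$ is a special semi-standard tableau (relative to $P^{-1}(i)$) of shape $Q^{-1}(i)$ and of weight equal to that of $S_{P^{-1}(i)}$. A diagram mapping $\alpha:\mu\to\lambda$ with $P\circ\alpha=Q$ represents $(S_1,\ldots,S_m)$ if, with $\alpha_i:Q^{-1}(i)\to P^{-1}(i)$ the restriction of $\alpha$, one has $S_i=S_{P^{-1}(i)}\circ\alpha_i$ for all $i$; representatives are always required to have all $\alpha_i$ admissible. A set of representatives contains exactly one representative for each such $m$-tuple. *)

(* Defs.v *)
(* MathComp, with finmap and multinomials. *)
From HB Require Import structures.
From mathcomp Require Import all_boot all_order all_algebra all_fingroup.
From mathcomp Require Import finmap mpoly.

Set Implicit Arguments.
Unset Strict Implicit.
Unset Printing Implicit Defensive.

Import GRing.Theory.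

Local Open Scope fset_scope.
Local Open Scope ring_scope.

Definition is_partition (la : seq nat) : bool :=
  sorted geq la && (0%N \notin la).

(* A box (i, j) has row index i and column index j, both counted from 1. *)
Definition box : Type := (nat * nat)%type.
Definition row_of (b : box) : nat := b.1.
Definition col_of (b : box) : nat := b.2.

(* Skew diagrams are finite sets of boxes. The notions below make sense for
   every finite set of boxes; they are only used for Young diagrams and for the
   fibres of ordered tableaux, which are skew diagrams. *)
Definition young (la : seq nat) : {fset box} :=
  [fset b in [seq (i, j) | i <- iota 1 (size la),
                           j <- iota 1 (nth 0%N la i.-1)]].

Definition tableau (E : {fset box}) : Type := {ffun E -> nat}.

Section Tableaux.
Variables (E : {fset box}) (T : tableau E).

Definition ordered_tableau : Prop :=
  [/\ forall b : E, (0 < T b)%N,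
      forall a b : E, row_of (val a) = row_of (val b) ->
        (col_of (val a) <= col_of (val b))%N -> (T a <= T b)%N
    & forall a b : E, col_of (val a) = col_of (val b) ->
        (row_of (val a) <= row_of (val b))%N -> (T a <= T b)%N].

Definition semistandard : Prop :=
  [/\ forall b : E, (0 < T b)%N,
      forall a b : E, row_of (val a) = row_of (val b) ->
        (col_of (val a) <= col_of (val b))%N -> (T a <= T b)%N
    & forall a b : E, col_of (val a) = col_of (val b) ->
        (row_of (val a) < row_of (val b))%N -> (T a < T b)%N].

Definition occurrences (i : nat) : nat := #|[set b : E | T b == i]|.

(* nu`_i is the multiplicity of the entry i.+1; the default value of nth is the
   extension of nu by zeros. *)
Definition has_weight (nu : seq nat) : Prop :=
  forall i : nat, occurrences i.+1 = nth 0%N nu i.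

Definition fibre (i : nat) : {fset box} := [fset val b | b : E & T b == i].

End Tableaux.

Definition row_tableau (E : {fset box}) : tableau E :=
  [ffun b : E => row_of (val b)].

Section DiagramMappings.
Variables (E F : {fset box}) (alpha : {ffun F -> E}).

Definition strictly_below_in_column (a b : F) : Prop :=
  col_of (val (alpha a)) = col_of (val (alpha b)) /\
  (row_of (val (alpha a)) < row_of (val (alpha b)))%N.

Definition diagram_mapping : Prop := bijective alpha.

Definition special_mapping : Prop :=
  diagram_mapping /\
  forall a b : F, strictly_below_in_column a b ->
    (row_of (val a) < row_of (val b))%N.

Definition admissible : Prop :=
  diagram_mapping /\
  forall a b : F, strictly_below_in_column a b ->
    (row_of (val a) < row_of (val b))%N /\
    (col_of (val b) <= col_of (val a))%N.

End DiagramMappings.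

Definition special (E F : {fset box}) (S : tableau F) : Prop :=
  [/\ semistandard S,
      forall i : nat, occurrences S i = occurrences (row_tableau E) i
    & exists2 alpha : {ffun F -> E}, special_mapping alpha &
        forall b : F, S b = row_tableau E (alpha b)].

Section Representatives.
Variables (m : nat) (D D' : {fset box}) (P : tableau D) (Q : tableau D').

(* Component i : 'I_m corresponds to the tableau entry i.+1. *)
Definition tableau_tuple : Type := forall i : 'I_m, tableau (fibre Q i.+1).

Definition special_tuple (S : tableau_tuple) : Prop :=
  forall i : 'I_m, special (fibre P i.+1) (S i).

(* If P \o alpha = Q, then beta is the restriction of alpha to the fibres. *)
Definition is_restriction (i : nat) (alpha : {ffun D' -> D})
    (beta : {ffun fibre Q i -> fibre P i}) : Prop :=
  forall (a : D') (b : fibre Q i),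
    val a = val b -> val (alpha a) = val (beta b).

Definition represents (alpha : {ffun D' -> D}) (S : tableau_tuple) : Prop :=
  [/\ diagram_mapping alpha,
      forall a : D', P (alpha a) = Q a
    & forall i : 'I_m,
        exists beta : {ffun fibre Q i.+1 -> fibre P i.+1},
          [/\ is_restriction alpha beta,
              admissible beta
            & forall b, S i b = row_tableau (fibre P i.+1) (beta b)]].

Definition set_of_representatives (R : {set {ffun D' -> D}}) : Prop :=
  (forall alpha, alpha \in R ->
     exists2 S : tableau_tuple, special_tuple S & represents alpha S) /\
  (forall S : tableau_tuple, special_tuple S ->
     exists! alpha, alpha \in R /\ represents alpha S).

End Representatives.

Definition column_stabiliser (E : {fset box}) : {set {perm E}} :=
  [set p : {perm E} | [forall b, col_of (val (p b)) == col_of (val b)]].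

Section Functions.
Variable k : fieldType.

(* The (i, j) entry, with 1-based indices i and j. All uses below are in range;
   the value 0 for indices that are too large is never met. *)
Definition entry (p q : nat) (A : 'M[k]_(p, q)) (i j : nat) : k :=
  match (insub i.-1 : option 'I_p), (insub j.-1 : option 'I_q) with
  | Some a, Some b => A a b
  | _, _ => 0
  end.

(* The coordinate function x(l)_(i,j) on m-tuples of r x s matrices. *)
Definition xcoord (m r s : nat) (l i j : nat) (X : m.-tuple 'M[k]_(r, s)) : k :=
  entry (nth 0 X l.-1) i j.

Definition u_fun (m r s : nat) (la mu : seq nat) (Q : tableau (young mu))
    (alpha : {ffun young mu -> young la}) (X : m.-tuple 'M[k]_(r, s)) : k :=
  \sum_(p in column_stabiliser (young mu))
   \sum_(q in column_stabiliser (young la))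
     (-1) ^+ odd_perm p * (-1) ^+ odd_perm q *
     \prod_(a : young mu)
        xcoord (Q a) (r - row_of (val (p a)) + 1)%N
              (row_of (val (q (alpha a)))) X.

Definition lower_left (n r s : nat) (A : 'M[k]_n) : 'M[k]_(r, s) :=
  \matrix_(i < r, j < s) entry A (n - r + i.+1) j.+1.

Definition phi (m r s n : nat) (A : 'M[k]_n) : m.-tuple 'M[k]_(r, s) :=
  [tuple lower_left r s (A ^+ i.+1) | i < m].

Section NilpotentVariety.
Variables n m : nat.

Definition nilvar : Type :=
  {A : 'M[k]_n | (A ^+ n == 0) && (A ^+ m.+1 == 0)}.

Definition GL : Type := {S : 'M[k]_n | S \in unitmx}.

Lemma conj_expr (S : GL) (A : 'M[k]_n) (d : nat) :
  (invmx (val S) *m A *m val S) ^+ d = invmx (val S) *m A ^+ d *m val S.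
Proof.
case: S => S /= uS; elim: d => [|d IHd].
  by rewrite !expr0 mulmx1 mulVmx.
by rewrite !exprS IHd -!mulmxE !mulmxA mulmxK.
Qed.

Fact conj_subproof (S : GL) (A : nilvar) :
  ((invmx (val S) *m val A *m val S) ^+ n == 0) &&
  ((invmx (val S) *m val A *m val S) ^+ m.+1 == 0).
Proof.
case: A => A /= /andP[/eqP An /eqP Am].
by rewrite !conj_expr An Am !mulmx0 !mul0mx eqxx.
Qed.

Definition conj_nil (S : GL) (A : nilvar) : nilvar :=
  exist _ (invmx (val S) *m val A *m val S) (conj_subproof S A).

Definition act (S : GL) (f : nilvar -> k) : nilvar -> k :=
  fun A => f (conj_nil S A).

(* The variety is reduced and k will be algebraically closed, so its coordinate
   ring is the ring of restrictions of polynomial functions in the entries. *)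
Definition regular (f : nilvar -> k) : Prop :=
  exists p : {mpoly k[n * n]},
    forall A : nilvar, f A = p.@[fun i => mxvec (val A) 0 i].

Definition upper_unitriangular (S : GL) : Prop :=
  (forall i, val S i i = 1) /\
  (forall i j : 'I_n, (j < i)%N -> val S i j = 0).

Definition diagonal (D : GL) : Prop := is_diag_mx (val D).

Definition character_of (chi : 'I_n -> int) (D : GL) : k :=
  \prod_(i < n) (val D i i) ^ (chi i).

Definition highest_weight_space (chi : 'I_n -> int) (f : nilvar -> k) : Prop :=
  [/\ regular f,
      forall S : GL, upper_unitriangular S -> act S f =1 f
    & forall D : GL, diagonal D ->
        forall A : nilvar, act D f A = character_of chi D * f A].

Definition linear_span (G : (nilvar -> k) -> Prop) (f : nilvar -> k) : Prop :=
  exists (d : nat) (c : 'I_d -> k) (g : 'I_d -> nilvar -> k),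
    (forall i, G (g i)) /\ forall A, f A = \sum_(i < d) c i * g i A.

Definition spans (G V : (nilvar -> k) -> Prop) : Prop :=
  forall f, linear_span G f <-> V f.

End NilpotentVariety.

End Functions.

Definition weight_pair (n : nat) (la mu : seq nat) (i : 'I_n) : int :=
  nth 0 ([seq (a : nat)%:Z | a <- la] ++ nseq (n - size la - size mu) 0
         ++ rev [seq - (a : nat)%:Z | a <- mu]) i.

(* Main.v *)
(**
  Highest weight functions are first reduced to explicit ones.  A highest
  weight function f, the restriction of a polynomial p, is transported to
  P_A(h) = det(h)^e p(h^-1 A h).  By Cramer's rule P_A is a polynomial in the
  entries of h, a combination of products of e determinants whose columns have
  the form A^i h_j.  The hypothesis on f says that P_A is killed by the
  polarisations of a column b by a column a < b and is a weight vector for the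
  columns, so Capelli's identity expresses a positive multiple of
  f(A) = P_A(1) as the result of applying to P_A a product of minors in the
  partial derivatives.  When these minors and determinants are expanded, the
  sums over repeated row indices are matrix products and traces of powers of A;
  the latter vanish by nilpotency.  What remains are the functions
  u_{Q,alpha} o phi with Q and alpha arbitrary.

  The second step straightens such a u_{Q,alpha}.  It is killed by the
  operators that add a row (or column) of the variables to the previous one,
  and this forces the leading monomial of any combination to satisfy two ballot
  conditions.  A monomial with the ballot conditions is the same thing as
  ordered tableaux P, Q with a tuple of special semi-standard tableaux, and the
  coefficients of the chosen u_{P,Q,alpha} in these monomials form a triangular
  matrix with nonzero diagonal.
*)
Require Import Defs.
From HB Require Import structures.
From mathcomp Require Import all_boot all_order all_algebra all_fingroup.
From mathcomp Require Import finmap mpoly zify ring.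

Set Implicit Arguments.
Unset Strict Implicit.
Unset Printing Implicit Defensive.

Import Order.TTheory GRing.Theory.

Local Open Scope ring_scope.

(** The obstacle is that [f] lives on a closed subvariety, where polarisations do not act. Fixing
    [A] and varying the conjugating matrix moves the problem to a polynomial in free entries, and
    evaluation at the identity brings it back. The scalars and index maps produced on the way must
    therefore be uniform in [A], which explains the order of quantifiers in most statements. The
    exponent [e] clears denominators, makes the weight [e + chi] nonnegative, and supplies enough
    columns: the conjugate partition of [e + chi] consists of the column lengths of [la] and of the
    complements in [n] of those of [mu]. This is how both diagrams enter.

    Two unrelated orders on monomials are used in the straightening. The lexicographic order on
    triples shows only that a nonzero invariant contains some monomial with both ballot conditions.
    The triangular shape is measured by [Rtot] and [ctot], and only among such monomials: the other
    monomials of a generator stay uncontrolled, which is harmless because an invariant without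
    ballot monomials is zero. *)

(** * Polynomial functions in characteristic zero and their restrictions to curves *)

Section PolynomialCalculus.
Variable k : fieldType.
Hypothesis char0 : [pchar k] =i pred0.

Lemma natr_neq0 (d : nat) : (0 < d)%N -> d%:R != 0 :> k.
Proof. by move=> d0; rewrite (pcharf0P k).1 // -lt0n. Qed.

Lemma poly_eq0_nonzero_points (p : {poly k}) :
  (forall b, b != 0 -> p.[b] = 0) -> p = 0.
Proof.
move=> p0; apply: contraTeq isT => pn0.
(* The test points [1, 2, ...], as many as the size of [p]: characteristic zero makes them nonzero
   and pairwise distinct. *)
pose rs : seq k := [seq i.+1%:R | i <- iota 0 (size p)].
suff: (size rs < size p)%N by rewrite size_map size_iota ltnn.
apply: max_poly_roots => //.
  by apply/allP => _ /mapP[i _ ->]; apply/eqP/p0/natr_neq0.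
rewrite map_inj_in_uniq ?iota_uniq // => i j _ _ /eqP.
wlog ij : i j / (i <= j)%N.
  move=> H; case: (leqP i j) => [/H // | /ltnW /H Hji].
  by rewrite eq_sym => /Hji.
rewrite eq_sym -subr_eq0 -natrB ?ltnS // subSS => e.
have [//|l] := eqVneq i j.
by move: (natr_neq0 (d := j - i)); rewrite e subn_gt0 ltn_neqAle l ij => /(_ isT).
Qed.

Variable N : nat.
Implicit Types (p q : {mpoly k[N]}) (v : 'I_N -> k) (w : 'I_N -> {poly k}).

Lemma mpoly_alg_ind (P : {mpoly k[N]} -> Prop) :
  (forall c, P c%:MP) -> (forall i, P 'X_i) ->
  (forall p q, P p -> P q -> P (p + q)) ->
  (forall p q, P p -> P q -> P (p * q)) -> forall p, P p.
Proof.
move=> PC PX PD PM; elim/mpolyind => [|c m p _ _ Pp]; first by rewrite -mpolyC0.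
apply: PD => //; rewrite -mul_mpolyC; apply: (PM) => //.
rewrite mpolyXE_id; apply: big_ind => [| x y | i _]; first by rewrite -mpolyC1.
  exact: (PM).
elim: (m i) => [|d IH]; first by rewrite expr0 -mpolyC1.
by rewrite exprS; apply: PM.
Qed.

(** Substitution of a polynomial curve for the variables. Invariance under a one-parameter group
    becomes a statement on a polynomial in one variable, whose derivative [deriv_curve] expresses
    through partial derivatives. *)
Definition curve_eval w p : {poly k} := mmap polyC w p.

Lemma horner_curve w p b : (curve_eval w p).[b] = p.@[fun i => (w i).[b]].
Proof.
elim/mpoly_alg_ind: p => [c|i|p q Hp Hq|p q Hp Hq].
- by rewrite /curve_eval mmapC mevalC hornerC.
- by rewrite /curve_eval mmapX mmap1U mevalXU.
- by rewrite /curve_eval raddfD mevalD hornerD Hp Hq.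
- by rewrite /curve_eval rmorphM mevalM hornerM Hp Hq.
Qed.

Lemma deriv_curve w p :
  (curve_eval w p)^`() = \sum_i curve_eval w p^`M(i) * (w i)^`().
Proof.
elim/mpoly_alg_ind: p => [c|i|p q Hp Hq|p q Hp Hq].
- rewrite /curve_eval mmapC derivC big1 // => i _.
  by rewrite mderivC raddf0 mul0r.
- rewrite /curve_eval mmapX mmap1U (bigD1 i) //= big1 ?addr0.
    rewrite mderivX mnm1E eqxx scale1r.
    by rewrite (_ : U_(i) - U_(i) = 0)%MM ?mpolyX0 ?rmorph1 ?mul1r //;
       apply/mnmP=> j; rewrite mnmBE subnn mnm0E.
  move=> j ji; rewrite mderivX mnm1E eq_sym (negPf ji) scale0r.
  by rewrite raddf0 mul0r.
- rewrite /curve_eval raddfD derivD Hp Hq -big_split; apply: eq_bigr => i _.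
  by rewrite mderivD raddfD mulrDl.
- rewrite /curve_eval rmorphM derivM Hp Hq mulr_suml mulr_sumr -big_split.
  apply: eq_bigr => i _; rewrite mderivM raddfD /= !rmorphM /=.
  by rewrite mulrDl mulrAC mulrA.
Qed.

Lemma poly_const_deriv0 (q : {poly k}) : q^`() = 0 -> q = (q.[0])%:P.
Proof.
move=> dq; apply/polyP => -[|i]; rewrite coefC /=; first by rewrite horner_coef0.
have := congr1 (fun r : {poly k} => r`_i) dq; rewrite coef_deriv coef0.
by move/eqP; rewrite -mulr_natr mulf_eq0 (negPf (natr_neq0 _)) // orbF => /eqP.
Qed.

Lemma mderiv_eq0_const p : (forall i, p^`M(i) = 0) -> p = (p@_0)%:MP.
Proof.
move=> dp; apply/mpolyP => m; rewrite mcoeffC.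
have [->|m0] := eqVneq m 0%MM; first by rewrite mulr1.
rewrite mulr0; have [i mi] : exists i, m i != 0%N.
  apply/existsP; apply: contraNT m0; rewrite negb_exists => /forallP H.
  by apply/eqP/mnmP => i; rewrite mnm0E; apply/eqP; have := H i; rewrite negbK.
have := congr1 (mcoeff (m - U_(i))%MM) (dp i).
rewrite mcoeff_mderiv mcoeff0 submK ?lep1mP // => /eqP.
by rewrite -mulr_natr mulf_eq0 (negPf (natr_neq0 _)) // orbF => /eqP.
Qed.

(** Induction on the degree: restriction to lines parallel to the axes shows that the partial
    derivatives vanish as functions, hence as polynomials, so that [p] is a constant with value
    zero. *)
Lemma meval_eq0 p : (forall v, p.@[v] = 0) -> p = 0.
Proof.
elim: {p}(msize p) {-2}p (leqnn (msize p)) => [|d IH] p sz p0.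
  by apply/eqP; rewrite -msize_poly_eq0 -leqn0.
suff dp i : p^`M(i) = 0.
  rewrite (mderiv_eq0_const dp).
  by have := p0 (fun=> 0); rewrite {1}(mderiv_eq0_const dp) mevalC => ->.
apply: IH => [|v].
  rewrite msizeE; apply/bigmax_leqP_seq => m mp _; rewrite -ltnS.
  apply: leq_trans sz.
  have : (m + U_(i))%MM \in msupp p.
    apply: contraTT mp => mp; rewrite -mcoeff_eq0 mcoeff_mderiv.
    by rewrite memN_msupp_eq0 // mul0rn.
  by move/msize_mdeg_lt; rewrite mdegD mdeg1 addn1.
pose w j : {poly k} := (v j)%:P + (if j == i then 'X else 0).
have : curve_eval w p = 0.
  by apply: poly_eq0_nonzero_points => b _; rewrite horner_curve p0.
move/(congr1 (fun r : {poly k} => r^`().[0])); rewrite deriv_curve deriv0 horner0.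
rewrite horner_sum (bigD1 i) //= big1 ?addr0 => [|j ji].
  rewrite /w eqxx derivD derivC derivX add0r hornerM hornerC mulr1.
  rewrite horner_curve => <-; apply: meval_eq => j.
  by case: eqP => _; rewrite !hornerE ?addr0.
by rewrite /w (negPf ji) derivD derivC deriv0 addr0 mulr0 horner0.
Qed.

End PolynomialCalculus.

(** * Constant coefficient operators and the Capelli identity *)

Section DiffOps.
Variables (k : fieldType) (N : nat).
Implicit Types (P Q R : {mpoly k[N]}).

(** The polynomial [Q] with its variables replaced by partial derivatives, applied to [P]. This
    makes the polynomial ring a module over itself ([dopM]), so a product of minors can be applied
    one minor at a time. *)
Definition dop Q P := \sum_(m <- msupp Q) Q@_m *: P^`M[m].

Lemma dop_supset (r : seq 'X_{1..N}) Q P :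
  uniq r -> {subset msupp Q <= r} -> dop Q P = \sum_(m <- r) Q@_m *: P^`M[m].
Proof.
move=> ur sub; rewrite [RHS](bigID (mem (msupp Q))) /= [X in _ + X]big1.
  rewrite addr0 -big_filter; apply: perm_big; apply: uniq_perm.
  - exact: msupp_uniq.
  - exact: filter_uniq.
  by move=> m; rewrite mem_filter; case: (boolP (m \in msupp Q)) => // /sub ->.
by move=> m mQ; rewrite memN_msupp_eq0 // scale0r.
Qed.

Lemma dopDl P : {morph dop^~ P : Q R / Q + R}.
Proof.
move=> Q R; pose r := undup (msupp Q ++ msupp R ++ msupp (Q + R)).
have sub A : {subset msupp A <= msupp Q ++ msupp R ++ msupp (Q + R)} ->
    dop A P = \sum_(m <- r) A@_m *: P^`M[m].
  by move=> s; apply: dop_supset; rewrite ?undup_uniq // => m /s; rewrite mem_undup.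
rewrite !sub -?big_split; try by move=> m h; rewrite !mem_cat h ?orbT.
by apply: eq_bigr => m _; rewrite mcoeffD scalerDl.
Qed.

Lemma dop0l P : dop 0 P = 0.
Proof. by rewrite /dop msupp0 big_nil. Qed.

Lemma dop_suml I (r : seq I) (B : pred I) F P :
  dop (\sum_(i <- r | B i) F i) P = \sum_(i <- r | B i) dop (F i) P.
Proof. exact: (big_morph (dop^~ P) (dopDl P) (dop0l P)). Qed.

Lemma dopZl c Q P : dop (c *: Q) P = c *: dop Q P.
Proof.
rewrite (@dop_supset (msupp Q)) ?msupp_uniq //; last exact: msuppZ_le.
by rewrite /dop scaler_sumr; apply: eq_bigr => m _; rewrite mcoeffZ scalerA.
Qed.

Lemma dopX m P : dop 'X_[m] P = P^`M[m].
Proof. by rewrite /dop msuppX big_seq1 mcoeffX eqxx scale1r. Qed.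

Lemma dopXU i P : dop 'X_i P = P^`M(i).
Proof. by rewrite dopX mderivmU1m. Qed.

Lemma dop1 P : dop 1 P = P.
Proof. by rewrite -mpolyX0 dopX mderivm0m. Qed.

Lemma dopDr Q : {morph dop Q : P R / P + R}.
Proof.
move=> P R; rewrite /dop -big_split; apply: eq_bigr => m _.
by rewrite mderivmD scalerDr.
Qed.

Lemma dop0r Q : dop Q 0 = 0.
Proof. by rewrite /dop big1 // => m _; rewrite raddf0 scaler0. Qed.

Lemma dopZr c Q P : dop Q (c *: P) = c *: dop Q P.
Proof.
rewrite /dop scaler_sumr; apply: eq_bigr => m _.
by rewrite mderivmZ !scalerA mulrC.
Qed.

Lemma dop_sumr I (r : seq I) (B : pred I) F Q :
  dop Q (\sum_(i <- r | B i) F i) = \sum_(i <- r | B i) dop Q (F i).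
Proof. exact: (big_morph (dop Q) (dopDr Q) (dop0r Q)). Qed.

Lemma dopM Q R P : dop (Q * R) P = dop R (dop Q P).
Proof.
rewrite {1}[Q]mpolyE {1}[R]mpolyE big_distrlr /= dop_suml.
under eq_bigr => m _ do rewrite dop_suml.
rewrite exchange_big /= {2}/dop; apply: eq_bigr => m2 _.
rewrite [dop Q P]/dop raddf_sum scaler_sumr /=; apply: eq_bigr => m1 _.
rewrite -scalerAl -scalerAr -mpolyXD !dopZl dopX mderivmDm.
by rewrite mderivmZ !scalerA mulrC.
Qed.

End DiffOps.

Section Capelli.
Variables (k : fieldType) (n N : nat) (x : 'I_n -> 'I_n -> 'I_N).
Hypothesis char0 : [pchar k] =i pred0.
Hypothesis x_inj : forall i j i' j', x i j = x i' j' -> i = i' /\ j = j'.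
Implicit Types (P Q : {mpoly k[N]}) (a b c i j : 'I_n) (L : seq ('I_n * 'I_n)).
Implicit Types (S : {set 'I_n}) (s : 'S_n).

Definition polarisation a b P := \sum_i 'X_(x i a) * P^`M(x i b).

(* The product of the polarisations in L with all derivations moved to the
   right; at the identity matrix only the derivations remain (W_at_identity). *)
Fixpoint normal_ordered L P :=
  if L is (a, b) :: L' then
    \sum_i 'X_(x i a) * normal_ordered L' P^`M(x i b)
  else P.

Local Notation D := polarisation.
Local Notation W := normal_ordered.

Lemma WD L : {morph W L : P Q / P + Q}.
Proof.
elim: L => [|[a b] L IH] P Q //=; rewrite -big_split; apply: eq_bigr => i _.
by rewrite mderivD IH mulrDr.
Qed.

Lemma W0 L : W L 0 = 0.
Proof.
elim: L => [|[a b] L IH] //=; rewrite big1 // => i _.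
by rewrite mderiv0 IH mulr0.
Qed.

Lemma WZ L t P : W L (t *: P) = t *: W L P.
Proof.
elim: L P => [|[a b] L IH] P //=; rewrite scaler_sumr; apply: eq_bigr => i _.
by rewrite mderivZ IH scalerAr.
Qed.

Lemma W_sum L I (r : seq I) (B : pred I) F :
  W L (\sum_(i <- r | B i) F i) = \sum_(i <- r | B i) W L (F i).
Proof. exact: (big_morph (W L) (WD L) (W0 L)). Qed.

(** All variables stand to the left of all derivations, so the factors commute and only the multiset
    of pairs matters. *)
Lemma W_swap u v L P : W (u :: v :: L) P = W (v :: u :: L) P.
Proof.
case: u v => [a b] [a' b'] /=.
under eq_bigr => i _ do rewrite mulr_sumr.
rewrite exchange_big /=; apply: eq_bigr => i _; rewrite mulr_sumr.
by apply: eq_bigr => j _; rewrite mderiv_comm mulrCA.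
Qed.

Lemma W_cons u L L' P : W L =1 W L' -> W (u :: L) P = W (u :: L') P.
Proof.
by case: u => a b e /=; apply: eq_bigr => i _; rewrite e.
Qed.

Lemma W_rem u L P : u \in L -> W L P = W (u :: rem u L) P.
Proof.
elim: L P => [|v L IH] P //; rewrite inE [rem _ _]/=.
have [<- // | vu uL] := eqVneq v u.
by rewrite W_swap; apply: W_cons => Q; apply: IH.
Qed.

Lemma W_perm L L' P : perm_eq L L' -> W L P = W L' P.
Proof.
elim: L L' P => [|u L IH] L' P.
  by rewrite perm_sym => /perm_nilP ->.
move=> e; have uL' : u \in L' by rewrite -(perm_mem e) mem_head.
rewrite (W_rem _ uL'); apply: W_cons => Q; apply: IH.
by rewrite -(perm_cons u) (permPl e) perm_to_rem.
Qed.

Lemma mderiv_XU u v : ('X_u : {mpoly k[N]})^`M(v) = (u == v)%:R.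
Proof.
rewrite mderivX mnm1E; have [->|] := eqVneq u v; last by rewrite scale0r.
rewrite scale1r (_ : U_(v) - U_(v) = 0)%MM ?mpolyX0 //.
by apply/mnmP=> j; rewrite mnmBE subnn mnm0E.
Qed.

Lemma x_eq i j i' j' : (x i j == x i' j') = (i == i') && (j == j').
Proof.
apply/eqP/andP => [/x_inj[-> ->] | [/eqP-> /eqP->]] //; by rewrite !eqxx.
Qed.

Lemma W_mulX_notin L i a Q : a \notin map snd L ->
  W L ('X_(x i a) * Q) = 'X_(x i a) * W L Q.
Proof.
elim: L Q => [|[c b] L IH] Q //=; rewrite inE negb_or => /andP[ab aL].
rewrite mulr_sumr; apply: eq_bigr => j _; rewrite mderivM mderiv_XU x_eq.
by rewrite (negPf ab) andbF mul0r add0r IH // mulrCA.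
Qed.

Lemma W_mulX_cons L i a c Q : a \notin map snd L ->
  W ((c, a) :: L) ('X_(x i a) * Q) =
  'X_(x i a) * W ((c, a) :: L) Q + 'X_(x i c) * W L Q.
Proof.
move=> aL /=; under eq_bigr => j _ do
  rewrite mderivM mderiv_XU x_eq eqxx andbT WD mulrDr W_mulX_notin //.
rewrite big_split addrC /=; congr (_ + _); last first.
  by rewrite mulr_sumr; apply: eq_bigr => j _; rewrite mulrCA.
rewrite (bigD1 i) //= eqxx mul1r big1 ?addr0 // => j ji.
by rewrite eq_sym (negPf ji) mul0r W0 mulr0.
Qed.

Lemma W_polar_notin L a b P : a \notin map snd L ->
  W L (D a b P) = W ((a, b) :: L) P.
Proof.
by move=> aL; rewrite W_sum /=; apply: eq_bigr => i _; rewrite W_mulX_notin.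
Qed.

(** The commutation rule behind Capelli's identity: the derivation in column [a] either passes the
    variable of the polarisation or consumes it, and then the pairs [(c, a)] and [(a, b)] merge into
    [(c, b)]. *)
Lemma W_polar_cons L a b c P : a \notin map snd L ->
  W ((c, a) :: L) (D a b P) = W [:: (a, b), (c, a) & L] P + W ((c, b) :: L) P.
Proof.
move=> aL; rewrite W_sum [W [:: (a, b), _ & _] _]/= [W ((c, b) :: _) _]/=.
by rewrite -big_split; apply: eq_bigr => i _; rewrite W_mulX_cons.
Qed.

Definition pairs_of S s := [seq (s j, j) | j <- enum S].

Lemma pairs_of_D1 S s c : c \in S ->
  perm_eq (pairs_of S s) ((s c, c) :: pairs_of (S :\ c) s).
Proof.
move=> cS; rewrite /pairs_of -(map_cons (fun j => (s j, j))); apply: perm_map.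
apply: uniq_perm => [||j]; rewrite /= ?enum_uniq ?mem_enum ?in_setD1 ?eqxx //.
by rewrite inE !mem_enum in_setD1; case: eqP => // ->.
Qed.

Lemma snd_pairs_of S s : map snd (pairs_of S s) = enum S.
Proof. by rewrite /pairs_of -map_comp map_id. Qed.

(** By Cauchy-Binet this is the sum over row sets of a minor of the variables in the columns [S]
    times the same minor in the derivations. *)
Definition capelli S P :=
  \sum_(s | perm_on S s) (-1) ^+ s *: W (pairs_of S s) P.

(** Highest weight vectors for right multiplication by upper triangular matrices, in infinitesimal
    form: [D a b] adds column [a] to the later column [b]. *)
Definition highest (kap : 'I_n -> nat) P :=
  (forall a b, (a < b)%N -> D a b P = 0) /\
  (forall a, D a a P = (kap a)%:R *: P).

Lemma perm_on_D1 S s i : perm_on (S :\ i) s = perm_on S s && (s i == i).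
Proof.
apply/subsetP/andP => [H|[/subsetP H /eqP si] j]; last first.
  rewrite !inE => sj; rewrite (H j sj) andbT.
  by apply: contraNneq sj => ->; rewrite si.
split; first by apply/subsetP => j /H; rewrite !inE => /andP[].
by apply: contraT => si; have := H i si; rewrite !inE eqxx.
Qed.

(* Moving the derivation in column c to the right leaves polarisations of column
   c by smaller columns, which kill P because c is the largest index of S; the
   commutators produce the sum. *)
Lemma capelli_rec S c kap P : c \in S -> (forall j, j \in S -> (j <= c)%N) ->
  highest kap P ->
  capelli S P = (kap c)%:R *: capelli (S :\ c) P +
                \sum_(i in S :\ c) capelli (S :\ i) P.
Proof.
move=> cS cmax [D0 Dk].
rewrite {1}/capelli (partition_big (fun s => s c) (mem S)) /=; last first.
  by move=> s sS; rewrite perm_closed.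
rewrite (bigD1 c) //=; congr (_ + _).
  rewrite /capelli scaler_sumr; apply: eq_big => [s|s /andP[sS /eqP sc]].
    by rewrite perm_on_D1.
  rewrite (W_perm _ (pairs_of_D1 s cS)) sc -W_polar_notin; last first.
    by rewrite snd_pairs_of mem_enum !inE eqxx.
  by rewrite Dk WZ !scalerA mulrC.
apply: eq_big => [i|i /andP[iS ic]]; first by rewrite !inE andbC.
(* A permutation that sends [c] to [i] is the transposition of [c] and [i] followed by a permutation
   that fixes [i]. The sign of the transposition cancels the sign coming from [D i c P = 0]. *)
rewrite /capelli (reindex_inj (mulgI (tperm c i))) /=; apply: eq_big => [s|s].
  rewrite permM tpermL perm_on_D1; apply: andb_id2r => _.
  have tS : perm_on S (tperm c i).
    by apply/subsetP=> j; rewrite inE; case: tpermP => [->|->|]; rewrite ?eqxx.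
  apply/idP/idP => h; last exact: perm_onM.
  by rewrite -[s](mulKg (tperm c i)) tpermV perm_onM.
rewrite permM tpermL => /andP[sS /eqP si]; set s' := (_ * s)%g.
have s'c : s' c = i by rewrite permM tpermL.
have s'i : s' i = s c by rewrite permM tpermR.
have s'j j : j != c -> j != i -> s' j = s j.
  by move=> jc ji; rewrite permM tpermD // eq_sym.
have eqL : pairs_of (S :\ c :\ i) s' = pairs_of (S :\ i :\ c) s.
  rewrite /pairs_of setDDl setUC -setDDl; apply/eq_in_map => j.
  by rewrite mem_enum !inE => /and3P[jc ji _]; rewrite s'j.
have iSc : i \in S :\ c by rewrite !inE ic.
have cSi : c \in S :\ i by rewrite !inE eq_sym ic.
rewrite (W_perm _ (pairs_of_D1 s' cS)) (@W_cons _ _ ((s c, i) :: pairs_of (S :\ i :\ c) s)); last first.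
  by move=> Q; rewrite (W_perm _ (pairs_of_D1 s' iSc)) s'i eqL.
rewrite s'c; have iL : i \notin map snd (pairs_of (S :\ i :\ c) s).
  by rewrite snd_pairs_of mem_enum !inE eqxx andbF.
have := @W_polar_cons (pairs_of (S :\ i :\ c) s) i c (s c) P iL.
rewrite D0; last by rewrite ltn_neqAle cmax // andbT; move: ic; rewrite -val_eqE.
rewrite W0 => /esym/eqP; rewrite addr_eq0 => /eqP ->.
rewrite (W_perm _ (pairs_of_D1 s cSi)) /s' odd_permM odd_tperm eq_sym ic.
by rewrite signr_addb mulN1r scalerN scaleNr opprK.
Qed.

(** One natural number serves all [P]. The recursion presents it as a weight times a smaller scalar
    plus natural numbers, whence its positivity when the weights on [S] are positive. *)
Lemma capelli_scalar S kap : exists d : nat,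
  (forall P, highest kap P -> capelli S P = d%:R *: P) /\
  ((forall a, a \in S -> (0 < kap a)%N) -> (0 < d)%N).
Proof.
elim: {S}#|S| {-2}S (erefl #|S|) => [|d IH] S.
  move/eqP; rewrite cards_eq0 => /eqP ->; exists 1%N; split => // P _.
  rewrite /capelli (bigD1 1%g) ?perm_on1 //= big1 ?addr0.
    by rewrite odd_perm1 !scale1r /pairs_of enum_set0.
  move=> s /andP[/subsetP s0 /eqP[]]; apply/permP => j; rewrite perm1.
  by apply: contraTeq isT => sj; have := s0 j sj; rewrite inE.
move=> Sd; have [i0 i0S] : exists i, i \in S by apply/card_gt0P; rewrite Sd.
pose c := [arg max_(i > i0 in S) val i].
have [cS cmax] : c \in S /\ forall j, j \in S -> (j <= c)%N.
  by rewrite /c; case: arg_maxnP => // j jS jmax; split=> // j' /jmax.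
have card_D i : i \in S -> #|S :\ i| = d.
  by move=> iS; move: Sd; rewrite (cardsD1 i) iS => -[].
have ex (i : 'I_n) : exists f : nat, i \in S ->
    forall P, highest kap P -> capelli (S :\ i) P = f%:R *: P.
  have [iS|iS] := boolP (i \in S); last by exists 0%N.
  by have [f [H _]] := IH _ (card_D i iS); exists f.
have [f fP] := fin_all_exists ex.
have [f0 [e0 f0pos]] := IH _ (card_D c cS).
exists (kap c * f0 + \sum_(i in S :\ c) f i)%N; split.
  move=> P hP; rewrite (capelli_rec cS cmax hP).
  rewrite e0 // scalerA -natrM natrD scalerDl natr_sum scaler_suml.
  by congr (_ + _); apply: eq_bigr => i; rewrite inE => /andP[_ /fP ->].
move=> kpos; rewrite addn_gt0 muln_gt0 kpos //= f0pos // => a.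
by rewrite inE => /andP[_ /kpos].
Qed.

Fixpoint derivs L P := if L is (a, b) :: L' then derivs L' P^`M(x a b) else P.

Lemma W_at_identity (v : 'I_N -> k) L P :
  (forall i j, v (x i j) = (i == j)%:R) -> (W L P).@[v] = (derivs L P).@[v].
Proof.
move=> v1; elim: L P => [|[a b] L IH] P //=.
rewrite raddf_sum (bigD1 a) //= big1 ?addr0 => [|i ia].
  by rewrite mevalM mevalXU v1 eqxx mul1r IH.
by rewrite mevalM mevalXU v1 (negPf ia) mul0r.
Qed.

Definition first_cols (c : nat) : {set 'I_n} := [set i : 'I_n | (i < c)%N].

(** The upper left [c] by [c] determinant of the generic matrix, written with permutations of all
    indices that fix those from [c] on, so that they compose with transpositions in one group. *)
Definition minor (c : nat) : {mpoly k[N]} :=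
  \sum_(s | perm_on (first_cols c) s) (-1) ^+ s *: \prod_(i < n | (i < c)%N) 'X_(x (s i) i).

Lemma derivs_dop L P : derivs L P = dop (\prod_(u <- L) 'X_(x u.1 u.2)) P.
Proof.
elim: L P => [|[a b] L IH] P /=; first by rewrite big_nil dop1.
by rewrite big_cons dopM dopXU IH.
Qed.

Lemma derivs_perm L L' P : perm_eq L L' -> derivs L P = derivs L' P.
Proof. by move=> e; rewrite !derivs_dop (perm_big _ e). Qed.

Lemma dop_minor (c : nat) P : dop (minor c) P =
  \sum_(s | perm_on (first_cols c) s) (-1) ^+ s *: derivs (pairs_of (first_cols c) s) P.
Proof.
rewrite dop_suml; apply: eq_bigr => s _; rewrite dopZl derivs_dop big_map.
by rewrite big_enum /=; congr (_ *: dop _ _); apply: eq_bigl => i; rewrite inE.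
Qed.

Lemma polarD a b : {morph D a b : P Q / P + Q}.
Proof.
move=> P Q; rewrite /polarisation -big_split; apply: eq_bigr => i _.
by rewrite mderivD mulrDr.
Qed.

Lemma polar0 a b : D a b 0 = 0.
Proof. by rewrite /polarisation big1 // => i _; rewrite mderiv0 mulr0. Qed.

Lemma polarZ a b t P : D a b (t *: P) = t *: D a b P.
Proof.
rewrite /polarisation scaler_sumr; apply: eq_bigr => i _.
by rewrite mderivZ scalerAr.
Qed.

Lemma polar_mderiv a b i j P :
  D a b P^`M(x i j) = (D a b P)^`M(x i j) - P^`M(x i b) *+ (a == j).
Proof.
rewrite raddf_sum /=; apply/eqP; rewrite eq_sym subr_eq; apply/eqP.
under eq_bigr => l _ do rewrite mderivM mderiv_XU x_eq mderiv_comm.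
rewrite big_split addrC /=; congr (_ + _).
rewrite (bigD1 i) //= eqxx big1 ?addr0 => [|l li].
  by case: (a == j); rewrite ?mul1r ?mul0r.
by rewrite (negPf li) mul0r.
Qed.

Lemma polar_derivs_notin a b L P : a \notin map snd L ->
  D a b (derivs L P) = derivs L (D a b P).
Proof.
elim: L P => [|[i j] L IH] P //=; rewrite inE negb_or => /andP[aj aL].
by rewrite IH // polar_mderiv (negPf aj) subr0.
Qed.

Lemma derivsD L : {morph derivs L : P Q / P + Q}.
Proof. by move=> P Q; rewrite !derivs_dop dopDr. Qed.

Lemma derivs0 L : derivs L 0 = 0.
Proof. by rewrite derivs_dop dop0r. Qed.

Lemma derivsN L P : derivs L (- P) = - derivs L P.
Proof. by apply/eqP; rewrite -addr_eq0 -derivsD addNr derivs0. Qed.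

Lemma polar_derivs_cons a b i L P : a \notin map snd L ->
  D a b (derivs ((i, a) :: L) P) =
  derivs ((i, a) :: L) (D a b P) - derivs ((i, b) :: L) P.
Proof.
by move=> aL /=; rewrite polar_derivs_notin // polar_mderiv eqxx derivsD derivsN.
Qed.

(** Euler's operator of column [b] multiplies a monomial by its degree in that column. If it kills
    [P], characteristic zero excludes the column from all monomials of [P]. *)
Lemma highest_col0 kap b i P : highest kap P -> kap b = 0%N -> P^`M(x i b) = 0.
Proof.
move=> [_ Dk] kb; have := Dk b; rewrite kb scale0r => D0.
apply/mpolyP => m; rewrite mcoeff0 mcoeff_mderiv.
have := congr1 (mcoeff (m + U_(x i b))%MM) D0.
have XdE (u : 'I_N) m' : ('X_u * P^`M(u))@_m' = P@_m' *+ m' u.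
  rewrite mulrC; have [e|e] := eqVneq (m' u) 0%N.
    rewrite e mulr0n mcoeffM big1 // => -[m1 m2] /= /eqP em.
    rewrite mcoeffX; have [e2|] := eqVneq U_(u)%MM (m2 : 'X_{1..N}).
      have := congr1 (fun m0 : 'X_{1..N} => m0 u) em.
      by rewrite /= e mnmDE -e2 mnm1E eqxx addn1.
    by rewrite mulr0.
  have em : (m' - U_(u) + U_(u) = m')%MM by rewrite submK ?lep1mP.
  rewrite -{1}em addmC mcoeffMX mcoeff_mderiv em mnmBE mnm1E eqxx.
  by rewrite subn1 prednK ?lt0n.
rewrite raddf_sum mcoeff0 /=; under eq_bigr => l _ do rewrite XdE.
rewrite sumrMnr => /eqP; rewrite -mulr_natr mulf_eq0 => /orP[/eqP ->|].
  by rewrite mul0rn.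
apply: contraTeq => _; apply: natr_neq0 => //.
by rewrite (bigD1 i) //= mnmDE mnm1E eqxx addn1.
Qed.

(** Commuting a polarisation with the minor replaces a derivation in column [a] by one in column
    [b]. For [b < c] two derivations in column [b] are antisymmetrised; for [c <= b] the polynomial
    does not involve column [b]. Both give zero. *)
Lemma highest_dop_minor (c : nat) kap P :
  (forall a, (a < c)%N -> (0 < kap a)%N) ->
  (forall a, (c <= a)%N -> kap a = 0%N) ->
  highest kap P -> highest (fun a => kap a - (a < c))%N (dop (minor c) P).
Proof.
move=> kpos k0 hP; have [D0 Dk] := hP; rewrite dop_minor.
pose L := pairs_of (first_cols c).
have Dsum a b : D a b (\sum_(s | perm_on (first_cols c) s) (-1) ^+ s *: derivs (L s) P)
    = \sum_(s | perm_on (first_cols c) s) (-1) ^+ s *: D a b (derivs (L s) P).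
  rewrite (big_morph (D a b) (polarD a b) (polar0 a b)).
  by apply: eq_bigr => s _; rewrite polarZ.
have inS a : (a \in first_cols c) = (a < c)%N by rewrite inE.
have Dcons a b s : (a < c)%N -> D a b (derivs (L s) P) =
    derivs (L s) (D a b P) - derivs ((s a, b) :: pairs_of (first_cols c :\ a) s) P.
  move=> ac; have aS : a \in first_cols c by rewrite inS.
  rewrite !(derivs_perm _ (pairs_of_D1 s aS)) polar_derivs_cons //.
  by rewrite snd_pairs_of mem_enum !inE eqxx.
have Dnotin a b s : (c <= a)%N -> D a b (derivs (L s) P) = derivs (L s) (D a b P).
  by move=> ca; rewrite polar_derivs_notin // snd_pairs_of mem_enum inS -leqNgt.
split=> [a b ab|a]; rewrite Dsum; last first.
  rewrite scaler_sumr; apply: eq_bigr => s _; rewrite scalerA mulrC -scalerA.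
  congr (_ *: _); have [ac|ca] := ltnP a c.
    have aS : a \in first_cols c by rewrite inS.
    rewrite Dcons // -(derivs_perm _ (pairs_of_D1 s aS)) Dk.
    rewrite natrB ?kpos // scalerBl scale1r; congr (_ - _).
    by rewrite !derivs_dop dopZr.
  by rewrite Dnotin // Dk subn0 !derivs_dop dopZr.
have [ac|ca] := ltnP a c; last first.
  by rewrite big1 // => s _; rewrite Dnotin // D0 // derivs0 scaler0.
under eq_bigr => s _ do rewrite Dcons // D0 // derivs0 sub0r.
have [bc|cb] := ltnP b c; last first.
  by rewrite big1 // => s _ /=; rewrite (highest_col0 _ hP) ?k0 // derivs0 oppr0 scaler0.
set Sm := \sum_(_ | _) _; suff: Sm = - Sm.
  move/eqP; rewrite -addr_eq0 -mulr2n -scaler_nat scaler_eq0.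
  by rewrite (negPf (natr_neq0 char0 _)) // => /eqP.
have ab' : a != b by rewrite -val_eqE neq_ltn ab.
rewrite {1}/Sm (reindex_inj (mulgI (tperm a b))) -sumrN; apply: eq_big => s.
  have tS : perm_on (first_cols c) (tperm a b).
    by apply/subsetP=> j; rewrite inE; case: tpermP => [->|->|]; rewrite ?eqxx ?inS.
  apply/idP/idP => h; last exact: perm_onM.
  by rewrite -[s](mulKg (tperm a b)) tpermV perm_onM.
move=> _; rewrite odd_permM odd_tperm ab' signr_addb mulN1r scaleNr.
congr (- (_ *: - _)).
have bSa : b \in first_cols c :\ a by rewrite in_setD1 eq_sym ab' inS.
have e (t : 'S_n) : derivs ((t a, b) :: pairs_of (first_cols c :\ a) t) P =
    derivs [:: (t a, b), (t b, b) & pairs_of (first_cols c :\ a :\ b) t] P.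
  by apply: derivs_perm; rewrite perm_cons pairs_of_D1.
rewrite !e !permM tpermL tpermR.
rewrite (_ : pairs_of _ (_ * s)%g = pairs_of (first_cols c :\ a :\ b) s); last first.
  apply/eq_in_map => j; rewrite mem_enum !inE => /and3P[jb ja _].
  by rewrite permM tpermD // eq_sym.
by apply: derivs_perm; apply/seq.permP => f /=; rewrite addnCA.
Qed.

(** Column lengths are removed from the largest down, which keeps the columns beyond the current
    minor at weight zero. At the identity matrix the Capelli operator and the minor in the
    derivations give the same value, so each step costs one positive factor. *)
Theorem capelli_columns (v : 'I_N -> k) (cs : seq nat) (kap : 'I_n -> nat) :
  (forall i j, v (x i j) = (i == j)%:R) ->
  sorted geq cs -> (forall a : 'I_n, kap a = count (fun c : nat => a < c)%N cs) ->
  exists2 d : nat, (0 < d)%N & forall P, highest kap P ->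
    d%:R * P.@[v] = (dop (\prod_(c <- cs) minor c) P).@[v].
Proof.
move=> v1; elim: cs kap => [|c cs IH] kap /= srt kapE.
  by exists 1%N => // P _; rewrite big_nil dop1 mul1r.
have le_c (c' : nat) : c' \in cs -> (c' <= c)%N.
  move=> c'cs; have tr : transitive geq by move=> a b d h1 h2; exact: leq_trans h2 h1.
  by have := order_path_min tr srt => /allP /(_ _ c'cs).
have kpos a : (a < c)%N -> (0 < kap a)%N by rewrite kapE => ->.
have k0 a : (c <= a)%N -> kap a = 0%N.
  rewrite kapE leqNgt => /negPf ca; rewrite ca add0n; apply/eqP.
  rewrite -leqn0 leqNgt -has_count; apply/hasPn => c' /le_c c'c.
  by rewrite -leqNgt (leq_trans c'c) // leqNgt ca.
have [|d d0 dE] := IH (fun a => kap a - (a < c))%N (path_sorted srt).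
  by move=> a; rewrite kapE addKn.
have [d' [d'E d'pos]] := capelli_scalar (first_cols c) kap.
exists (d * d')%N; first by rewrite muln_gt0 d0 d'pos // => a; rewrite inE => /kpos.
move=> P hP; rewrite big_cons dopM -dE; last exact: highest_dop_minor.
rewrite natrM -mulrA -mevalZ -d'E //; congr (_ * _).
rewrite dop_minor /capelli !raddf_sum; apply: eq_bigr => s _ /=.
by rewrite !mevalZ W_at_identity.
Qed.

End Capelli.

(** * Ballot conditions for leading monomials *)

Section Ballot.
Variables (k : fieldType) (N : nat).
Hypothesis char0 : [pchar k] =i pred0.
Implicit Types (P Q : {mpoly k[N]}) (m : 'X_{1..N}).

Lemma mcoeff_mulX_mderiv P a b m : a != b ->
  ('X_a * P^`M(b))@_m =
  if (0 < m a)%N then P@_(m - U_(a) + U_(b)) *+ (m b).+1 else 0.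
Proof.
move=> ab; rewrite mulrC; case: posnP => [e|m0].
  rewrite mcoeffM big1 // => -[m1 m2] /= /eqP em.
  rewrite mcoeffX; have [e2|] := eqVneq U_(a)%MM (m2 : 'X_{1..N}).
    have := congr1 (fun m0 : 'X_{1..N} => m0 a) em.
    by rewrite /= e mnmDE -e2 mnm1E eqxx addn1.
  by rewrite mulr0.
have em : (m - U_(a) + U_(a) = m)%MM by rewrite submK ?lep1mP // -lt0n.
rewrite -{1}em addmC mcoeffMX mcoeff_mderiv mnmBE mnm1E (negPf ab).
by rewrite subn0.
Qed.

Lemma size_prod_exp (w : 'I_N -> {poly k}) (d e : 'I_N -> nat) :
  (forall u, (size (w u) <= (d u).+1)%N) ->
  (size (\prod_u w u ^+ e u)%R <= (\sum_u d u * e u).+1)%N.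
Proof.
move=> wd; elim/big_rec2: _ => [|u s p _ IH]; first by rewrite size_poly1.
apply: leq_trans (size_polyMleq _ _) _.
have : (size (w u ^+ e u)%R <= (d u * e u).+1)%N.
  apply: leq_trans (size_poly_exp_leq _ _) _; rewrite ltnS leq_mul2r.
  by apply/orP; right; have := wd u; case: (size _).
move: IH; set z1 := size _; set z2 := size _; lia.
Qed.

(** The letters [c] index the entries of two neighbouring rows, or two neighbouring columns, of
    variables: [x1 c] lies in the first and [x2 c] in the second. The hypothesis [lead] below
    isolates what is used of [M] as a leading monomial. *)
Variables (C : finType) (rk : C -> nat) (x1 x2 : C -> 'I_N).
Hypothesis rk_inj : injective rk.
Hypothesis x1_inj : injective x1.
Hypothesis x2_inj : injective x2.
Hypothesis x12 : forall c c', x1 c != x2 c'.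

Variables (v : {mpoly k[N]}) (M : 'X_{1..N}).
Hypothesis v_inv : \sum_c 'X_(x1 c) * v^`M(x2 c) = 0.
Hypothesis vM : v@_M != 0.
Hypothesis lead : forall m, v@_m != 0 -> m != M ->
  (forall u, (forall c, u != x1 c) -> (forall c, u != x2 c) -> m u = M u) ->
  (forall c, m (x1 c) + m (x2 c) = M (x1 c) + M (x2 c))%N ->
  exists2 c, (m (x2 c) < M (x2 c))%N &
    forall c', (rk c < rk c')%N -> m (x2 c') = M (x2 c').

(* Restrict v to the monomials that differ from M only in the letters of rank at
   most that of c0, with the same total content.  The restriction g is invariant
   under x2 -> x2 + t x1 for these letters, so g(x1 + b x2, x2) and
   g(x1 + b x2, x1) agree up to the factor (-b)^-k; comparing degrees in b at a
   point with x1 c0 = 0 gives the inequality. *)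
Section Threshold.
Variable c0 : C.
Local Notation low := (fun c => rk c <= rk c0)%N.

Let K2 := (\sum_(c | low c) M (x2 c))%N.
Let K1 := (\sum_(c | low c) M (x1 c))%N.

Let same_outside m := [forall u, [|| m u == M u, [exists (c | low c), u == x1 c]
   | [exists (c | low c), u == x2 c]]].
Let same_content m := [forall (c | low c), m (x1 c) + m (x2 c) == M (x1 c) + M (x2 c)].
(** Here [d] is the amount by which the degree in the low [x2] falls short of that of [M]. The
    polynomial [g] below is supported in [cls 0], and its invariance is tested on monomials in
    [cls 1]. *)
Let cls d m := [&& same_outside m, same_content m &
  (d + \sum_(c | low c) m (x2 c))%N == K2].

Let outsideP m u : same_outside m -> (forall c, low c -> u != x1 c) ->
  (forall c, low c -> u != x2 c) -> m u = M u.
Proof.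
move=> /forallP/(_ u)/or3P[/eqP //|/exists_inP[c lc e]|/exists_inP[c lc e]] H1 H2.
  by have := H1 c lc; rewrite e.
by have := H2 c lc; rewrite e.
Qed.

Let contentP m c : same_outside m -> same_content m ->
  (m (x1 c) + m (x2 c) = M (x1 c) + M (x2 c))%N.
Proof.
move=> so /forall_inP sc; have [lc|lc] := leqP (rk c) (rk c0).
  exact/eqP/sc.
rewrite !(outsideP so) // => c' lc'; rewrite ?(inj_eq x1_inj) ?(inj_eq x2_inj) ?x12 //.
- by rewrite eq_sym x12.
- by apply: contraTneq lc => ->; rewrite -leqNgt.
- by apply: contraTneq lc => ->; rewrite -leqNgt.
Qed.

Let clsM : cls 0 M.
Proof.
rewrite /cls add0n eqxx andbT; apply/andP; split.
  by apply/forallP => u; rewrite eqxx.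
by apply/forall_inP => c _.
Qed.

Let move_up m c := (m - U_(x1 c) + U_(x2 c))%MM.

Let move_x1 m c c' : (0 < m (x1 c))%N ->
  (move_up m c (x1 c') + (c == c') = m (x1 c'))%N.
Proof.
move=> m0; rewrite mnmDE mnmBE !mnm1E (inj_eq x1_inj) [x2 c == _]eq_sym.
by rewrite (negPf (x12 _ _)) addn0; case: eqP => [<-|]; lia.
Qed.

Let move_x2 m c c' : (move_up m c (x2 c') = m (x2 c') + (c == c'))%N.
Proof.
by rewrite mnmDE mnmBE !mnm1E (inj_eq x2_inj) (negPf (x12 _ _)) subn0.
Qed.

Let move_out m c u : u != x1 c -> u != x2 c -> move_up m c u = m u.
Proof.
move=> u1 u2; rewrite mnmDE mnmBE !mnm1E ![_ == u]eq_sym.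
by rewrite (negPf u1) (negPf u2) subn0 addn0.
Qed.

Let cls_move m c : low c -> (0 < m (x1 c))%N -> cls 0 (move_up m c) = cls 1 m.
Proof.
move=> lc m0; rewrite /cls; congr [&& _, _ & _].
- apply: eq_forallb => u.
  have [_|] := boolP [exists (c' | low c'), u == x1 c']; first by rewrite !orbT.
  rewrite negb_exists_in => /forall_inP/(_ c lc) n1.
  have [_|] := boolP [exists (c' | low c'), u == x2 c']; first by rewrite !orbT.
  rewrite negb_exists_in => /forall_inP/(_ c lc) n2.
  by rewrite move_out.
- apply: eq_forallb => c'; congr (_ ==> (_ == _)).
  by rewrite -[in RHS](move_x1 c' m0) move_x2; lia.
- congr (_ == _); rewrite add0n (eq_bigr _ (fun c' _ => move_x2 m c c')).
  rewrite big_split addnC /=; congr (_ + _)%N.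
  by rewrite (bigD1 c) //= eqxx big1 // => c' /andP[_]; rewrite eq_sym => /negPf ->.
Qed.

Let g := \sum_(m <- msupp v | cls 0 m) v@_m *: 'X_[m].

Let coef_g m : g@_m = if cls 0 m then v@_m else 0.
Proof.
rewrite /g raddf_sum /=; under eq_bigr => m' _ do rewrite mcoeffZ mcoeffX.
have [mv|mv] := boolP (m \in msupp v); last first.
  rewrite big_seq_cond big1 ?memN_msupp_eq0 ?if_same // => m' /andP[m'v _].
  have [e|_] := eqVneq m' m; last by rewrite mulr0.
  by rewrite -e m'v in mv.
rewrite big_mkcond (bigD1_seq m) ?msupp_uniq //= big1 ?addr0.
  by rewrite eqxx mulr1.
by move=> m' m'm; rewrite (negPf m'm) mulr0 if_same.
Qed.

Let supp_g m : m \in msupp g -> cls 0 m /\ v@_m != 0.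
Proof.
by rewrite mcoeff_msupp coef_g; case: ifP => //; rewrite eqxx.
Qed.

Let g_inv : \sum_(c | low c) 'X_(x1 c) * g^`M(x2 c) = 0.
Proof.
apply/mpolyP => m; rewrite mcoeff0 raddf_sum /=.
under eq_bigr => c _ do rewrite mcoeff_mulX_mderiv // coef_g.
have [c1|c1] := boolP (cls 1 m); last first.
  rewrite big1 // => c lc; case: ifP => // m0.
  by rewrite -/(move_up m c) cls_move // (negPf c1) mul0rn.
have := congr1 (mcoeff m) v_inv; rewrite mcoeff0 raddf_sum /=.
rewrite (bigID low) /= [X in _ + X = _]big1 ?addr0 => [e|c /= hc]; first rewrite -[RHS]e.
  apply: eq_bigr => c lc; rewrite mcoeff_mulX_mderiv //; case: ifP => // m0.
  by rewrite -/(move_up m c) cls_move // c1.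
(* A letter above the threshold contributes nothing: the monomial it comes from would exceed [M] at
   [x2 c], where [c] is the highest letter with a difference, against [lead]. *)
rewrite mcoeff_mulX_mderiv //; case: ifP => // m0.
rewrite -ltnNge in hc; case/and3P: c1 => so sc _.
apply/eqP; rewrite -mulr_natr mulf_eq0 (negPf (natr_neq0 char0 _)) // orbF.
apply: contraTT isT => vm; rewrite -/(move_up m c) in vm.
have mx2 : m (x2 c) = M (x2 c).
  apply: outsideP => // c' lc'; first by rewrite eq_sym x12.
  by rewrite (inj_eq x2_inj); apply: contraTneq lc' => <-; rewrite -ltnNge.
case: (lead vm).
- by apply/eqP => e; have := move_x2 m c c; rewrite e eqxx mx2; lia.
- by move=> u u1 u2; rewrite move_out //; apply: outsideP.
- by move=> c'; rewrite -(contentP c' so sc) -(move_x1 c' m0) move_x2; lia.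
move=> c1 lt1 gt1; have cc1 : c != c1.
  by apply: contraTneq lt1 => <-; rewrite move_x2 eqxx mx2 -leqNgt leq_addr.
move: lt1; rewrite move_x2 (negPf cc1) addn0 => lt1.
have [lc|] := ltnP (rk c1) (rk c).
  by have := gt1 c lc; rewrite move_x2 eqxx mx2; lia.
rewrite leq_eqVlt (inj_eq rk_inj) (negPf cc1) /= => h1.
move: lt1; rewrite (outsideP so) ?ltnn // => c' lc'.
  by rewrite eq_sym x12.
rewrite (inj_eq x2_inj); apply: contraTneq lc' => <-.
by rewrite -ltnNge (ltn_trans hc).
Qed.

Section SetRows.
Variables (y : 'I_N -> k).

Definition set_rows (T : Type) (A B : C -> T) (z : 'I_N -> T) u :=
  if [pick c | low c && (u == x1 c)] is Some c then A c
  else if [pick c | low c && (u == x2 c)] is Some c then B c else z u.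

Lemma set_rows1 T A B (z : _ -> T) c : low c -> set_rows A B z (x1 c) = A c.
Proof.
move=> lc; rewrite /set_rows; case: pickP => [c' /andP[_ /eqP/x1_inj ->] //|].
by move/(_ c); rewrite lc eqxx.
Qed.

Lemma set_rows2 T A B (z : _ -> T) c : low c -> set_rows A B z (x2 c) = B c.
Proof.
move=> lc; rewrite /set_rows; case: pickP => [c' /andP[_]|_].
  by rewrite eq_sym (negPf (x12 _ _)).
case: pickP => [c' /andP[_ /eqP/x2_inj ->] //|].
by move/(_ c); rewrite lc eqxx.
Qed.

Lemma set_rows_out T A B (z : _ -> T) u : (forall c, low c -> u != x1 c) ->
  (forall c, low c -> u != x2 c) -> set_rows A B z u = z u.
Proof.
move=> u1 u2; rewrite /set_rows; case: pickP => [c /andP[lc e]|_].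
  by have := u1 c lc; rewrite e.
case: pickP => [c /andP[lc e]|_] //.
by have := u2 c lc; rewrite e.
Qed.

Lemma rows_case (R : 'I_N -> Prop) :
  (forall c, low c -> R (x1 c)) -> (forall c, low c -> R (x2 c)) ->
  (forall u, (forall c, low c -> u != x1 c) -> (forall c, low c -> u != x2 c) -> R u)
  -> forall u, R u.
Proof.
move=> R1 R2 R3 u; have [/exists_inP[c lc /eqP->]|n1] :=
  boolP [exists (c | low c), u == x1 c]; first exact: R1.
have [/exists_inP[c lc /eqP->]|n2] :=
  boolP [exists (c | low c), u == x2 c]; first exact: R2.
apply: R3 => c lc.
  by move: n1; rewrite negb_exists_in => /forall_inP/(_ c lc).
by move: n2; rewrite negb_exists_in => /forall_inP/(_ c lc).
Qed.

Let G A B := g.@[set_rows A B y].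

(** The derivative in [t] along the shear is the expression of [g_inv] evaluated on the curve, so
    the restriction of [g] is constant. *)
Let G_shear A B t : G A (fun c => B c + t * A c) = G A B.
Proof.
pose w u : {poly k} := set_rows (fun c => (A c)%:P)
  (fun c => (B c)%:P + (A c)%:P * 'X) (fun u => (y u)%:P) u.
have wE b u : (w u).[b] = set_rows A (fun c => B c + b * A c) y u.
  elim/rows_case: u => [c lc|c lc|u u1 u2]; rewrite /w.
  - by rewrite !set_rows1 // hornerE.
  - by rewrite !set_rows2 // !hornerE mulrC.
  - by rewrite !set_rows_out // hornerE.
have -> : G A B = (curve_eval w g).[0].
  rewrite horner_curve; apply: meval_eq => u; rewrite wE.
  elim/rows_case: u => [c lc|c lc|u u1 u2]; rewrite ?set_rows1 ?set_rows2 //.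
    by rewrite mul0r addr0.
  by rewrite !set_rows_out.
have -> : G A (fun c => B c + t * A c) = (curve_eval w g).[t].
  by rewrite horner_curve; apply: meval_eq => u; rewrite wE.
rewrite (poly_const_deriv0 char0 (q := curve_eval w g)) ?hornerC //.
have e0 : \sum_(c | low c) (A c)%:P * curve_eval w g^`M(x2 c) = 0.
  have := congr1 (curve_eval w) g_inv; rewrite /curve_eval !raddf_sum /= raddf0.
  move=> e; rewrite -[RHS]e; apply: eq_bigr => c lc.
  by rewrite rmorphM /= mmapX mmap1U {2}/w set_rows1.
rewrite deriv_curve -[RHS]e0.
rewrite (bigID (fun u => [exists (c | low c), u == x2 c])) /= [X in _ + X]big1.
  rewrite addr0 (reindex_onto x2 (fun u => odflt c0 [pick c | low c && (u == x2 c)])) /=.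
    apply: eq_big => [c|c lc].
      apply/andP/idP => [[/exists_inP[c' lc' /eqP/x2_inj ->]] //|lc].
      split; first by apply/exists_inP; exists c.
      case: pickP => [c' /andP[_ /eqP/x2_inj ->] //|/(_ c)].
      by rewrite lc eqxx.
    have {}lc : low c.
      by case/andP: lc => /exists_inP[c' lc' /eqP/x2_inj ->].
    rewrite {2}/w set_rows2 // derivD derivC derivM derivC derivX.
    by rewrite mul0r add0r mulr1 add0r mulrC.
  move=> u /exists_inP[c lc /eqP->].
  case: pickP => [c' /andP[_ /eqP <-] //|/(_ c)].
  by rewrite lc eqxx.
move=> u /negP n2; rewrite [X in _ * X](_ : _ = 0) ?mulr0 //.
move: n2; elim/rows_case: u => [c lc|c lc|u u1 u2] n2; rewrite /w.
- by rewrite set_rows1 // derivC.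
- by case: n2; apply/exists_inP; exists c.
- by rewrite set_rows_out // derivC.
Qed.

Let ind2 u : nat := (\sum_(c | low c) (u == x2 c))%N.
Let ind1 u : nat := (\sum_(c | low c) (u == x1 c))%N.

Let sum_ind (z : C -> 'I_N) m :
  (\sum_u (\sum_(c | low c) (u == z c)) * m u = \sum_(c | low c) m (z c))%N.
Proof.
under eq_bigr => u _ do rewrite big_distrl /=.
rewrite exchange_big /=; apply: eq_bigr => c lc.
rewrite (bigD1 (z c)) //= eqxx mul1n big1 ?addn0 // => u /negPf ->.
by rewrite mul0n.
Qed.

Let G_hom A B s : G A (fun c => s * B c) = s ^+ K2 * G A B.
Proof.
rewrite /G !mevalE mulr_sumr; apply: eq_big_seq => m /supp_g[/and3P[_ _ mK] _].
rewrite mulrCA; congr (_ * _); rewrite add0n in mK.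
rewrite -(eqP mK) -(sum_ind x2) -/ind2 expr_sum -big_split; apply: eq_bigr => u _ /=.
rewrite exprM -exprMn; congr (_ ^+ _).
elim/rows_case: u => [c lc|c lc|u u1 u2].
- rewrite !set_rows1 // /ind2 big1 ?mul1r // => c' _.
  by rewrite (negPf (x12 _ _)).
- rewrite !set_rows2 // /ind2 (bigD1 c) //= eqxx big1 ?expr1 // => c' /andP[_ n].
  by rewrite (inj_eq x2_inj) eq_sym (negPf n).
- rewrite !set_rows_out // /ind2 big1 ?mul1r // => c' lc'.
  by rewrite (negPf (u2 _ lc')).
Qed.

Hypothesis y0 : y (x2 c0) != 0.
Hypothesis not_ballot : (\sum_(c | rk c < rk c0) M (x1 c) < K2)%N.

Let K1_split : K1 = (M (x1 c0) + \sum_(c | rk c < rk c0) M (x1 c))%N.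
Proof.
rewrite /K1 (bigD1 c0) //=; congr (_ + _)%N; apply: eq_bigl => c.
by rewrite ltn_neqAle (inj_eq rk_inj) andbC.
Qed.

Lemma g_eval0 : g.@[y] = 0.
Proof.
(* The given point is the value at [b0] of the curve [(A + b B, B)], and on this curve the
   coordinate at [x1 c0] is a pure multiple of [b]. *)
pose b0 := y (x1 c0) / y (x2 c0).
pose B c := y (x2 c); pose A c := y (x1 c) - b0 * B c.
have A0 : A c0 = 0 by rewrite /A /B /b0 divfK // subrr.
pose w (E : C -> k) u : {poly k} := set_rows
  (fun c => (A c)%:P + (B c)%:P * 'X) (fun c => (E c)%:P) (fun u => (y u)%:P) u.
have wE E b u : (w E u).[b] = set_rows (fun c => A c + b * B c) E y u.
  elim/rows_case: u => [c lc|c lc|u u1 u2]; rewrite /w.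
  - by rewrite !set_rows1 // !hornerE mulrC.
  - by rewrite !set_rows2 // !hornerE.
  - by rewrite !set_rows_out // hornerE.
pose q := curve_eval (w B) g.
have qE b : q.[b] = G (fun c => A c + b * B c) B.
  by rewrite horner_curve; apply: meval_eq => u; rewrite wE.
have <- : q.[b0] = g.@[y].
  rewrite qE; apply: meval_eq => u.
  elim/rows_case: u => [c lc|c lc|u u1 u2].
  - by rewrite set_rows1 // /A subrK.
  - by rewrite set_rows2.
  - by rewrite set_rows_out.
suff -> : q = 0 by rewrite horner0.
apply/eqP/negPn/negP => q0.
(* Homogeneity turns [b ^ K2] times [g(A + b B, B)] into [g(A + b B, b B)]; the shear by [-1]
   subtracts the first row from the second and leaves [-A] there. *)
have qX : 'X^K2 * q = (-1) ^+ K2 *: curve_eval (w A) g.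
  apply/eqP; rewrite -subr_eq0; apply/eqP/(poly_eq0_nonzero_points char0) => b _.
  rewrite hornerD hornerN hornerM hornerXn hornerZ qE -G_hom.
  have -> : (curve_eval (w A) g).[b] = G (fun c => A c + b * B c) A.
    by rewrite horner_curve; apply: meval_eq => u; rewrite wE.
  rewrite -(G_shear _ _ (-1)) -G_hom; apply/eqP; rewrite subr_eq0; apply/eqP.
  apply: meval_eq => u; elim/rows_case: u => [c lc|c lc|u u1 u2].
  - by rewrite !set_rows1.
  - by rewrite !set_rows2 // !mulN1r opprD addrCA subrr addr0.
  - by rewrite !set_rows_out.
have sz : (size ('X^K2 * q)%R <= K1.+1)%N.
  rewrite qX; apply: leq_trans (size_scale_leq _ _) _.
  rewrite /curve_eval /mmap; apply: leq_trans (size_sum _ _ _) _.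
  apply/bigmax_leqP_seq => m mg _; rewrite mul_polyC.
  apply: leq_trans (size_scale_leq _ _) _.
  have [/and3P[so sc mK] _] := supp_g mg.
  apply: leq_trans (@size_prod_exp _ ind1 _ _) _ => [u|].
    elim/rows_case: u => [c lc|c lc|u u1 u2]; rewrite /w.
    - rewrite set_rows1 // /ind1 (bigD1 c) //= eqxx.
      apply: leq_trans (size_polyD _ _) _; rewrite geq_max size_polyC mul_polyC.
      rewrite (leq_trans (leq_b1 _)) //= (leq_trans (size_scale_leq _ _)) //.
      by rewrite size_polyX add1n ltnS.
    - by rewrite set_rows2 // size_polyC (leq_trans (leq_b1 _)).
    - by rewrite set_rows_out // size_polyC (leq_trans (leq_b1 _)).
  rewrite /ind1 sum_ind ltnS.
  suff : (\sum_(c | low c) m (x1 c) + \sum_(c | low c) m (x2 c) = K1 + K2)%N.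
    by move/eqP: mK; rewrite add0n => ->; lia.
  rewrite /K1 /K2 -!big_split; apply: eq_bigr => c _ /=; exact: contentP.
(* Among the monomials of [g], [lead] gives [M] the largest exponent at [x2 c0], hence by equal
   content the smallest one at [x1 c0]. *)
have dv : 'X^(M (x1 c0)) %| q.
  rewrite /q /curve_eval /mmap big_seq; apply: (big_ind (fun p : {poly k} => 'X^(M (x1 c0)) %| p)) => //.
    by move=> p1 p2; apply: dvdp_add.
  move=> m mg; rewrite dvdp_mull // /mmap1 (bigD1 (x1 c0)) //= dvdp_mulr //.
  rewrite /w set_rows1 // A0 polyC0 add0r exprMn dvdp_mull // dvdp_exp2l //.
  have [cm vm] := supp_g mg; have [-> //|mM] := eqVneq m M.
  have /and3P[so sc _] := cm.
  have cont := contentP c0 so sc.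
  have [||c lt1 gt1] := lead vm mM.
  - by move=> u u1 u2; apply: outsideP.
  - by move=> c; apply: contentP.
  suff : (m (x2 c0) <= M (x2 c0))%N by lia.
  have [lc|hc] := leqP (rk c) (rk c0); last first.
    move: lt1; rewrite (outsideP so) ?ltnn // => c' lc'.
      by rewrite eq_sym x12.
    by rewrite (inj_eq x2_inj); apply: contraTneq lc' => <-; rewrite -ltnNge.
  move: lc; rewrite leq_eqVlt (inj_eq rk_inj) => /orP[/eqP <-|/gt1 -> //].
  exact: ltnW.
(* A nonzero [q] would give [K2 + M (x1 c0) <= K1], which is the ballot inequality. *)
have := dvdp_leq q0 dv; rewrite size_polyXn.
move: sz; rewrite mulrC size_mulXn // K1_split.
by move: not_ballot; set S1 := (\sum_(c | _) _)%N; set sq := size q; lia.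
Qed.

End SetRows.

Lemma ballot_at :
  (\sum_(c | rk c <= rk c0) M (x2 c) <= \sum_(c | rk c < rk c0) M (x1 c))%N.
Proof.
rewrite leqNgt; apply/negP => nb.
(* The extra factor takes care of the points where [y (x2 c0) = 0]. *)
have /eqP : g * 'X_(x2 c0) = 0.
  apply: (meval_eq0 char0) => y; rewrite mevalM mevalXU.
  by have [->|y0] := eqVneq (y (x2 c0)) 0; rewrite ?mulr0 // (g_eval0 y0 nb) mul0r.
rewrite mulf_eq0 => /orP[/eqP g0|/eqP/(congr1 (mcoeff U_(x2 c0)%MM))].
  by have := coef_g M; rewrite g0 mcoeff0 clsM => /esym/eqP; rewrite (negPf vM).
by rewrite mcoeff0 mcoeffX eqxx => /eqP; rewrite oner_eq0.
Qed.

End Threshold.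

End Ballot.

(** * Counting arguments for permutations that preserve columns *)

Lemma eq_of_leq_sum (I : eqType) (s : seq I) (f g : I -> nat) :
  (forall i, i \in s -> f i <= g i)%N -> (\sum_(i <- s) g i <= \sum_(i <- s) f i)%N ->
  forall i, i \in s -> f i = g i.
Proof.
elim: s => [|j s IH] //= fg; rewrite !big_cons => H.
have fgs : forall i, i \in s -> (f i <= g i)%N by move=> i si; apply: fg; rewrite inE si orbT.
have Hs : (\sum_(i <- s) f i <= \sum_(i <- s) g i)%N.
  by rewrite !big_seq; apply: leq_sum.
have fgj := fg j (mem_head _ _).
move=> i; rewrite inE => /orP[/eqP->|]; first by lia.
by apply: IH => //; lia.
Qed.

Lemma eq_of_leq_sum_fin (I : finType) (f g : I -> nat) :
  (forall i, f i <= g i)%N -> (\sum_i g i <= \sum_i f i)%N -> f =1 g.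
Proof.
move=> fg H i; by apply: (@eq_of_leq_sum _ (index_enum I)).
Qed.

(** A permutation does not change the sum of [f], so it cannot raise [f] somewhere without lowering
    it elsewhere. *)
Lemma perm_nondecreasing (Z : finType) (p : {perm Z}) (f : Z -> nat) :
  (forall b, f b <= f (p b))%N -> forall b, f (p b) = f b.
Proof.
move=> H b; apply/esym/(@eq_of_leq_sum_fin Z f (f \o p)) => //=.
by rewrite [leqRHS](reindex_inj (@perm_inj _ p)) /=.
Qed.

Section Cut.
Variables (Z : finType) (J : eqType) (cl : Z -> J) (row : Z -> nat) (p : {perm Z}).
Hypothesis p_cl : forall b, cl (p b) = cl b.

Definition top_closed (A : {set Z}) := forall b b',
  cl b = cl b' -> (row b <= row b')%N -> b' \in A -> b \in A.

Variables A B : {set Z}.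
Hypotheses (topA : top_closed A) (topB : top_closed B).

Let X := [set b in B | p b \in A].
Let part (Y : {set Z}) j := [set b in Y | cl b == j].
Let classes := undup (map cl (enum Z)).

Let card_parts (Y : {set Z}) : #|Y| = (\sum_(j <- classes) #|part Y j|)%N.
Proof.
under eq_bigr => j _ do rewrite -sum1_card big_mkcond /=.
rewrite exchange_big /= -sum1_card big_mkcond /=; apply: eq_bigr => b _.
rewrite (bigD1_seq (cl b)) ?undup_uniq ?mem_undup ?map_f ?mem_enum //=.
rewrite inE eqxx andbT big1 ?addn0 // => j ji.
by rewrite inE eq_sym (negPf ji) andbF.
by rewrite -enumT mem_enum.
Qed.

Let chain j : part A j \subset part B j \/ part B j \subset part A j.
Proof.
have [|/subsetPn[a]] := boolP (part A j \subset part B j); first by left.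
rewrite !inE => /andP[aA /eqP aj] naB; right; apply/subsetP => b.
rewrite !inE => /andP[bB /eqP bj]; rewrite bj eqxx andbT.
apply: (topA (b' := a)); rewrite ?aj // leqNgt; apply: contra naB => ab.
by rewrite aj eqxx andbT; apply: (topB (b' := b)); rewrite ?aj // ltnW.
Qed.

Let card_pre j : #|[set b | (cl b == j) && (p b \in A)]| = #|part A j|.
Proof.
rewrite -(card_imset _ (@perm_inj _ p)); apply: eq_card => b.
apply/imsetP/idP => [[a] | ]; rewrite !inE.
  by move=> /andP[aj aA] ->; rewrite aA p_cl.
move=> /andP[bA bj]; exists ((p^-1)%g b); last by rewrite permKV.
by rewrite inE permKV bA -p_cl permKV bj.
Qed.

Let cut_part j : (#|part X j| <= #|part (A :&: B) j|)%N.
Proof.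
case: (chain j) => /subsetP s.
  apply: leq_trans (_ : #|part A j| <= _)%N.
    rewrite -card_pre; apply/subset_leq_card/subsetP => b; rewrite !inE.
    by move=> /andP[/andP[_ ->] ->].
  apply/subset_leq_card/subsetP => b bA; have := s b bA; move: bA.
  by rewrite !inE => /andP[-> ->] /andP[->].
apply/subset_leq_card/subsetP => b; rewrite !inE => /andP[/andP[bB _] bj].
by have := s b; rewrite !inE bB bj => /(_ isT)/andP[->].
Qed.

(** In each class the parts of [A] and [B] are nested, so their intersection is the smaller of the
    two, and no permutation of the class brings more elements of [B] into [A]. *)
Lemma cut_le : (#|X| <= #|A :&: B|)%N.
Proof. by rewrite !card_parts; apply: leq_sum => j _; apply: cut_part. Qed.

(** Equality of the totals forces equality class by class. In a class where [A] is the smaller part,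
    its whole preimage then lies in [B]. *)
Lemma cut_eq b : (#|A :&: B| <= #|X|)%N -> p b \in A ->
  (forall b', cl b' = cl b -> b' \in A -> b' \in B) -> b \in B.
Proof.
rewrite !card_parts => H pbA sub.
have e := eq_of_leq_sum (fun j _ => cut_part j) H.
have {e}e := e (cl b); have cb : cl b \in classes by rewrite mem_undup map_f // mem_enum.
have {}e := e cb.
have eAB : part (A :&: B) (cl b) = part A (cl b).
  apply/setP => b'; rewrite !inE; have [bb|] := eqVneq (cl b') (cl b); last by rewrite !andbF.
  by rewrite !andbT; case: (boolP (b' \in A)) => // /(sub _ bb) ->.
rewrite eAB -card_pre in e.
have /eqP eX : part X (cl b) == [set b' | (cl b' == cl b) && (p b' \in A)].
  rewrite eqEcard e leqnn andbT; apply/subsetP => b'; rewrite !inE.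
  by move=> /andP[/andP[_ ->] ->].
have : b \in part X (cl b) by rewrite eX inE eqxx.
by rewrite !inE => /andP[/andP[]].
Qed.

End Cut.

(** Differences in [y] count the indices with [y < f i], that is, they give the conjugate partition,
    which determines an antitone sequence. *)
Lemma eq_antitone_sum_minn (r Y : nat) (f g : 'I_r -> nat) :
  (forall i i' : 'I_r, i <= i' -> f i' <= f i)%N ->
  (forall i i' : 'I_r, i <= i' -> g i' <= g i)%N ->
  (forall i, f i <= Y)%N -> (forall i, g i <= Y)%N ->
  (forall y, (y <= Y)%N -> \sum_i minn y (f i) = \sum_i minn y (g i))%N -> f =1 g.
Proof.
have cardE (h : 'I_r -> nat) y :
    (\sum_i minn y.+1 (h i) = #|[set i | y < h i]| + \sum_i minn y (h i))%N.
  rewrite -sum1_card [X in (X + _)%N]big_mkcond -big_split; apply: eq_bigr => i _ /=.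
  by rewrite inE; case: ifP; lia.
have key (f1 g1 : 'I_r -> nat) i0 :
    (forall i i' : 'I_r, i <= i' -> f1 i' <= f1 i)%N ->
    (forall i i' : 'I_r, i <= i' -> g1 i' <= g1 i)%N -> (f1 i0 <= Y)%N ->
    (forall y, (y <= Y)%N -> \sum_i minn y (f1 i) = \sum_i minn y (g1 i))%N ->
    (f1 i0 <= g1 i0)%N.
  move=> mf mg fY e; rewrite leqNgt; apply/negP => gf.
  have := e (g1 i0).+1; rewrite !cardE e; last by lia.
  move=> e2; have {e2} : (#|[set i | g1 i0 < f1 i]| = #|[set i | g1 i0 < g1 i]|)%N.
    by apply/eqP; rewrite -(eqn_add2r (\sum_i minn (g1 i0) (g1 i))) e2 //; lia.
  suff : ([set i | g1 i0 < g1 i] \proper [set i | g1 i0 < f1 i])%N.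
    by move/proper_card => l1 l2; move: l1; rewrite l2 ltnn.
  apply/properP; split; last by exists i0; rewrite !inE // ltnn.
  apply/subsetP => i; rewrite !inE => gi; have [ii|ii] := leqP i i0.
    by rewrite (leq_trans gf) // mf.
  by move: gi; rewrite ltnNge mg // ltnW.
move=> mf mg fY gY e i; apply/eqP; rewrite eqn_leq.
by apply/andP; split; apply: key => // y yY; rewrite e.
Qed.

Section Transport.
Variables (E F : finType) (al : F -> E) (al' : E -> F).
Hypotheses (alK : cancel al al') (al'K : cancel al' al).

Lemma transport_subproof (s : {perm E}) : injective (fun a => al' (s (al a))).
Proof. by move=> a b /(can_inj al'K)/perm_inj/(can_inj alK). Qed.

Definition transport (s : {perm E}) : {perm F} := perm (@transport_subproof s).

Lemma transportE s a : transport s a = al' (s (al a)).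
Proof. by rewrite permE. Qed.

Lemma odd_transport s : odd_perm (transport s) = odd_perm s.
Proof.
have [ts -> dts] := prod_tpermP s.
elim: ts dts => [|[x y] ts IH] /=.
  move=> _; rewrite !big_nil (_ : transport 1 = 1%g) ?odd_perm1 //.
  by apply/perm.permP => a; rewrite transportE !perm1 alK.
move=> /andP[xy /IH e]; rewrite !big_cons /=.
have -> : transport (tperm x y * \prod_(t <- ts) tperm t.1 t.2) =
    (tperm (al' x) (al' y) * transport (\prod_(t <- ts) tperm t.1 t.2))%g.
  apply/perm.permP => a; rewrite permM !transportE permM; congr (al' (_ _)).
  case: (tpermP x y (al a)) => [<-|<-|nx ny].
  - by rewrite alK tpermL al'K.
  - by rewrite alK tpermR al'K.
  - by rewrite tpermD //; apply/eqP => e'; [apply: nx | apply: ny]; rewrite -e' al'K.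
rewrite !odd_permM e !odd_tperm; congr (_ (+) _).
by rewrite (inj_eq (can_inj al'K)).
Qed.

End Transport.

(** * Variables indexed by triples, and the two ballot conditions *)

Section Indexing.
Variables m r s : nat.

Local Notation T := ('I_m * 'I_r * 'I_s)%type.
Local Notation N := (m * r * s)%N.

Definition row_letter (u : T) := (u.1.1 * s + u.2)%N.
Definition col_letter (u : T) := (u.1.1 * r + u.1.2)%N.
Definition var_rank (u : T) := ((u.1.1 * r + u.1.2) * s + u.2)%N.

Lemma var_rank_lt u : (var_rank u < N)%N.
Proof.
case: u => [[[l hl] [i hi]] [j hj]]; rewrite /var_rank /=.
have h1 : (l * r + i < m * r)%N by nia.
by nia.
Qed.

(* Decreasing in var_rank: multinomials order monomials by their first
   differing exponent, and we need to compare at the last triple (l, i, j). *)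
Definition vix (u : T) : 'I_N := rev_ord (Ordinal (var_rank_lt u)).

Lemma divmod_inj d a b a' b' : (b < d)%N -> (b' < d)%N ->
  (a * d + b = a' * d + b')%N -> a = a' /\ b = b'.
Proof.
move=> bd b'd e; have e1 := congr1 (divn^~ d) e; have e2 := congr1 (modn^~ d) e.
move: e1 e2; rewrite /= !modnMDl !modn_small // !divnMDl ?(leq_ltn_trans _ bd) //.
by rewrite !divn_small // !addn0.
Qed.

Lemma lex_ltn d a b a' b' : (b < d)%N -> (b' < d)%N ->
  (a * d + b < a' * d + b')%N = ((a < a') || ((a == a') && (b < b')))%N.
Proof.
move=> bd b'd; case: (ltngtP a a') => [aa|aa|->] /=; last by rewrite ltn_add2l.
  have h : (a.+1 * d <= a' * d)%N by rewrite leq_mul2r aa orbT.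
  by rewrite mulSn in h; lia.
have h : (a'.+1 * d <= a * d)%N by rewrite leq_mul2r aa orbT.
by rewrite mulSn in h; lia.
Qed.

Lemma row_letter_inj (u u' : T) : row_letter u = row_letter u' ->
  u.1.1 = u'.1.1 /\ u.2 = u'.2.
Proof. by case/divmod_inj => // /val_inj -> /val_inj ->. Qed.

Lemma col_letter_inj (u u' : T) : col_letter u = col_letter u' -> u.1 = u'.1.
Proof.
case: u u' => [[l i] j] [[l' i'] j'] /divmod_inj[] //=.
by move=> /val_inj -> /val_inj ->.
Qed.

Lemma vix_inj : injective vix.
Proof.
move=> u u' /rev_ord_inj/(congr1 val) /=; rewrite /var_rank => /divmod_inj[] //.
move=> /divmod_inj[] // e1 e2 e3.
by case: u u' e1 e2 e3 => [[l i] j] [[l' i'] j'] /= /val_inj-> /val_inj-> /val_inj->.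
Qed.

Lemma vix_surj n : exists u, n = vix u.
Proof.
have [g _ gK] : bijective vix.
  by apply: inj_card_bij vix_inj _; rewrite !card_prod !card_ord.
by exists (g n); rewrite gK.
Qed.

Lemma ltn_vix u u' : (vix u < vix u')%N = (var_rank u' < var_rank u)%N.
Proof. by have := var_rank_lt u; have := var_rank_lt u'; rewrite /=; lia. Qed.

Definition msum (M : 'X_{1..N}) (K : pred T) := (\sum_(u | K u) M (vix u))%N.

(* The letters (l, j) of row i, and the letters (l, i) of column j, are ordered
   lexicographically and coded by integers. *)
Definition rc M i L := msum M (fun u => (u.1.2 == i) && (row_letter u < L)%N).
Definition cc M j L := msum M (fun u => (u.2 == j) && (col_letter u < L)%N).

(** If the letters of row [i], sorted, fill row [i] of a left-justified array, the inequality says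
    that the columns of the array increase strictly. *)
Definition row_ballot M := forall (i i' : 'I_r) L, i' = i.+1 :> nat ->
  (L < m * s)%N -> (rc M i' L.+1 <= rc M i L)%N.
Definition col_ballot M := forall (j j' : 'I_s) L, j' = j.+1 :> nat ->
  (L < m * r)%N -> (cc M j' L.+1 <= cc M j L)%N.

Lemma leq_rc M i L L' : (L <= L')%N -> (rc M i L <= rc M i L')%N.
Proof.
move=> le; rewrite /rc /msum [leqRHS](bigID (fun u : T => row_letter u < L)%N) /=.
apply: leq_trans (leq_addr _ _); rewrite leq_eqVlt; apply/orP; left; apply/eqP.
by apply: eq_bigl => u; case: eqP => //= _; apply/idP/andP => [h|[]//]; split => //; lia.
Qed.

Lemma rc_row u M : (rc M u.1.2 (row_letter u).+1 = rc M u.1.2 (row_letter u) + M (vix u))%N.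
Proof.
rewrite /rc /msum (bigD1 u) /=; last by rewrite eqxx ltnS leqnn.
rewrite addnC; congr (_ + _)%N; apply: eq_bigl => u'.
have [e|ne] /= := eqVneq u'.1.2 u.1.2; last by rewrite ?andbF.
apply/andP/idP => [[le ne]|lt].
  rewrite ltnS leq_eqVlt in le; case/orP: le => // /eqP/row_letter_inj[e1 e2].
  case/negP: ne; case: u u' e e1 e2 => [[l i] j] [[l' i'] j'] /= -> -> ->.
  by rewrite eqxx.
by split; [lia | apply: contraTneq lt => ->; rewrite ltnn].
Qed.

Lemma row_letter_lt u : (row_letter u < m * s)%N.
Proof. by case: u => [[[l hl] i] [j hj]]; rewrite /row_letter /=; nia. Qed.

Lemma col_letter_lt u : (col_letter u < m * r)%N.
Proof. by case: u => [[[l hl] [i hi]] j]; rewrite /col_letter /=; nia. Qed.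

Lemma rc_antitone M L : row_ballot M -> (L <= m * s)%N ->
  forall i i' : 'I_r, (i <= i')%N -> (rc M i' L <= rc M i L)%N.
Proof.
move=> bM LL; have step (i i' : 'I_r) : i' = i.+1 :> nat -> (rc M i' L <= rc M i L)%N.
  move=> e; case: L LL => [|L] LL; last first.
    by apply: leq_trans (leq_rc _ _ (leqnSn L)); apply: bM.
  by rewrite /rc /msum big1 // => u; rewrite ltn0 andbF.
move=> i i'; move e : (i' - i)%N => d; elim: d i' e => [|d IH] i' e ii.
  by rewrite (_ : i' = i) //; apply/val_inj => /=; lia.
have h : (i'.-1 < r)%N by have := ltn_ord i'; lia.
apply: leq_trans (step (Ordinal h) i' _) _ => /=; first by lia.
by apply: IH => /=; lia.
Qed.

End Indexing.

Section Leading.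
Variables (k : fieldType) (m r s : nat).
Hypothesis char0 : [pchar k] =i pred0.
Local Notation T := ('I_m * 'I_r * 'I_s)%type.
Local Notation N := (m * r * s)%N.
Variables (v : {mpoly k[N]}) (t : nat).
Hypothesis v_deg : forall M, M \in msupp v -> mdeg M = t.
Hypothesis v0 : v != 0.

Let lead_lt M : v@_M != 0 -> M != mlead v ->
  exists2 u : T, (M (vix u) < mlead v (vix u))%N &
    forall u', (var_rank u < var_rank u')%N -> M (vix u') = mlead v (vix u').
Proof.
move=> vM ne; have Mv : M \in msupp v by rewrite mcoeff_msupp.
have : (M < mlead v)%O by rewrite lt_neqAle ne msupp_le_mlead.
(* The monomial order compares degrees first; homogeneity of [v] leaves only the comparison of
   exponents. *)
have e : mdeg M = mdeg (mlead v) by rewrite !v_deg // mlead_supp.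
move=> /(ltmcP e)[n eq_n lt_n]; have [u eu] := vix_surj n.
exists u; first by rewrite -eu.
by move=> u' h; apply: eq_n; rewrite eu ltn_vix.
Qed.

Lemma row_ballot_mlead :
  (forall i i' : 'I_r, i' = i.+1 :> nat ->
    \sum_(c : 'I_m * 'I_s) 'X_(vix (c.1, i, c.2)) * v^`M(vix (c.1, i', c.2)) = 0) ->
  row_ballot (mlead v).
Proof.
move=> inv i i' L ii Lms; set M := mlead v.
have s0 : (0 < s)%N by case: (s) Lms => //; rewrite muln0.
have h1 : (L %/ s < m)%N by rewrite ltn_divLR.
pose c0 : 'I_m * 'I_s := (Ordinal h1, Ordinal (ltn_pmod L s0)).
pose rk (c : 'I_m * 'I_s) := row_letter (c.1, i, c.2).
have rk0 : rk c0 = L by rewrite /rk /row_letter /= -divn_eq.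
have rcE (i1 : 'I_r) L1 : rc M i1 L1 =
    (\sum_(c : 'I_m * 'I_s | rk c < L1) M (vix (c.1, i1, c.2)))%N.
  rewrite /rc /msum (reindex_onto (fun c : 'I_m * 'I_s => (c.1, i1, c.2))
     (fun u : T => (u.1.1, u.2))) /=.
    by apply: eq_bigl => -[l j]; rewrite !eqxx /= andbT.
  by case=> [[l i2] j] /= /andP[/eqP -> _].
rewrite !rcE -rk0; under eq_bigl => c do rewrite ltnS.
have ne_ii : i != i' by rewrite -val_eqE /= ii neq_ltn ltnSn.
apply: (@ballot_at _ _ char0 _ rk (fun c => vix (c.1, i, c.2))
  (fun c => vix (c.1, i', c.2)) _ _ _ _ v M).
- by case=> [l j] [l' j'] /row_letter_inj /= [-> ->].
- by case=> [l j] [l' j'] /vix_inj /= [-> ->].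
- by case=> [l j] [l' j'] /vix_inj /= [-> ->].
- by move=> c c'; rewrite (inj_eq (@vix_inj _ _ _)) !xpair_eqE (negPf ne_ii) andbF.
- exact: inv.
- by rewrite -mcoeff_msupp mlead_supp.
move=> M' vM' ne out cont; have [[[l i1] j] lt1 gt1] := lead_lt vM' ne.
have [e1|n1] := eqVneq i1 i'.
  exists (l, j) => [|[l' j'] rr]; first by rewrite /= -e1.
  apply: gt1 => /=; move: rr; rewrite /rk /row_letter /var_rank /= e1.
  rewrite !lex_ltn // => /orP[->//|/andP[/eqP-> ->]].
  by rewrite !eqxx ?orbT.
(* The last difference cannot lie in row [i]: equal content would force a difference at the same
   letter in row [i'], which comes later in the order of triples. *)
have [e2|n2] := eqVneq i1 i.
  have : M' (vix (l, i', j)) = M (vix (l, i', j)).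
    by apply: gt1; rewrite /var_rank /= e2 lex_ltn // ii ltn_add2l ltnSn.
  by have := cont (l, j); rewrite /= -/M -e2; move: lt1; rewrite -/M; lia.
by move: lt1; rewrite out ?ltnn // => -[l' j']; rewrite (inj_eq (@vix_inj _ _ _))
  !xpair_eqE ?(negPf n1) ?(negPf n2) ?andbF.
Qed.

(** The order on triples that served rows serves columns too: on triples with a fixed [j] it is the
    order of the column letters, as it is that of the row letters on triples with a fixed [i]. *)
Lemma col_ballot_mlead :
  (forall j j' : 'I_s, j' = j.+1 :> nat ->
    \sum_(c : 'I_m * 'I_r) 'X_(vix (c, j)) * v^`M(vix (c, j')) = 0) ->
  col_ballot (mlead v).
Proof.
move=> inv j j' L jj Lmr; set M := mlead v.
have r0 : (0 < r)%N by case: (r) Lmr => //; rewrite muln0.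
have h1 : (L %/ r < m)%N by rewrite ltn_divLR.
pose c0 : 'I_m * 'I_r := (Ordinal h1, Ordinal (ltn_pmod L r0)).
pose rk (c : 'I_m * 'I_r) := col_letter (c, j).
have rk0 : rk c0 = L by rewrite /rk /col_letter /= -divn_eq.
have ccE (j1 : 'I_s) L1 : cc M j1 L1 =
    (\sum_(c : 'I_m * 'I_r | rk c < L1) M (vix (c, j1)))%N.
  rewrite /cc /msum (reindex_onto (fun c : 'I_m * 'I_r => (c, j1)) fst) /=.
    by apply: eq_bigl => -[l i]; rewrite !eqxx /= andbT.
  by case=> c j2 /= /andP[/eqP -> _].
rewrite !ccE -rk0; under eq_bigl => c do rewrite ltnS.
have ne_jj : j != j' by rewrite -val_eqE /= jj neq_ltn ltnSn.
apply: (@ballot_at _ _ char0 _ rk (fun c => vix (c, j))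
  (fun c => vix (c, j')) _ _ _ _ v M).
- by move=> c c' /col_letter_inj.
- by move=> c c' /vix_inj [].
- by move=> c c' /vix_inj [].
- by move=> c c'; rewrite (inj_eq (@vix_inj _ _ _)) !xpair_eqE (negPf ne_jj) andbF.
- exact: inv.
- by rewrite -mcoeff_msupp mlead_supp.
move=> M' vM' ne out cont; have [[c j1] lt1 gt1] := lead_lt vM' ne.
have [e1|n1] := eqVneq j1 j'.
  exists c => [|c' rr]; first by rewrite /= -e1.
  apply: gt1 => /=; move: rr; rewrite /rk /col_letter /var_rank /= e1.
  by rewrite !lex_ltn // => /orP[->//|/andP[/eqP-> ->]]; rewrite !eqxx ?orbT.
have [e2|n2] := eqVneq j1 j.
  have : M' (vix (c, j')) = M (vix (c, j')).
    by apply: gt1; rewrite /var_rank /= e2 jj ltn_add2l ltnSn.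
  by have := cont c; rewrite /= -/M -e2; move: lt1; rewrite -/M; lia.
by move: lt1; rewrite out ?ltnn // => c'; rewrite (inj_eq (@vix_inj _ _ _))
  xpair_eqE ?(negPf n1) ?(negPf n2) ?andbF.
Qed.

End Leading.

Definition colstab (Z : finType) (c : Z -> nat) : {set {perm Z}} :=
  [set p : {perm Z} | [forall b, c (p b) == c b]].

Lemma colstabP (Z : finType) (c : Z -> nat) (p : {perm Z}) :
  reflect (forall b, c (p b) = c b) (p \in colstab c).
Proof.
by rewrite inE; apply: (iffP forallP) => H b; [apply/eqP | apply/eqP/H].
Qed.

Lemma colstab1 (Z : finType) (c : Z -> nat) : 1%g \in colstab c.
Proof. by apply/colstabP => b; rewrite perm1. Qed.

(** * Triangularity of the generators *)

Section Upoly.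
Variables (k : fieldType) (m r s : nat).
Hypothesis char0 : [pchar k] =i pred0.
Local Notation T := ('I_m * 'I_r * 'I_s)%type.
Local Notation N := (m * r * s)%N.

Variables (F E : finType) (rF : F -> 'I_r) (cF : F -> nat) (rE : E -> 'I_s) (cE : E -> nat).
Variables (Q : F -> 'I_m) (al : F -> E).

Definition mon (z : F -> T) : 'X_{1..N} := (\sum_a U_(vix (z a)))%MM.

Definition ukey (p : {perm F}) (q : {perm E}) a : T := (Q a, rF (p a), rE (q (al a))).

Definition upoly : {mpoly k[N]} :=
  \sum_(p in colstab cF) \sum_(q in colstab cE)
    (-1) ^+ odd_perm p * (-1) ^+ odd_perm q *: 'X_[mon (ukey p q)].

Lemma msum_mon z (K : pred T) : msum (mon z) K = #|[set a | K (z a)]|.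
Proof.
rewrite /msum; under eq_bigr => u _ do rewrite mnm_sumE.
rewrite exchange_big -sum1_card [RHS]big_mkcond /=; apply: eq_bigr => a _.
rewrite inE; case: ifP => Ka; last first.
  rewrite big1 // => u Ku; rewrite mnm1E (inj_eq (@vix_inj _ _ _)).
  by case: eqP => // e; rewrite e Ku in Ka.
rewrite (bigD1 (z a)) //= mnm1E eqxx big1 ?addn0 // => u /andP[_ n].
by rewrite mnm1E (inj_eq (@vix_inj _ _ _)) eq_sym (negPf n).
Qed.

Lemma upoly_supp M : upoly@_M != 0 ->
  exists p q, [/\ p \in colstab cF, q \in colstab cE & mon (ukey p q) = M].
Proof.
move=> H; have [/existsP[p /existsP[q /and3P[pF qE /eqP e]]]|none] :=
  boolP [exists p, exists q, [&& p \in colstab cF, q \in colstab cE &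
    mon (ukey p q) == M]]; first by exists p, q.
case/eqP: H; rewrite /upoly raddf_sum big1 // => p pF /=.
rewrite raddf_sum big1 // => q qE /=; rewrite mcoeffZ mcoeffX.
case: eqP => e; last by rewrite mulr0.
case/negP: none; apply/existsP; exists p; apply/existsP; exists q.
by rewrite pF qE e eqxx.
Qed.

Variable al' : E -> F.
Hypotheses (alK : cancel al al') (al'K : cancel al' al).
Hypothesis rcF_inj : forall a a', rF a = rF a' -> cF a = cF a' -> a = a'.
Hypothesis rcE_inj : forall b b', rE b = rE b' -> cE b = cE b' -> b = b'.
Hypothesis cF_pos : forall a, (0 < cF a)%N.
Hypothesis cF_le : forall a, (cF a <= #|F|)%N.

Let P b := Q (al' b).
Let letter a := (Q a * s + rE (al a))%N.

Hypothesis P_ord : forall b b', cE b = cE b' -> (rE b <= rE b')%N -> (P b <= P b')%N.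
Hypothesis letter_col : forall a a', cF a = cF a' -> (rF a < rF a')%N ->
  (letter a < letter a')%N.
(** The boxes of a row with letter below [L] are its leftmost ones: weak increase along rows, in the
    form used for counting. *)
Hypothesis letter_row : forall i L y,
  #|[set a | [&& rF a == i, letter a < L & cF a <= y]]|%N =
  minn y #|[set a | (rF a == i) && (letter a < L)]|%N.
Hypothesis adm : forall a a', cE (al a) = cE (al a') -> Q a = Q a' ->
  (rE (al a) < rE (al a'))%N -> (cF a' <= cF a)%N.

Let M := mon (ukey 1 1).
Hypothesis M_ballot : row_ballot M.

(* A monomial M' occurring in upoly other than M has smaller Rtot, or the same
   Rtot and larger ctot: the permutations of columns can only move entries away
   from the top left corner. *)
Definition Rtot (M0 : 'X_{1..N}) :=
  (\sum_(lj : 'I_m * 'I_s) msum M0 (fun u : T => (u.1.1 <= lj.1) && (u.2 <= lj.2)))%N.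

Definition ctot Y (M0 : 'X_{1..N}) :=
  (\sum_(Ly : 'I_(m * s).+1 * 'I_Y.+1) \sum_i minn Ly.2 (rc M0 i Ly.1))%N.

(** The cut lemmas with the columns of [E] as classes, for the rows up to [j] against the entries of
    [P] up to [l]. Both sets are closed upwards, the second because [P] increases down columns. *)
Let R_le p q (lj : 'I_m * 'I_s) : q \in colstab cE ->
  (msum (mon (ukey p q)) (fun u : T => (u.1.1 <= lj.1) && (u.2 <= lj.2)) <=
   msum M (fun u : T => (u.1.1 <= lj.1) && (u.2 <= lj.2)))%N
  /\
  (msum M (fun u : T => (u.1.1 <= lj.1) && (u.2 <= lj.2)) <=
   msum (mon (ukey p q)) (fun u : T => (u.1.1 <= lj.1) && (u.2 <= lj.2)) ->
   forall b, P (q b) = lj.1 -> rE (q b) = lj.2 -> P b <= P (q b))%N.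
Proof.
case: lj => l j /= /colstabP qE.
pose A := [set b | (rE b <= j)%N]; pose B := [set b | (P b <= l)%N].
have topA : top_closed cE rE A.
  by move=> b b' _ h; rewrite !inE; apply: leq_trans.
have topB : top_closed cE rE B.
  by move=> b b' e h; rewrite !inE; apply: leq_trans; apply: P_ord.
have eq1 (q0 : {perm E}) : #|[set a | (Q a <= l) && (rE (q0 (al a)) <= j)]|%N =
    #|[set b in B | q0 b \in A]|.
  rewrite -(card_imset _ (can_inj alK)); apply: eq_card => b.
  apply/imsetP/idP => [[a] | ]; rewrite !inE; first by move=> h ->; rewrite /P alK.
  by move=> h; exists (al' b); rewrite ?al'K // inE al'K.
rewrite !msum_mon /= !eq1.
have -> : [set b in B | (1%g : {perm E}) b \in A] = A :&: B.
  by apply/setP => b; rewrite !inE perm1 andbC.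
split; first exact: cut_le topA topB.
move=> H b e1 e2; suff : b \in B by rewrite inE e1.
apply: (cut_eq qE topA topB H); rewrite ?inE ?e2 // => b' cb' /=.
by rewrite !inE -e2 -e1 => h; apply: P_ord; rewrite ?qE.
Qed.

Lemma Rtot_le p q : q \in colstab cE -> (Rtot (mon (ukey p q)) <= Rtot M)%N.
Proof. by move=> qE; apply: leq_sum => lj _; have [] := R_le p lj qE. Qed.

(** The equality case at the pair [(P (q b), rE (q b))] gives [P b <= P (q b)], and a permutation
    that never decreases [P] preserves it. *)
Lemma Rtot_eq p q : q \in colstab cE -> Rtot (mon (ukey p q)) = Rtot M ->
  forall b, P (q b) = P b.
Proof.
move=> qE e b; apply/val_inj; apply: (perm_nondecreasing (f := fun b => P b)) => {}b /=.
have [_ H] := R_le p (P (q b), rE (q b)) qE; apply: H => //.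
rewrite (eq_of_leq_sum_fin (f := fun lj : 'I_m * 'I_s => msum (mon (ukey p q)) (fun u : T => (u.1.1 <= lj.1)%N && (u.2 <= lj.2)%N))
   (g := fun lj => msum M (fun u : T => (u.1.1 <= lj.1)%N && (u.2 <= lj.2)%N))) //.
  by move=> lj; have [] := R_le p lj qE.
by move: e; rewrite /Rtot => ->.
Qed.

Let cnt (q : {perm E}) L y := #|[set a | (Q a * s + rE (q (al a)) < L)%N && (cF a <= y)%N]|.

Let rc_mon p q i L : rc (mon (ukey p q)) i L =
  #|[set a | (rF (p a) == i) && (Q a * s + rE (q (al a)) < L)%N]|.
Proof. by rewrite /rc msum_mon. Qed.

Let card_row (K : pred F) : (#|[set a | K a]| = \sum_i #|[set a | (rF a == i) && K a]|)%N.
Proof.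
under eq_bigr => i _ do rewrite -sum1_card big_mkcond /=.
rewrite exchange_big -sum1_card [LHS]big_mkcond /=; apply: eq_bigr => a _.
rewrite (bigD1 (rF a)) //= !inE eqxx big1 ?addn0 // => i.
by rewrite inE eq_sym => /negPf ->.
Qed.

(** A row has at most [y] boxes in the first [y] columns, and [p] preserves columns. For [p = q = 1]
    equality holds by [letter_row]; this is [cntM]. *)
Let cnt_le (p : {perm F}) (q : {perm E}) L y : p \in colstab cF ->
  (cnt q L y <= \sum_i minn y (rc (mon (ukey p q)) i L))%N.
Proof.
move=> /colstabP pF.
have -> : cnt q L y = #|[set a | (Q ((p^-1)%g a) * s + rE (q (al ((p^-1)%g a))) < L)%N && (cF a <= y)%N]|.
  rewrite /cnt -(card_imset _ (@perm_inj _ p)); apply: eq_card => a.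
  apply/imsetP/idP => [[a'] | ]; rewrite !inE.
    by move=> h ->; rewrite permK pF.
  by move=> h; exists ((p^-1)%g a); rewrite ?permKV // inE -(pF ((p^-1)%g a)) permKV.
rewrite card_row; apply: leq_sum => i _; rewrite leq_min; apply/andP; split.
  case: y => [|y].
    rewrite leqn0 cards_eq0; apply/eqP/setP => a; rewrite !inE.
    by rewrite [(cF a <= 0)%N]leqNgt cF_pos !andbF.
  rewrite -[leqRHS](card_ord y.+1) -(card_in_imset (f := fun a => inord (cF a).-1 : 'I_y.+1)).
    exact: max_card.
  move=> a a'; rewrite !inE => /and3P[/eqP ai _ ay] /and3P[/eqP a'i _ a'y] /(congr1 val).
  move: (cF_pos a) (cF_pos a') => h h'; rewrite /= !inordK; try lia.
  by move=> e; apply: rcF_inj; [rewrite ai a'i | lia].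
rewrite rc_mon -[leqRHS](card_imset _ (@perm_inj _ p)); apply/subset_leq_card/subsetP => a.
rewrite !inE => /and3P[ai h _]; apply/imsetP; exists ((p^-1)%g a); last by rewrite permKV.
by rewrite inE permKV ai.
Qed.

Let rcM i L : rc M i L = #|[set a | (rF a == i) && (letter a < L)%N]|.
Proof. by rewrite /M rc_mon; apply: eq_card => a; rewrite !inE !perm1. Qed.

Let cntM L y : (\sum_i minn y (rc M i L) = cnt 1 L y)%N.
Proof.
rewrite /cnt card_row; apply: eq_bigr => i _; rewrite rcM -letter_row.
by apply: eq_card => a; rewrite !inE !perm1.
Qed.

Let g b := cF (al' b).

(** A second cut, whose classes are the boxes in one column of [E] with one entry of [P].
    Admissibility says that lower boxes of a class come from columns of [F] weakly further left,
    which makes [B] closed upwards. *)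
Let cnt_q (q : {perm E}) L y : q \in colstab cE -> (forall b, P (q b) = P b) ->
  (cnt 1 L y <= cnt q L y)%N /\
  ((cnt q L y <= cnt 1 L y)%N -> forall b, (P (q b) * s + rE (q b) < L)%N ->
    (forall b', cE b' = cE b -> P b' = P b -> (P b' * s + rE b' < L)%N -> (y < g b')%N) ->
   (y < g b)%N).
Proof.
move=> /colstabP qE qP.
pose cl b := (cE b, P b).
pose A := [set b | (P b * s + rE b < L)%N]; pose B := [set b | (y < g b)%N].
have q_cl b : cl (q b) = cl b by rewrite /cl qE qP.
have topA : top_closed cl rE A.
  move=> b b' [_ e] h; rewrite !inE e; apply: leq_trans.
  by rewrite ltnS leq_add2l.
have topB : top_closed cl rE B.
  move=> b b' [e1 e2]; rewrite leq_eqVlt => /orP[/eqP/val_inj e|h].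
    by rewrite !inE (rcE_inj e e1).
  rewrite !inE => h'; apply: leq_trans h' _.
  by apply: adm; rewrite ?al'K.
have eq1 (q0 : {perm E}) : (forall b, P (q0 b) = P b) ->
    (cnt q0 L y + #|[set b in B | q0 b \in A]| = #|A|)%N.
  move=> q0P; rewrite /cnt -(card_imset _ (can_inj alK)).
  rewrite -(card_imset [set b in B | _] (@perm_inj _ q0)).
  rewrite -(card_imset [set al a | a in _] (@perm_inj _ q0)).
  rewrite -(cardsID [set q0 b | b in B] A) addnC; congr (_ + _)%N; apply: eq_card => b.
    apply/imsetP/idP => [[b']|]; rewrite !inE.
      by move=> /andP[h1 h2] ->; rewrite h2 imset_f // inE.
    by move=> /andP[bA /imsetP[b' b'B e]]; exists b'; rewrite // inE b'B /= -e inE.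
  apply/imsetP/idP => [[b' /imsetP[a ha ->] ->]|].
    move: ha; rewrite !inE (mem_imset _ _ (@perm_inj _ q0)) !inE /g alK -leqNgt.
    by rewrite q0P /P alK andbC.
  rewrite !inE => /andP[nb bA]; exists ((q0^-1)%g b); last by rewrite permKV.
  apply/imsetP; exists (al' ((q0^-1)%g b)); last by rewrite al'K.
  rewrite inE al'K permKV -/(P _) -q0P permKV bA /=.
  rewrite leqNgt; apply: contra nb => nb; apply/imsetP.
  by exists ((q0^-1)%g b); rewrite ?permKV // inE.
have e1 := eq1 1%g (fun b => congr1 P (perm1 b)); have eq := eq1 q qP.
have e1' : [set b in B | (1%g : {perm E}) b \in A] = A :&: B.
  by apply/setP => b; rewrite !inE perm1 andbC.
rewrite e1' in e1; have le := cut_le q_cl topA topB.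
split; first by lia.
move=> H b hb sub; suff : b \in B by rewrite inE.
apply: (cut_eq q_cl topA topB); [lia | by rewrite inE | ].
by move=> b' [c1 c2]; rewrite !inE; apply: sub.
Qed.

Lemma ctot_le p q : p \in colstab cF -> q \in colstab cE ->
  (forall b, P (q b) = P b) -> (ctot #|F| M <= ctot #|F| (mon (ukey p q)))%N.
Proof.
move=> pF qE qP; apply: leq_sum => Ly _; rewrite cntM.
apply: leq_trans (cnt_le q _ _ pF); exact: (cnt_q _ _ qE qP).1.
Qed.

Lemma ctot_eq_minn p q : p \in colstab cF -> q \in colstab cE ->
  (forall b, P (q b) = P b) -> ctot #|F| M = ctot #|F| (mon (ukey p q)) ->
  forall L y, (L <= m * s)%N -> (y <= #|F|)%N ->
   (\sum_i minn y (rc M i L) = \sum_i minn y (rc (mon (ukey p q)) i L))%N.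
Proof.
move=> pF qE qP e L y Lms yF.
have := @eq_of_leq_sum_fin ('I_(m * s).+1 * 'I_#|F|.+1)%type
  (fun Ly => \sum_i minn Ly.2 (rc M i Ly.1))%N
  (fun Ly => \sum_i minn Ly.2 (rc (mon (ukey p q)) i Ly.1))%N.
move=> H; apply: (H _ _ (Ordinal (n := (m * s).+1) Lms, Ordinal (n := #|F|.+1) yF)).
  move=> Ly; rewrite cntM; apply: leq_trans (cnt_le q _ _ pF).
  exact: (cnt_q _ _ qE qP).1.
by rewrite -/(ctot _ M) -/(ctot _ _) e.
Qed.

Let colstab_g p q : p \in colstab cF -> q \in colstab cE ->
  (forall b, P (q b) = P b) -> ctot #|F| M = ctot #|F| (mon (ukey p q)) ->
  forall b, g (q b) = g b.
Proof.
move=> pF qE qP e b; have e' := ctot_eq_minn pF qE qP e.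
suff H b' : (g (q b') <= g b')%N.
  have := @perm_nondecreasing _ (q^-1)%g g _ (q b); rewrite permK => -> // b'.
  by have := H ((q^-1)%g b'); rewrite permKV.
move gy : (g (q b')) => [//|y].
(* The cut is taken just after the letter of [q b'] and just left of the column of [F] from which
   [q b'] comes. *)
pose L := (P (q b') * s + rE (q b')).+1.
have Lms : (L <= m * s)%N by apply: (row_letter_lt (P (q b'), rF (al' (q b')), rE (q b'))).
have yF : (y <= #|F|)%N by have := cF_le (al' (q b')); rewrite -/(g _) gy; lia.
have [_ H] := cnt_q L y qE qP; apply: H => //.
  by rewrite -cntM e' //; apply: cnt_le.
move=> b1 c1 p1; rewrite /L p1 -qP ltnS leq_add2l -gy => le.
move: le; rewrite leq_eqVlt => /orP[/eqP/val_inj r1|lt].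
  rewrite (_ : b1 = q b') //; apply: rcE_inj => //.
  by rewrite c1; move/colstabP: qE => ->.
apply: adm; rewrite ?al'K //; first by move/colstabP: qE => ->.
by rewrite -!/(P _) p1 qP.
Qed.

Let M_of_rc M' : (forall i L, (L <= m * s)%N -> rc M i L = rc M' i L) -> M' = M.
Proof.
move=> e; apply/mnmP => n; have [u ->] := vix_surj n.
apply/eqP; rewrite -(eqn_add2l (rc M' u.1.2 (row_letter u))) -rc_row.
have h := row_letter_lt u.
by rewrite -!e // ?rc_row // ltnW.
Qed.

(** When both statistics agree, all sums of truncated row counts agree. The row ballot condition
    makes the row counts antitone in [i], so they coincide, and they determine the monomial. *)
Lemma upoly_triangular M' : row_ballot M' -> upoly@_M' != 0 -> M' != M ->
  (Rtot M' < Rtot M)%N \/ (Rtot M' = Rtot M /\ ctot #|F| M < ctot #|F| M')%N.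
Proof.
move=> bM' /upoly_supp[p [q [pF qE eM']]] ne; have := Rtot_le p qE; rewrite eM'.
rewrite leq_eqVlt => /orP[/eqP e|]; [right|by left]; split => //.
rewrite -eM' in e bM' ne *.
have qP := Rtot_eq qE e; have := ctot_le pF qE qP.
rewrite leq_eqVlt => /orP[/eqP e2|] //.
case/eqP: ne; apply: M_of_rc => i L Lms; move: i.
have rcF (z : F -> T) i : (rc (mon z) i L <= #|F|)%N.
  by rewrite /rc msum_mon max_card.
apply: (@eq_antitone_sum_minn r #|F|) => //.
- exact: rc_antitone.
- exact: rc_antitone.
- by move=> i; apply: rcF.
- by move=> y yF; apply: ctot_eq_minn.
Qed.

(** Here [q] preserves the entries of [P] and the columns of origin, so [al] carries it to a column
    permutation [p0] of [F]. What remains of [p] after removing [p0] preserves the letters, which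
    increase strictly down columns, and is the identity. *)
Let sign1 p q : p \in colstab cF -> q \in colstab cE -> mon (ukey p q) = M ->
  odd_perm p = odd_perm q.
Proof.
move=> pF qE eM; have qP := Rtot_eq qE (congr1 Rtot eM).
have gq := colstab_g pF qE qP (congr1 (ctot #|F|) (esym eM)).
pose p0 := transport alK al'K q.
suff -> : p = p0 by rewrite odd_transport.
have p0E a : al (p0 a) = q (al a) by rewrite transportE al'K.
have cp0 a : cF (p0 a) = cF a by rewrite transportE -/(g _) gq /g alK.
have Qp0 a : Q (p0 a) = Q a by rewrite transportE -/(P _) qP /P alK.
pose p1 := (p0^-1 * p)%g.
suff p11 : forall a, p1 a = a.
  by apply/perm.permP => a; have := p11 (p0 a); rewrite permM permK.
have pF' := pF; move/colstabP: pF' => cp.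
have cp1 b : cF (p1 b) = cF b.
  by rewrite permM cp -(cp0 ((p0^-1)%g b)) permKV.
have key i L : #|[set a | (rF (p1 a) == i) && (letter a < L)%N]| =
    #|[set a | (rF a == i) && (letter a < L)%N]|.
  rewrite -rcM -eM rc_mon -[RHS](card_imset _ (@perm_inj _ p0)).
  apply: eq_card => b0; apply/idP/imsetP => [|[b]]; rewrite !inE.
    move=> h; exists ((p0^-1)%g b0); last by rewrite permKV.
    rewrite inE -p0E permKV -(Qp0 ((p0^-1)%g b0)) permKV.
    by move: h; rewrite permM.
  by move=> h ->; rewrite permM permK /letter p0E Qp0.
have rp a : (letter a <= letter (p1 a))%N.
  pose A := [set a1 | (rF a1 <= rF (p1 a))%N]; pose B := [set a1 | (letter a1 < (letter (p1 a)).+1)%N].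
  have letter_col_le a1 a2 : cF a1 = cF a2 -> (rF a1 <= rF a2)%N -> (letter a1 <= letter a2)%N.
    move=> ec; rewrite leq_eqVlt => /orP[/eqP/val_inj er|]; last by move/(letter_col ec)/ltnW.
    by rewrite (rcF_inj er ec).
  have topA : top_closed cF rF A by move=> a1 a2 _ h; rewrite !inE; apply: leq_trans.
  have topB : top_closed cF rF B.
    move=> a1 a2 ec er; rewrite !inE; apply: leq_trans; rewrite ltnS.
    exact: letter_col_le.
  suff : a \in B by rewrite inE ltnS.
  apply: (cut_eq cp1 topA topB); last 1 first.
  - move=> a1 ca; rewrite !inE ltnS => h; apply: letter_col_le => //.
    by rewrite ca cp1.
  - have -> : #|A :&: B| = (\sum_(i : 'I_r | i <= rF (p1 a)) #|[set a1 | (rF a1 == i) && (letter a1 < (letter (p1 a)).+1)%N]|)%N.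
      rewrite card_row [RHS]big_mkcond /=; apply: eq_bigr => i _; case: ifP => h.
        by apply: eq_card => a1; rewrite !inE; case: eqP => //= ->; rewrite h.
      apply/eqP; rewrite cards_eq0; apply/eqP/setP => a1; rewrite !inE.
      by case: eqP => //= ->; rewrite h.
    under eq_bigr => i _ do rewrite -key -sum1_card big_mkcond /=.
    rewrite exchange_big -[leqRHS]sum1_card [leqRHS]big_mkcond /=; apply: leq_sum => a1 _.
    rewrite !inE; have [h|h] := leqP (rF (p1 a1)) (rF (p1 a)); last first.
      rewrite big1 // => i hi; rewrite inE; case: eqP => //= e.
      by move: h; rewrite e ltnNge hi.
    rewrite (bigD1 (rF (p1 a1))) //= inE eqxx /= big1 ?addn0 ?andbT // => i /andP[_ n].
    by rewrite inE eq_sym (negPf n).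
  - by rewrite inE.
move=> a; have e := perm_nondecreasing rp a.
apply: rcF_inj => //; apply/val_inj => /=.
case: (ltngtP (rF (p1 a)) (rF a)) => // h.
  by have := letter_col (cp1 a) h; rewrite e ltnn.
by have := letter_col (esym (cp1 a)) h; rewrite e ltnn.
Qed.

(** No cancellation occurs: by [sign1] every pair that contributes to [M] contributes one, and the
    pair of identities does contribute. *)
Lemma upoly_diagonal : upoly@_M != 0.
Proof.
have -> : upoly@_M =
    (\sum_(p in colstab cF) \sum_(q in colstab cE) (mon (ukey p q) == M))%:R.
  rewrite natr_sum /upoly raddf_sum; apply: eq_bigr => p pF /=.
  rewrite natr_sum raddf_sum; apply: eq_bigr => q qE /=.
  rewrite mcoeffZ mcoeffX; case: eqP => e; last by rewrite mulr0.
  by rewrite (sign1 pF qE e) -signr_addb addbb mulr1.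
apply: natr_neq0 => //.
rewrite (bigD1 1%g) ?colstab1 //= (bigD1 1%g) ?colstab1 //=.
by rewrite -/M eqxx.
Qed.

End Upoly.

(** * Invariance of alternating sums under unitriangular substitutions *)

Section Alternating.
Variables (k : fieldType) (r : nat).
Hypothesis char0 : [pchar k] =i pred0.
Variables (Z : finType) (rw : Z -> 'I_r) (cl : Z -> nat).
Hypothesis rc_inj : forall a a', rw a = rw a' -> cl a = cl a' -> a = a'.
Hypothesis down : forall a (i : 'I_r), (i <= rw a)%N ->
  exists2 b, cl b = cl a & rw b = i.

(** A product over the columns of determinants in the rows that the column occupies; by [down] these
    rows form an initial segment. *)
Definition alternating (w : Z -> 'I_r -> k) :=
  \sum_(p in colstab cl) (-1) ^+ odd_perm p * \prod_a w a (rw (p a)).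

Lemma colstabM (p q : {perm Z}) : p \in colstab cl -> q \in colstab cl ->
  (p * q)%g \in colstab cl.
Proof. by move=> /colstabP cp /colstabP cq; apply/colstabP => b; rewrite permM cq cp. Qed.

Lemma colstab_tperm a a' : cl a = cl a' -> tperm a a' \in colstab cl.
Proof. by move=> e; apply/colstabP => b; case: tpermP => [->|->|]. Qed.

Lemma alternating_sum_eq0 (w : Z -> 'I_r -> k) a a' : a != a' -> cl a = cl a' ->
  w a =1 w a' -> alternating w = 0.
Proof.
move=> ne ca e; set S := alternating w; have : S = - S.
  rewrite {1}/S /alternating (reindex_inj (mulgI (tperm a a'))) /= -sumrN.
  apply: eq_big => p.
    apply/idP/idP => h; last by apply: colstabM => //; apply: colstab_tperm.
    by rewrite -[p](mulKg (tperm a a')) tpermV colstabM ?colstab_tperm.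
  move=> _; rewrite odd_permM odd_tperm ne signr_addb expr1 mulN1r mulNr.
  congr (- (_ * _)).
  rewrite (reindex_inj (@perm_inj _ (tperm a a'))) /=; apply: eq_bigr => b _.
  by rewrite permM tpermK; case: tpermP => [->|->|].
move/eqP; rewrite -addr_eq0 -mulr2n -mulr_natr mulf_eq0.
by rewrite (negPf (natr_neq0 char0 _)) // orbF => /eqP.
Qed.

(** The substitution adds to a row only multiples of earlier rows. In the expansion, [th] records
    the row chosen at each box. It contributes zero if it repeats a row within a column, or if every
    [p] meets a vanishing factor of [g]; otherwise it is a rearrangement [rw (p0 a)], and only
    [p = p0] avoids the vanishing factors. *)
Lemma alternating_unitriangular (g : 'I_r -> 'I_r -> k) (w : Z -> 'I_r -> k) :
  (forall i, g i i = 1) -> (forall i i' : 'I_r, (i < i')%N -> g i i' = 0) ->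
  alternating (fun a i => \sum_i' g i i' * w a i') = alternating w.
Proof.
move=> g1 g0; rewrite /alternating.
under eq_bigr => p _ do rewrite bigA_distr_bigA /= big_distrr /=.
rewrite exchange_big /=.
pose G (th : {ffun Z -> 'I_r}) := alternating (fun a i => g i (th a)).
have -> : \sum_(th : {ffun Z -> 'I_r}) \sum_(p in colstab cl) (-1) ^+ odd_perm p *
     \prod_a (g (rw (p a)) (th a) * w a (th a)) =
     \sum_(th : {ffun Z -> 'I_r}) G th * \prod_a w a (th a).
  apply: eq_bigr => th _; rewrite big_distrl /=; apply: eq_bigr => p _.
  by rewrite big_split /= mulrA.
pose im (p : {perm Z}) : {ffun Z -> 'I_r} := [ffun a => rw (p a)].
have im_inj : {in colstab cl &, injective im}.
  move=> p q /colstabP cp /colstabP cq e; apply/perm.permP => a.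
  by apply: rc_inj; rewrite ?cp ?cq //; have /ffunP/(_ a) := e; rewrite !ffunE.
rewrite (bigID (mem (im @: colstab cl))) /= [X in _ + X]big1 ?addr0; last first.
  move=> th nim; suff -> : G th = 0 by rewrite mul0r.
  have [/injectiveP inj|/injectivePn[a [a' ne [e1 e2]]]] :=
    boolP (injectiveb (fun a : Z => (th a, cl a))); last first.
    by apply: (alternating_sum_eq0 ne e2) => i; rewrite e1.
  rewrite /G /alternating big1 // => p /colstabP cp.
  have [/forallP le|] := boolP [forall a, (th a <= rw (p a))%N]; last first.
    rewrite negb_forall => /existsP[a]; rewrite -ltnNge => lt.
    by rewrite (bigD1 a) //= g0 // mul0r mulr0.
  pose f a := odflt a [pick b | (cl b == cl a) && (rw b == th a)].
  have fP a : cl (f a) = cl a /\ rw (f a) = th a.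
    rewrite /f; case: pickP => [b /andP[/eqP-> /eqP->]//|no].
    have [b cb rb] := down (le a); have := no b.
    by rewrite cb rb cp !eqxx.
  have f_inj : injective f.
    move=> a a' e; apply: inj.
    by rewrite -(fP a).1 -(fP a).2 e (fP a').1 (fP a').2.
  case/negP: nim; apply/imsetP; exists (perm f_inj).
    by apply/colstabP => b; rewrite permE (fP b).1.
  by apply/ffunP => a; rewrite ffunE permE (fP a).2.
rewrite big_imset //=; apply: eq_bigr => p0 p0c; congr (_ * _); last first.
  by apply: eq_bigr => a _; rewrite ffunE.
rewrite /G /alternating (bigD1 p0) //= [X in _ + X]big1 ?addr0.
  by rewrite big1 ?mulr1 // => a _; rewrite ffunE g1.
move=> p /andP[pc ne].
have [/forallP le|] := boolP [forall a, (rw (p0 a) <= rw (p a))%N]; last first.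
  rewrite negb_forall => /existsP[a]; rewrite -ltnNge => lt.
  by rewrite (bigD1 a) //= ffunE g0 // mul0r mulr0.
case/eqP: ne; apply/perm.permP => a.
have := @perm_nondecreasing _ (p0^-1 * p)%g (fun b => rw b) _ (p0 a).
rewrite permM permK => e; apply: rc_inj.
  by apply/val_inj/e => b; rewrite permM -{1}[b](permKV p0).
by move/colstabP: pc => ->; move/colstabP: p0c => ->.
Qed.

End Alternating.

Section ShiftDerivation.
Variables (k : fieldType) (N : nat).
Hypothesis char0 : [pchar k] =i pred0.
Variables (C : finType) (x1 x2 : C -> 'I_N).

Definition shift_along (t : k) (y : 'I_N -> k) u :=
  y u + t * \sum_(c | x2 c == u) y (x1 c).

(** A version at a single point, so that it also applies when invariance is known at invertible
    matrices only. *)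
Lemma shift_derivation_at (p : {mpoly k[N]}) (y : 'I_N -> k) :
  (forall t, p.@[shift_along t y] = p.@[y]) ->
  (\sum_c 'X_(x1 c) * p^`M(x2 c)).@[y] = 0.
Proof.
move=> inv; pose w u : {poly k} := (y u)%:P + (\sum_(c | x2 c == u) y (x1 c))%:P * 'X.
have wE t u : (w u).[t] = shift_along t y u.
  by rewrite /w !hornerE mulrC.
have q0 : curve_eval w p - (p.@[y])%:P = 0.
  apply: (poly_eq0_nonzero_points char0) => t _.
  by rewrite !hornerE horner_curve (meval_eq _ (wE t)) inv subrr.
have := congr1 (fun q : {poly k} => q^`().[0]) q0.
rewrite /= derivB derivC subr0 deriv0 horner0 deriv_curve horner_sum => <-.
rewrite raddf_sum /= (eq_bigr (fun u => (\sum_(c | x2 c == u) y (x1 c)) * p^`M(u).@[y])).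
  under [RHS]eq_bigr => u _ do rewrite mulr_suml.
  rewrite (exchange_big_dep predT) //=; apply: eq_bigr => c _.
  rewrite (big_pred1 (x2 c)) => [|u]; last by rewrite eq_sym.
  by rewrite mevalM mevalXU.
move=> u _; rewrite hornerM horner_curve /w derivD derivC add0r derivM derivC.
rewrite mul0r add0r derivX mulr1 hornerC mulrC; congr (_ * _).
by apply: meval_eq => u'; rewrite -/(w u') wE /shift_along mul0r addr0.
Qed.

Lemma shift_derivation (p : {mpoly k[N]}) :
  (forall y t, p.@[shift_along t y] = p.@[y]) ->
  \sum_c 'X_(x1 c) * p^`M(x2 c) = 0.
Proof. by move=> inv; apply: (meval_eq0 char0) => y; apply: shift_derivation_at. Qed.

End ShiftDerivation.

Section UpolyInvariance.
Variables (k : fieldType) (m r s : nat).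
Hypothesis char0 : [pchar k] =i pred0.
Local Notation T := ('I_m * 'I_r * 'I_s)%type.
Local Notation N := (m * r * s)%N.
Variables (F E : finType) (rF : F -> 'I_r) (cF : F -> nat) (rE : E -> 'I_s) (cE : E -> nat).
Hypothesis rcF_inj : forall a a', rF a = rF a' -> cF a = cF a' -> a = a'.
Hypothesis rcE_inj : forall b b', rE b = rE b' -> cE b = cE b' -> b = b'.
Hypothesis downF : forall a (i : 'I_r), (i <= rF a)%N ->
  exists2 b, cF b = cF a & rF b = i.
Hypothesis downE : forall a (i : 'I_s), (i <= rE a)%N ->
  exists2 b, cE b = cE a & rE b = i.
Variables (Q : F -> 'I_m) (al : F -> E) (al' : E -> F).
Hypotheses (alK : cancel al al') (al'K : cancel al' al).

Definition usum (y : 'I_m -> 'I_r -> 'I_s -> k) :=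
  \sum_(p in colstab cF) \sum_(q in colstab cE)
    (-1) ^+ odd_perm p * (-1) ^+ odd_perm q *
    \prod_a y (Q a) (rF (p a)) (rE (q (al a))).

Lemma meval_upoly (v : 'I_N -> k) : (upoly k rF cF rE cE Q al).@[v] =
  usum (fun l i j => v (vix (l, i, j))).
Proof.
rewrite /upoly raddf_sum; apply: eq_bigr => p _ /=; rewrite raddf_sum.
apply: eq_bigr => q _ /=; rewrite mevalZ /mon; congr (_ * _).
rewrite (_ : 'X_[_] = \prod_a 'X_(vix (ukey rF rE Q al p q a))).
  by rewrite rmorph_prod; apply: eq_bigr => a _; rewrite /= mevalXU.
by rewrite mprodXE.
Qed.

Lemma usum_eq y y' : (forall l i j, y l i j = y' l i j) -> usum y = usum y'.
Proof.
move=> e; apply: eq_bigr => p _; apply: eq_bigr => q _; congr (_ * _).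
by apply: eq_bigr => a _.
Qed.

Lemma usum_rows (g : 'I_r -> 'I_r -> k) y :
  (forall i, g i i = 1) -> (forall i i' : 'I_r, (i < i')%N -> g i i' = 0) ->
  usum (fun l i j => \sum_i' g i i' * y l i' j) = usum y.
Proof.
move=> g1 g0; rewrite /usum exchange_big [RHS]exchange_big /=; apply: eq_bigr => q _.
have := alternating_unitriangular char0 rcF_inj downF
  (fun a i => y (Q a) i (rE (q (al a)))) g1 g0.
rewrite /alternating => e.
rewrite [RHS](eq_bigr (fun p => (-1) ^+ odd_perm q * ((-1) ^+ odd_perm p *
  \prod_a y (Q a) (rF (p a)) (rE (q (al a)))))); last by move=> p _; rewrite [RHS]mulrCA mulrA.
rewrite -[RHS]mulr_sumr -e mulr_sumr; apply: eq_bigr => p _.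
by rewrite [RHS]mulrCA mulrA.
Qed.

Lemma usum_cols (g : 'I_s -> 'I_s -> k) y :
  (forall i, g i i = 1) -> (forall i i' : 'I_s, (i < i')%N -> g i i' = 0) ->
  usum (fun l i j => \sum_j' g j j' * y l i j') = usum y.
Proof.
move=> g1 g0; apply: eq_bigr => p _.
have := alternating_unitriangular char0 rcE_inj downE
  (fun b j => y (Q (al' b)) (rF (p (al' b))) j) g1 g0.
rewrite /alternating => e.
have re (f : F -> E -> k) : \prod_a f a (al a) = \prod_b f (al' b) b.
  rewrite (reindex al); last by exists al' => b _; rewrite ?alK ?al'K.
  by apply: eq_bigr => a _; rewrite alK.
under eq_bigr => q _ do rewrite -mulrA
  (re (fun a b => \sum_j' g (rE (q b)) j' * y (Q a) (rF (p a)) j')).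
rewrite -mulr_sumr e mulr_sumr; apply: eq_bigr => q _.
by rewrite -mulrA (re (fun a b => y (Q a) (rF (p a)) (rE (q b)))).
Qed.

Lemma elementary_sum n (i0 i1 : 'I_n) (t : k) (f : 'I_n -> k) i : i0 != i1 ->
  \sum_i' ((i == i')%:R + t * ((i == i1) && (i' == i0))%:R) * f i' =
  f i + t * (f i0 *+ (i == i1)).
Proof.
move=> ne; under eq_bigr => i' _ do rewrite mulrDl.
rewrite big_split /=; congr (_ + _).
  rewrite (bigD1 i) //= eqxx mul1r big1 ?addr0 // => i' n1.
  by rewrite eq_sym (negPf n1) mul0r.
rewrite (bigD1 i0) //= eqxx andbT big1 ?addr0 => [|i' /negPf->].
  by rewrite -mulrA mulr_natl.
by rewrite andbF mulr0 mul0r.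
Qed.

(** Infinitesimal form of [usum_rows] for the elementary matrix that adds [t] times row [i] to row
    [i']. *)
Lemma upoly_row_derivation (i i' : 'I_r) : i' = i.+1 :> nat ->
  \sum_(c : 'I_m * 'I_s) 'X_(vix (c.1, i, c.2)) *
    (upoly k rF cF rE cE Q al)^`M(vix (c.1, i', c.2)) = 0.
Proof.
move=> ii; have ne : i != i' by rewrite -val_eqE /= ii neq_ltn ltnSn.
apply: (@shift_derivation k N char0 _ (fun c => vix (c.1, i, c.2)) (fun c => vix (c.1, i', c.2))).
move=> y t; rewrite !meval_upoly.
rewrite -[RHS](@usum_rows (fun i1 i2 => (i1 == i2)%:R + t * ((i1 == i') && (i2 == i))%:R)).
- apply: usum_eq => l i1 j.
  rewrite (elementary_sum t (fun i2 => y (vix (l, i2, j)))) // /shift_along.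
  congr (_ + _ * _); case: eqP => [->|n1].
    rewrite (big_pred1 (l, j)) // => -[l' j'].
    by rewrite (inj_eq (@vix_inj _ _ _)) !xpair_eqE eqxx andbT.
  rewrite big_pred0 // => -[l' j']; rewrite (inj_eq (@vix_inj _ _ _)) !xpair_eqE.
  have /negPf-> : i' != i1 by rewrite eq_sym; exact/eqP.
  by rewrite andbF.
- by move=> i1; rewrite eqxx; case: eqP => [->|_] /=; rewrite 1?eq_sym ?(negPf ne) mulr0 addr0.
- move=> i1 i2 lt; have -> : (i1 == i2) = false by apply/eqP => e; rewrite e ltnn in lt.
  case: eqP => [e1|] /=; last by rewrite mulr0 addr0.
  case: eqP => [e2|] /=; last by rewrite mulr0 addr0.
  by move: lt; rewrite e1 e2 ii; lia.
Qed.

Lemma upoly_col_derivation (j j' : 'I_s) : j' = j.+1 :> nat ->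
  \sum_(c : 'I_m * 'I_r) 'X_(vix (c, j)) *
    (upoly k rF cF rE cE Q al)^`M(vix (c, j')) = 0.
Proof.
move=> jj; have ne : j != j' by rewrite -val_eqE /= jj neq_ltn ltnSn.
apply: (@shift_derivation k N char0 _ (fun c => vix (c, j)) (fun c => vix (c, j'))).
move=> y t; rewrite !meval_upoly.
rewrite -[RHS](@usum_cols (fun i1 i2 => (i1 == i2)%:R + t * ((i1 == j') && (i2 == j))%:R)).
- apply: usum_eq => l i1 j1.
  rewrite (elementary_sum t (fun j2 => y (vix (l, i1, j2)))) // /shift_along.
  congr (_ + _ * _); case: eqP => [->|n1].
    rewrite (big_pred1 (l, i1)) // => c.
    by rewrite (inj_eq (@vix_inj _ _ _)) xpair_eqE eqxx andbT.
  rewrite big_pred0 // => c; rewrite (inj_eq (@vix_inj _ _ _)) xpair_eqE.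
  have /negPf-> : j' != j1 by rewrite eq_sym; exact/eqP.
  by rewrite andbF.
- by move=> i1; rewrite eqxx; case: eqP => [->|_] /=; rewrite 1?eq_sym ?(negPf ne) mulr0 addr0.
- move=> i1 i2 lt; have -> : (i1 == i2) = false by apply/eqP => e; rewrite e ltnn in lt.
  case: eqP => [e1|] /=; last by rewrite mulr0 addr0.
  case: eqP => [e2|] /=; last by rewrite mulr0 addr0.
  by move: lt; rewrite e1 e2 jj; lia.
Qed.

End UpolyInvariance.

(** * Spanning by a family that is triangular on the good monomials only *)

Section SpanTriangular.
Variables (k : fieldType) (N : nat).
Implicit Types (u v : {mpoly k[N]}) (M : 'X_{1..N}).

Inductive in_span (G : {mpoly k[N]} -> Prop) : {mpoly k[N]} -> Prop :=
| in_span0 : in_span G 0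
| in_span_add c u v : G u -> in_span G v -> in_span G (c *: u + v).

Variables (G H : {mpoly k[N]} -> Prop) (good : pred 'X_{1..N}) (stat : 'X_{1..N} -> nat).
Hypothesis G_H : forall u, G u -> H u.
Hypothesis H_sub : forall c u v, H u -> H v -> H (v - c *: u).
Hypothesis H_lead : forall v, H v -> v != 0 -> exists2 M, good M & v@_M != 0.
Hypothesis G_lead : forall M, good M -> exists u, [/\ G u, u@_M != 0 &
  forall M', good M' -> M' != M -> u@_M' != 0 -> (stat M' < stat M)%N].

(** Good monomials are eliminated by decreasing [stat]: the outer induction bounds the statistic,
    the inner one runs through a list containing the good monomials of the top value. Bad monomials
    may appear freely, since by [H_lead] nothing remains once the good ones are gone. *)
Lemma span_triangular v : H v -> in_span G v.
Proof.
suff main B w : H w -> (forall M, good M -> w@_M != 0 -> (stat M < B)%N) -> in_span G w.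
  move=> Hv; apply: (main (\max_(M <- msupp v) (stat M)).+1) => // M _.
  by rewrite -mcoeff_msupp ltnS => Mv; apply: leq_bigmax_seq.
elim: B w => [|B IH] w Hw small.
  have [->|w0] := eqVneq w 0; first exact: in_span0.
  by have [M gM wM] := H_lead Hw w0; have := small M gM wM.
suff step (s : seq 'X_{1..N}) w1 : H w1 ->
    (forall M, good M -> w1@_M != 0 -> (stat M < B.+1)%N) ->
    (forall M, good M -> w1@_M != 0 -> stat M = B -> M \in s) -> in_span G w1.
  by apply: (step (msupp w)) => // M _; rewrite mcoeff_msupp.
elim: s w1 => [|M s IHs] w1 Hw1 le1 in1.
  apply: IH => // M gM wM; have := le1 M gM wM; rewrite ltnS leq_eqVlt.
  by case/orP => // /eqP /(in1 M gM wM).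
have [/andP[gM /eqP sM]|bad] := boolP (good M && (stat M == B)); last first.
  apply: IHs => // M' gM' wM' sM'; have := in1 M' gM' wM' sM'.
  by rewrite inE => /orP[/eqP e|//]; case/negP: bad; rewrite -e gM' sM' eqxx.
have [u [Gu uM tri]] := G_lead gM; pose c := w1@_M / u@_M.
have -> : w1 = c *: u + (w1 - c *: u) by rewrite addrC subrK.
apply: in_span_add => //.
have coef M' : (w1 - c *: u)@_M' = w1@_M' - c * u@_M' by rewrite mcoeffB mcoeffZ.
have c0 : (w1 - c *: u)@_M = 0 by rewrite coef divfK // subrr.
have nz M' : M' != M -> good M' -> (w1 - c *: u)@_M' != 0 ->
    w1@_M' != 0 \/ (stat M' < B)%N.
  move=> ne gM'; rewrite coef; have [e|] := eqVneq (w1@_M') 0; last by left.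
  rewrite e sub0r oppr_eq0 mulf_eq0 negb_or => /andP[_ h]; right.
  by rewrite -sM tri.
apply: IHs.
- exact: H_sub (G_H Gu) Hw1.
- move=> M' gM' wM'; have ne : M' != M by apply: contraNneq wM' => ->; rewrite c0.
  by case: (nz _ ne gM' wM') => [/(le1 _ gM')|/ltnW] //.
- move=> M' gM' wM' sM'; have ne : M' != M by apply: contraNneq wM' => ->; rewrite c0.
  case: (nz _ ne gM' wM') => [h|]; last by rewrite sM' ltnn.
  by have := in1 M' gM' h sM'; rewrite inE (negPf ne).
Qed.

End SpanTriangular.

(** If [f L] counts the letters below [L], the witness is the [c]-th letter in increasing order. *)
Lemma threshold (f : nat -> nat) (c K : nat) :
  {homo f : x y / (x <= y)%N} -> f 0%N = 0%N -> (0 < c)%N -> (c <= f K)%N ->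
  exists2 l, (l < K)%N & forall L, (l < L)%N = (c <= f L)%N.
Proof.
move=> mf f0 c0 cK; have ex : exists L, (c <= f L)%N by exists K.
case: (ex_minnP ex) => l cl lmin; exists l.-1.
  case: l cl lmin => [|l] cl lmin; first by rewrite f0 leqNgt c0 in cl.
  exact: lmin.
move=> L; apply/idP/idP => [lL|/lmin lL].
  by apply: leq_trans cl (mf _ _ _); lia.
by case: l cl lmin lL => [|l] //; rewrite f0 leqNgt c0.
Qed.

Lemma match_keys (F E T : finType) (kF : F -> T) (kE : E -> T) :
  (forall u, #|[set a | kF a == u]| = #|[set b | kE b == u]|) ->
  exists al al', [/\ cancel al al', cancel al' al & forall a, kE (al a) = kF a].
Proof.
move=> eqc.
(* Without a box in [E] there is no default value for [nth], but then [F] is empty as well.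
   Otherwise the fibres over each key are enumerated and paired by position. *)
have [b0 _|noE] := pickP (@predT E); last first.
  have noF (a : F) : False.
    have := eqc (kF a); rewrite [RHS]eq_card0 => [|b]; last by have := noE b.
    by move/eqP; rewrite cards_eq0 => /eqP/setP/(_ a); rewrite !inE eqxx.
  have noEb (b : E) : False by have := noE b.
  exists (fun a => False_rect _ (noF a)), (fun b => False_rect _ (noEb b)).
  by split=> [a|b|a]; [case: (noF a) | have := noE b | case: (noF a)].
pose fib a := enum [set a' | kF a' == kF a].
pose fibE a := enum [set b | kE b == kF a].
have szf a : size (fib a) = size (fibE a) by rewrite /fib /fibE -!cardE eqc.
have afib a : a \in fib a by rewrite mem_enum inE.
pose al a := nth b0 (fibE a) (index a (fib a)).
have al_in a : al a \in fibE a by rewrite mem_nth // -szf index_mem.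
have kal a : kE (al a) = kF a by have := al_in a; rewrite mem_enum inE => /eqP.
have al_inj : injective al.
  move=> a a' e; have ek : kF a = kF a' by rewrite -!kal e.
  have ef : fib a = fib a' by rewrite /fib ek.
  have eE : fibE a = fibE a' by rewrite /fibE ek.
  move: e; rewrite /al eE => /eqP; rewrite nth_uniq ?enum_uniq //; last first.
  - by rewrite -szf index_mem.
  - by rewrite -eE -szf index_mem.
  by move/eqP; rewrite ef => /index_inj; apply; rewrite // -ef.
have cEF : #|E| = #|F|.
  have sumc (X : finType) (kX : X -> T) : #|X| = (\sum_u #|[set a | kX a == u]|)%N.
    under eq_bigr => u _ do rewrite -sum1_card big_mkcond /=.
    rewrite exchange_big -sum1_card /=; apply: eq_bigr => a _.
    rewrite (bigD1 (kX a)) //= inE eqxx big1 ?addn0 // => u.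
    by rewrite inE eq_sym => /negPf ->.
  by rewrite (sumc _ kE) (sumc _ kF); apply: eq_bigr => u _; rewrite eqc.
have [al' alK al'K] := inj_card_bij al_inj (eq_leq cEF).
by exists al, al'.
Qed.

(** * From ballot monomials to tableaux *)

Section GoodMonomials.
Variables (m r s : nat).
Local Notation T := ('I_m * 'I_r * 'I_s)%type.
Local Notation N := (m * r * s)%N.
Variables (F E : finType) (rF : F -> 'I_r) (cF : F -> nat) (rE : E -> 'I_s) (cE : E -> nat).
Variables (lenF : 'I_r -> nat) (lenE : 'I_s -> nat).
Hypothesis cF_pos : forall a, (0 < cF a)%N.
Hypothesis cE_pos : forall b, (0 < cE b)%N.
Hypothesis card_rowF : forall i (K : pred nat),
  #|[set a | (rF a == i) && K (cF a)]| = count K (iota 1 (lenF i)).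
Hypothesis card_rowE : forall j (K : pred nat),
  #|[set b | (rE b == j) && K (cE b)]| = count K (iota 1 (lenE j)).
Variable M : 'X_{1..N}.
Hypotheses (rb : row_ballot M) (cb : col_ballot M).
Hypothesis rsum : forall i, rc M i (m * s)%N = lenF i.
Hypothesis csum : forall j, cc M j (m * r)%N = lenE j.

Lemma count_leq_iota c d : count (fun x => x <= c)%N (iota 1 d) = minn c d.
Proof.
elim: d => [|d IH]; first by rewrite minn0.
have -> : iota 1 d.+1 = iota 1 d ++ [:: d.+1] by rewrite -[d.+1]addn1 iotaD /= addn1 add1n.
by rewrite count_cat IH /= addn0; case: leqP; lia.
Qed.

Let col_le_len (Z : finType) n (rw : Z -> 'I_n) (cl : Z -> nat) len :
  (forall i (K : pred nat), #|[set a | (rw a == i) && K (cl a)]| = count K (iota 1 (len i))) ->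
  forall a, (cl a <= len (rw a))%N.
Proof.
move=> card_row a; have := card_row (rw a) (pred1 (cl a)).
rewrite leqNgt => e; apply/negP => lt; move: e.
rewrite (count_memPn _); last by rewrite mem_iota; lia.
by move/eqP; rewrite cards_eq0 => /eqP/setP/(_ a); rewrite !inE !eqxx.
Qed.

Let rc0 i : rc M i 0 = 0%N.
Proof. by rewrite /rc /msum big1 // => u; rewrite ltn0 andbF. Qed.

Let cc0 j : cc M j 0 = 0%N.
Proof. by rewrite /cc /msum big1 // => u; rewrite ltn0 andbF. Qed.

Lemma leq_cc j L L' : (L <= L')%N -> (cc M j L <= cc M j L')%N.
Proof.
move=> le; rewrite /cc /msum [leqRHS](bigID (fun u : T => col_letter u < L)%N) /=.
apply: leq_trans (leq_addr _ _); rewrite leq_eqVlt; apply/orP; left; apply/eqP.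
by apply: eq_bigl => u; case: eqP => //= _; apply/idP/andP => [h|[]//]; split => //; lia.
Qed.

Lemma cc_col (u : T) : (cc M u.2 (col_letter u).+1 = cc M u.2 (col_letter u) + M (vix u))%N.
Proof.
rewrite /cc /msum (bigD1 u) /=; last by rewrite eqxx ltnS leqnn.
rewrite addnC; congr (_ + _)%N; apply: eq_bigl => u'.
have [e|ne] /= := eqVneq u'.2 u.2; last by rewrite ?andbF.
apply/andP/idP => [[le ne]|lt].
  rewrite ltnS leq_eqVlt in le; case/orP: le => // /eqP/col_letter_inj e1.
  by case/negP: ne; case: u u' e e1 => [c j] [c' j'] /= -> ->.
by split; [lia | apply: contraTneq lt => ->; rewrite ltnn].
Qed.

(** The monomial is read in two ways: the sorted letters of row [i] fill row [i] of [F], and those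
    of column [j] fill row [j] of [E]. Each box then carries a full triple, every triple occurs as
    often as its exponent in [M] on both sides, and [al] matches boxes with equal triples. *)
Lemma good_data : exists (letF : F -> nat) (letE : E -> nat) (al : F -> E) (al' : E -> F),
  [/\ cancel al al', cancel al' al,
      (forall a, letF a < m * s)%N, (forall b, letE b < m * r)%N &
   [/\ forall a L, (letF a < L)%N = (cF a <= rc M (rF a) L)%N,
      forall b L, (letE b < L)%N = (cE b <= cc M (rE b) L)%N,
      forall u : T, #|[set a | (rF a == u.1.2) && (letF a == row_letter u)]| = M (vix u)
    & forall a, [/\ (letE (al a) %/ r = letF a %/ s)%N, (letE (al a) %% r = rF a)%N &
                 (letF a %% s = rE (al a))%N] ] ].
Proof.
have [letF HF] : exists letF : F -> nat, forall a, (letF a < m * s)%N /\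
    forall L, (letF a < L)%N = (cF a <= rc M (rF a) L)%N.
  apply: (fin_all_exists (P := fun a l => (l < m * s)%N /\
    forall L, (l < L)%N = (cF a <= rc M (rF a) L)%N)) => a.
  have [] := @threshold (rc M (rF a)) (cF a) (m * s)%N.
  - by move=> L L'; apply: leq_rc.
  - exact: rc0.
  - exact: cF_pos.
  - by rewrite rsum; apply: (col_le_len card_rowF).
  - by move=> l; exists l.
have [letE HE] : exists letE : E -> nat, forall b, (letE b < m * r)%N /\
    forall L, (letE b < L)%N = (cE b <= cc M (rE b) L)%N.
  apply: (fin_all_exists (P := fun b l => (l < m * r)%N /\
    forall L, (l < L)%N = (cE b <= cc M (rE b) L)%N)) => b.
  have [] := @threshold (cc M (rE b)) (cE b) (m * r)%N.
  - by move=> L L'; apply: leq_cc.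
  - exact: cc0.
  - exact: cE_pos.
  - by rewrite csum; apply: (col_le_len card_rowE).
  - by move=> l; exists l.
have cardF (u : T) : #|[set a | (rF a == u.1.2) && (letF a == row_letter u)]| = M (vix u).
  have ltc L : (L <= m * s)%N ->
      #|[set a | (rF a == u.1.2) && (letF a < L)%N]| = rc M u.1.2 L.
    move=> Lms; transitivity #|[set a | (rF a == u.1.2) && (cF a <= rc M u.1.2 L)%N]|.
      by apply: eq_card => a; rewrite !inE; case: eqP => //= <-; rewrite (HF a).2.
    rewrite (card_rowF _ (fun x => x <= rc M u.1.2 L)%N) count_leq_iota.
    by apply/minn_idPl; rewrite -rsum leq_rc.
  have h := row_letter_lt u; have := ltc _ h; rewrite rc_row -(ltc _ (ltnW h)).
  rewrite -(cardsID [set a | (letF a < row_letter u)%N]) => e.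
  apply: (@addnI #|[set a | (rF a == u.1.2) && (letF a < row_letter u)%N]|).
  rewrite -e; congr (_ + _)%N; apply: eq_card => a; rewrite !inE.
    by case: eqP => //= _; case: ltngtP => //; lia.
  by case: eqP => //= _; case: ltngtP => //; lia.
have cardE (u : T) : #|[set b | (rE b == u.2) && (letE b == col_letter u)]| = M (vix u).
  have ltc L : (L <= m * r)%N ->
      #|[set b | (rE b == u.2) && (letE b < L)%N]| = cc M u.2 L.
    move=> Lms; transitivity #|[set b | (rE b == u.2) && (cE b <= cc M u.2 L)%N]|.
      by apply: eq_card => b; rewrite !inE; case: eqP => //= <-; rewrite (HE b).2.
    rewrite (card_rowE _ (fun x => x <= cc M u.2 L)%N) count_leq_iota.
    by apply/minn_idPl; rewrite -csum leq_cc.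
  have h := col_letter_lt u; have := ltc _ h; rewrite cc_col -(ltc _ (ltnW h)).
  rewrite -(cardsID [set b | (letE b < col_letter u)%N]) => e.
  apply: (@addnI #|[set b | (rE b == u.2) && (letE b < col_letter u)%N]|).
  rewrite -e; congr (_ + _)%N; apply: eq_card => b; rewrite !inE.
    by case: eqP => //= _; case: ltngtP => //; lia.
  by case: eqP => //= _; case: ltngtP => //; lia.
have s0 (a : F) : (0 < s)%N by have := (HF a).1; case: (s) => //; rewrite muln0.
have r0 (b : E) : (0 < r)%N by have := (HE b).1; case: (r) => //; rewrite muln0.
have dF (a : F) : (letF a %/ s < m)%N by rewrite ltn_divLR ?(HF a).1 ?(s0 a).
have dE (b : E) : (letE b %/ r < m)%N by rewrite ltn_divLR ?(HE b).1 ?(r0 b).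
pose kF a : T := (Ordinal (dF a), rF a, Ordinal (ltn_pmod (letF a) (s0 a))).
pose kE b : T := (Ordinal (dE b), Ordinal (ltn_pmod (letE b) (r0 b)), rE b).
have [|al [al' [alK al'K kal]]] := @match_keys F E _ kF kE.
  move=> u; transitivity (M (vix u)); last symmetry.
    rewrite -cardF; apply: eq_card => a; rewrite !inE; apply/eqP/andP => [<-|].
      by rewrite eqxx /row_letter /= -divn_eq.
    move=> [/eqP e1 /eqP]; rewrite [LHS](divn_eq _ s) => e2.
    have [e3 e4] := divmod_inj (ltn_pmod _ (s0 a)) (ltn_ord _) e2.
    by case: u e1 e2 e3 e4 => [[l i] j] /= <- _ e3 e4; congr (_, _, _); apply/val_inj.
  rewrite -cardE; apply: eq_card => b; rewrite !inE; apply/eqP/andP => [<-|].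
    by rewrite eqxx /col_letter /= -divn_eq.
  move=> [/eqP e1 /eqP]; rewrite [LHS](divn_eq _ r) => e2.
  have [e3 e4] := divmod_inj (ltn_pmod _ (r0 b)) (ltn_ord _) e2.
  by case: u e1 e2 e3 e4 => [[l i] j] /= <- _ e3 e4; congr (_, _, _); apply/val_inj.
exists letF, letE, al, al'; split => //; try by move=> z; [apply: (HF z).1 | apply: (HE z).1].
- by move=> a; apply: (HF a).1.
- by move=> b; apply: (HE b).1.
split => //.
- by move=> a L; apply: (HF a).2.
- by move=> b L; apply: (HE b).2.
by move=> a; have := kal a; rewrite /kE /kF => -[e1 e2 e3]; split=> //; [rewrite -e2 | rewrite e3].
Qed.

End GoodMonomials.

(** * Young diagrams with zero-based rows *)

Lemma in_young (la : seq nat) (b : box) : (b \in young la) =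
  [&& 0 < b.1, 0 < b.2 & b.2 <= nth 0 la b.1.-1]%N.
Proof.
case: b => i j /=; rewrite /young !inE; apply/allpairsPdep/and3P.
  by move=> [i' [j' []]]; rewrite !mem_iota => h1 h2 [-> ->]; split; lia.
move=> [i0 j0 le]; exists i, j; rewrite !mem_iota; split => //; last by lia.
rewrite i0 add1n ltnS leqNgt; apply/negP => lt.
by move: le; rewrite nth_default; lia.
Qed.

Lemma youngP (la : seq nat) (a : young la) :
  [&& 0 < row_of (val a), 0 < col_of (val a) & col_of (val a) <= nth 0 la (row_of (val a)).-1]%N.
Proof. by rewrite -in_young (valP a). Qed.

Section Young.
Variables (n : nat) (la : seq nat).
Hypothesis la_n : (size la <= n)%N.

Lemma yrow_proof (a : young la) : ((row_of (val a)).-1 < n)%N.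
Proof.
have /and3P[h1 h2 h3] := youngP a; apply: leq_trans la_n; rewrite ltnNge.
by apply/negP => h; move: h3; rewrite nth_default // leqNgt h2.
Qed.

Definition yrow a : 'I_n := Ordinal (yrow_proof a).
Definition ycol (a : young la) : nat := col_of (val a).

Lemma yrowE a : (yrow a).+1 = row_of (val a).
Proof. by have /and3P[h _ _] := youngP a; rewrite /= prednK. Qed.

Lemma y_pos a : (0 < ycol a)%N.
Proof. by have /and3P[] := youngP a. Qed.

Lemma y_inj a a' : yrow a = yrow a' -> ycol a = ycol a' -> a = a'.
Proof.
move=> e1 e2; apply/val_inj; rewrite [val a]surjective_pairing [val a']surjective_pairing.
by rewrite -/(row_of (val a)) -/(row_of (val a')) -!yrowE e1; congr (_, _).
Qed.

Hypothesis la_part : is_partition la.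

Lemma partition_antitone i i' : (i <= i')%N -> (nth 0 la i' <= nth 0 la i)%N.
Proof.
move=> le; have /andP[srt _] := la_part.
have [h|h] := ltnP i' (size la); last by rewrite (nth_default _ h).
apply: (sorted_leq_nth (leT := geq)) => //; rewrite ?inE //; last exact: leq_ltn_trans h.
by move=> a b c h1 h2; apply: leq_trans h2 h1.
by move=> a; apply: leqnn.
Qed.

Lemma y_down a (i : 'I_n) : (i <= yrow a)%N -> exists2 b, ycol b = ycol a & yrow b = i.
Proof.
move=> le; have /and3P[h1 h2 h3] := youngP a.
have bin : (i.+1, ycol a) \in young la.
  rewrite in_young; apply/and3P; split=> //=; apply: leq_trans h3 _.
  exact: partition_antitone.
by exists [` bin]%fset => //; apply/val_inj.
Qed.

Lemma y_card_row (i : 'I_n) (K : pred nat) :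
  #|[set a | (yrow a == i) && K (ycol a)]| = count K (iota 1 (nth 0%N la i)).
Proof.
rewrite cardE -(size_map ycol) -size_filter; apply/perm_size/uniq_perm.
- rewrite map_inj_in_uniq ?enum_uniq // => a a'; rewrite !mem_enum !inE.
  by move=> /andP[/eqP e _] /andP[/eqP e' _]; apply: y_inj; rewrite e e'.
- by rewrite filter_uniq ?iota_uniq.
move=> c; rewrite mem_filter mem_iota; apply/mapP/andP => [[a]|[Kc hc]].
  rewrite mem_enum inE => /andP[/eqP e Ka] ->; split=> //.
  have /and3P[_ h2 h3] := youngP a.
  by rewrite y_pos add1n ltnS -e.
have bin : (i.+1, c) \in young la by rewrite in_young /=; lia.
exists [` bin]%fset => //; rewrite mem_enum inE Kc andbT.
by apply/eqP/val_inj.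
Qed.

Lemma card_young : #|{: young la}| = sumn la.
Proof.
transitivity (\sum_(i < n) nth 0 la i)%N.
  transitivity (\sum_(i < n) #|[set a : young la | (yrow a == i) && predT (ycol a)]|)%N.
    under eq_bigr => i _ do rewrite -sum1_card big_mkcond /=.
    rewrite exchange_big -sum1_card /=; apply: eq_bigr => a _.
    rewrite (bigD1 (yrow a)) //= inE eqxx big1 // => i.
    by rewrite inE eq_sym => /negPf ->.
  by apply: eq_bigr => i _; rewrite y_card_row count_predT size_iota.
rewrite sumnE (big_nth 0%N) big_mkord -(subnKC la_n) big_split_ord /= [X in (_ + X)%N]big1 ?addn0 //.
by move=> i _; rewrite nth_default // leq_addr.
Qed.

Lemma y_card_le a : (ycol a <= #|{: young la}|)%N.
Proof.
have /and3P[_ _ h3] := youngP a; apply: leq_trans h3 _.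
rewrite -(size_iota 1 (nth 0%N la _)) -(count_predT (iota _ _)) -(y_card_row (yrow a)).
exact: max_card.
Qed.

End Young.

Section Representatives.
Variables (m r s : nat) (la mu : seq nat).
Hypotheses (mu_r : (size mu <= r)%N) (la_s : (size la <= s)%N).
Local Notation F := (young mu).
Local Notation E := (young la).
Local Notation rF := (yrow mu_r).
Local Notation rE := (yrow la_s).
Local Notation cF := (@ycol mu).
Local Notation cE := (@ycol la).

Variables (letF : F -> nat) (letE : E -> nat) (al : F -> E) (al' : E -> F).
Hypotheses (alK : cancel al al') (al'K : cancel al' al).
Hypotheses (letF_lt : forall a, (letF a < m * s)%N) (letE_lt : forall b, (letE b < m * r)%N).
Hypothesis letF_row : forall a a', rF a = rF a' -> (cF a <= cF a')%N -> (letF a <= letF a')%N.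
Hypothesis letF_col : forall a a', cF a = cF a' -> (rF a < rF a')%N -> (letF a < letF a')%N.
Hypothesis letE_row : forall b b', rE b = rE b' -> (cE b <= cE b')%N -> (letE b <= letE b')%N.
Hypothesis letE_col : forall b b', cE b = cE b' -> (rE b < rE b')%N -> (letE b < letE b')%N.
Hypothesis keys : forall a, [/\ (letE (al a) %/ r = letF a %/ s)%N,
  (letE (al a) %% r = rF a)%N & (letF a %% s = rE (al a))%N].

(** A letter of [F] is [l * s + j]: the quotient gives the entry of [Q] and the remainder the entry
    of the special tableau in the fibre. A letter of [E] is [l * r + i], whose quotient gives [P].
    The successors make entries start at one. *)
Definition tabQ : tableau F := [ffun a => (letF a %/ s).+1].
Definition tabP : tableau E := [ffun b => (letE b %/ r).+1].
Definition wt : m.-tuple nat := [tuple #|[set a : F | (letF a %/ s)%N == l]| | l < m].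

Let s_pos (a : F) : (0 < s)%N.
Proof. by have := letF_lt a; case: (s) => //; rewrite muln0. Qed.

Let row_eq n (nu : seq nat) (h : (size nu <= n)%N) (a a' : young nu) :
  row_of (val a) = row_of (val a') -> yrow h a = yrow h a'.
Proof. by move=> e; apply/val_inj; rewrite /= e. Qed.

Let row_lt n (nu : seq nat) (h : (size nu <= n)%N) (a a' : young nu) :
  (row_of (val a) < row_of (val a'))%N = (yrow h a < yrow h a')%N.
Proof. by rewrite -!(yrowE h) ltnS. Qed.

Lemma tabP_al a : tabP (al a) = tabQ a.
Proof. by rewrite !ffunE; have [-> _ _] := keys a. Qed.

Lemma ordered_tabQ : ordered_tableau tabQ.
Proof.
split=> [a|a a' e le|a a' e le]; rewrite !ffunE // ltnS leq_div2r //.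
  by apply: letF_row => //; apply: row_eq.
move: le; rewrite leq_eqVlt => /orP[/eqP er|lt].
  by rewrite (y_inj (row_eq mu_r er) e).
by apply/ltnW/letF_col; rewrite // -row_lt.
Qed.

Lemma ordered_tabP : ordered_tableau tabP.
Proof.
split=> [a|a a' e le|a a' e le]; rewrite !ffunE // ltnS leq_div2r //.
  by apply: letE_row => //; apply: row_eq.
move: le; rewrite leq_eqVlt => /orP[/eqP er|lt].
  by rewrite (y_inj (row_eq la_s er) e).
by apply/ltnW/letE_col; rewrite // -row_lt.
Qed.

Lemma tabQ_weight : has_weight tabQ wt.
Proof.
move=> i; have [im|mi] := ltnP i m; last first.
  rewrite nth_default ?size_tuple //; apply/eqP; rewrite cards_eq0; apply/eqP/setP => a.
  rewrite !inE ffunE eqSS; apply/eqP => e.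
  by move: (letF_lt a); rewrite -ltn_divLR ?(s_pos a) // e ltnNge mi.
rewrite (_ : nth 0%N wt i = tnth wt (Ordinal im)) ?(tnth_nth 0%N) //.
by rewrite -tnth_nth tnth_mktuple; apply: eq_card => a; rewrite !inE ffunE eqSS.
Qed.

Lemma tabP_weight : has_weight tabP wt.
Proof.
move=> i; rewrite -tabQ_weight /occurrences -(card_imset _ (can_inj alK)).
apply: eq_card => b; apply/idP/imsetP => [|[a]]; rewrite !inE.
  by move=> h; exists (al' b); rewrite ?al'K // inE -tabP_al al'K.
by move=> h ->; rewrite tabP_al.
Qed.

Lemma sumn_wt : sumn wt = #|{: F}|.
Proof.
rewrite sumnE big_tuple; under eq_bigr => l _ do
  rewrite tnth_mktuple -sum1_card big_mkcond /=.
rewrite exchange_big -sum1_card /=; apply: eq_bigr => a _.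
have h : (letF a %/ s < m)%N by rewrite ltn_divLR ?(s_pos a).
rewrite (bigD1 (Ordinal h)) //= inE eqxx big1 // => l nl.
by rewrite inE; case: eqP => // e; case/eqP: nl; apply/val_inj.
Qed.

Lemma fibreP (D : {fset box}) (X : tableau D) i (b : fibre X i) :
  exists2 a : D, val a = val b & X a = i.
Proof.
have := valP b; rewrite /fibre => /imfsetP[a /=]; rewrite inE => /eqP Xa e.
by exists a.
Qed.

Lemma in_fibre (D : {fset box}) (X : tableau D) (a : D) : val a \in fibre X (X a).
Proof. by apply/imfsetP; exists a; rewrite //= inE. Qed.

(* The default value 1 is never met: the boxes of the fibre are boxes of mu. *)
Definition tabS : tableau_tuple m tabQ := fun l =>
  [ffun b : fibre tabQ l.+1 =>
     if insub (val b) is Some a then (letF (a : F) %% s).+1 else 1%N].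

Lemma tabSE (l : 'I_m) (b : fibre tabQ l.+1) (a : F) : val a = val b -> tabS l b = (letF a %% s).+1.
Proof. by move=> e; rewrite ffunE -e valK. Qed.

Let letF_divmod a l : tabQ a = l.+1 -> letF a = (l * s + letF a %% s)%N.
Proof. by rewrite ffunE => -[<-]; rewrite -divn_eq. Qed.

Let restr (l : 'I_m) (b : fibre tabQ l.+1) : exists b' : fibre tabP l.+1,
  forall a : F, val a = val b -> val (al a) = val b'.
Proof.
have [a e Qa] := fibreP b.
have h : val (al a) \in fibre tabP l.+1 by rewrite -Qa -tabP_al in_fibre.
by exists [` h]%fset => a' e'; rewrite (_ : a' = a) //; apply/val_inj; rewrite e' e.
Qed.

(** Semistandardness is monotonicity of [letF] inside one quotient, where only remainders vary. The
    special mapping is the restriction of [al]: strict increase of [letE] down columns of [E],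
    inside one quotient, says that the row in [F] increases. *)
Lemma special_tabS : special_tuple tabP tabS.
Proof.
move=> l; have [be0 beP] := fin_all_exists (@restr l).
pose be : {ffun fibre tabQ l.+1 -> fibre tabP l.+1} := [ffun b => be0 b].
have be_al (b : fibre tabQ l.+1) (a : F) : val a = val b -> val (be b) = val (al a).
  by move=> e; rewrite ffunE -(beP b a e).
have be_inj : injective be.
  move=> b b' e; have [a ea Qa] := fibreP b; have [a' ea' Qa'] := fibreP b'.
  apply/val_inj; rewrite /= -ea -ea'; congr val; apply/(can_inj alK)/val_inj.
  by rewrite -(be_al _ _ ea) -(be_al _ _ ea') e.
have be_surj b' : exists b, be b = b'.
  have [a' ea' Pa'] := fibreP b'.
  have h : val (al' a') \in fibre tabQ l.+1.
    by rewrite -Pa' -{2}(al'K a') tabP_al in_fibre.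
  exists [` h]%fset; apply/val_inj; rewrite (be_al _ (al' a')) //.
  by rewrite al'K.
have [be' beK] := fin_all_exists be_surj.
have be_bij : bijective be by exists be' => // b; apply: be_inj; rewrite beK.
have tabS_be b : tabS l b = row_tableau (fibre tabP l.+1) (be b).
  have [a ea Qa] := fibreP b; rewrite (tabSE ea) ffunE (be_al _ _ ea).
  by have [_ _ ->] := keys a; rewrite yrowE.
split.
- split=> [b|b b' er ec|b b' ec er].
  + by have [a ea _] := fibreP b; rewrite (tabSE ea).
  + have [a ea Qa] := fibreP b; have [a' ea' Qa'] := fibreP b'.
    rewrite (tabSE ea) (tabSE ea') ltnS -(leq_add2l (l * s)).
    rewrite -(letF_divmod Qa) -(letF_divmod Qa'); apply: letF_row.
      by apply: row_eq; rewrite ea ea'.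
    by rewrite /ycol ea ea'.
  + have [a ea Qa] := fibreP b; have [a' ea' Qa'] := fibreP b'.
    rewrite (tabSE ea) (tabSE ea') ltnS -(ltn_add2l (l * s)).
    rewrite -(letF_divmod Qa) -(letF_divmod Qa'); apply: letF_col.
      by rewrite /ycol ea ea'.
    by rewrite -row_lt ea ea'.
- move=> i; rewrite /occurrences -(card_imset _ be_inj); apply: eq_card => b'.
  apply/imsetP/idP => [[b]|]; rewrite !inE; first by rewrite tabS_be => h ->.
  by move=> h; exists (be' b'); rewrite ?beK // inE tabS_be beK.
exists be => //; split=> // b b' [ec er].
have [a ea Qa] := fibreP b; have [a' ea' Qa'] := fibreP b'.
move: ec er; rewrite (be_al _ _ ea) (be_al _ _ ea') => ec er.
rewrite -ea -ea' (row_lt mu_r); have := letE_col ec; rewrite -(row_lt la_s) => /(_ er).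
have [e1 e2 _] := keys a; have [e1' e2' _] := keys a'.
rewrite (divn_eq (letE (al a)) r) (divn_eq (letE (al a')) r) e1 e2 e1' e2'.
move: Qa Qa'; rewrite !ffunE => -[->] -[->].
by rewrite ltn_add2l.
Qed.

End Representatives.

Lemma ballot_lt (n K : nat) (f : 'I_n -> nat -> nat) :
  (forall i L L', (L <= L')%N -> (f i L <= f i L')%N) ->
  (forall (i i' : 'I_n) L, i' = i.+1 :> nat -> (L < K)%N -> (f i' L.+1 <= f i L)%N) ->
  forall (i i' : 'I_n) L, (i < i')%N -> (L < K)%N -> (f i' L.+1 <= f i L)%N.
Proof.
move=> mono b i i' L; move e : (i' - i)%N => d; elim: d i' e => [|d IH] i' e lt LK; first by lia.
have [ei|ne] := eqVneq (i' : nat) i.+1; first exact: b.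
have h : (i'.-1 < n)%N by have := ltn_ord i'; lia.
apply: leq_trans (b (Ordinal h) i' L _ LK) _ => /=; first by lia.
by apply: leq_trans (mono _ L L.+1 _) _ => //; apply: IH => //=; lia.
Qed.

(** * Straightening by the chosen representatives *)

Section SpanByRepresentatives.
Variables (k : fieldType).
Hypothesis char0 : [pchar k] =i pred0.
Variables (m r s : nat).
Hypothesis m1 : (0 < m)%N.
Variables (la mu : seq nat).
Hypotheses (la_part : is_partition la) (mu_part : is_partition mu).
Hypotheses (mu_r : (size mu <= r)%N) (la_s : (size la <= s)%N).
Variables (reps : m.-tuple nat -> tableau (young la) -> tableau (young mu) ->
          {set {ffun young mu -> young la}}).
Hypothesis repsP : forall (nu : m.-tuple nat) (P : tableau (young la))
                  (Q : tableau (young mu)),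
     sumn nu = sumn mu ->
     ordered_tableau P -> ordered_tableau Q ->
     has_weight P nu -> has_weight Q nu ->
     set_of_representatives m P Q (reps nu P Q).
Local Notation F := (young mu).
Local Notation E := (young la).
Local Notation rF := (yrow mu_r).
Local Notation rE := (yrow la_s).
Local Notation cF := (@ycol mu).
Local Notation cE := (@ycol la).
Local Notation N := (m * r * s)%N.
Local Notation T := ('I_m * 'I_r * 'I_s)%type.
Local Notation up := (upoly k rF cF rE cE).

(** Zero-based entries. The default of [insubd] would be met only for entries above [m], which a
    weight given by an [m]-tuple excludes. *)
Definition entry_index (Q : tableau F) (a : F) : 'I_m := insubd (Ordinal m1) (Q a).-1.

Definition generator (u : {mpoly k[N]}) : Prop :=
  exists (nu : m.-tuple nat) (P : tableau E) (Q : tableau F) (alpha : {ffun F -> E}),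
   [/\ sumn nu = sumn mu, ordered_tableau P /\ ordered_tableau Q,
       has_weight P nu /\ has_weight Q nu, alpha \in reps nu P Q &
       u = up (entry_index Q) alpha].

(** Highest weight vectors of weights [mu] and [la] for the general linear groups acting on the rows
    and on the columns of the variables. *)
Definition hwv (v : {mpoly k[N]}) : Prop :=
  [/\ forall M, M \in msupp v ->
        (forall i : 'I_r, msum M (fun u : T => u.1.2 == i) = nth 0%N mu i) /\
        (forall j : 'I_s, msum M (fun u : T => u.2 == j) = nth 0%N la j),
      forall i i' : 'I_r, i' = i.+1 :> nat ->
        \sum_(c : 'I_m * 'I_s) 'X_(vix (c.1, i, c.2)) * v^`M(vix (c.1, i', c.2)) = 0
    & forall j j' : 'I_s, j' = j.+1 :> nat ->
        \sum_(c : 'I_m * 'I_r) 'X_(vix (c, j)) * v^`M(vix (c, j')) = 0].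

Let rc_all M i : rc M i (m * s)%N = msum M (fun u : T => u.1.2 == i).
Proof. by apply: eq_bigl => u; rewrite row_letter_lt andbT. Qed.

Let cc_all M j : cc M j (m * r)%N = msum M (fun u : T => u.2 == j).
Proof. by apply: eq_bigl => u; rewrite col_letter_lt andbT. Qed.

Lemma hwv_upoly Q al al' : cancel al al' -> cancel al' al -> hwv (up Q al).
Proof.
move=> alK al'K; split=> [M|i i' e|j j' e].
- rewrite mcoeff_msupp => /upoly_supp[p [q [/colstabP pF /colstabP qE <-]]].
  split=> [i|j]; rewrite msum_mon /=.
    rewrite -[RHS](size_iota 1) -(count_predT (iota _ _)) -(y_card_row mu_r mu_part).
    rewrite -[LHS](card_imset _ (@perm_inj _ p)); apply: eq_card => a.
    apply/imsetP/idP => [[a']|]; rewrite !inE; first by move=> h ->; rewrite h.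
    move=> /andP[h _]; exists ((p^-1)%g a); last by rewrite permKV.
    by rewrite inE permKV h.
  rewrite -[RHS](size_iota 1) -(count_predT (iota _ _)) -(y_card_row la_s la_part).
  have qal_inj : injective (fun a => q (al a)).
    by move=> a a' /perm_inj/(can_inj alK).
  rewrite -[LHS](card_imset _ qal_inj); apply: eq_card => b.
  apply/imsetP/idP => [[a]|]; rewrite !inE; first by move=> h ->; rewrite h.
  move=> /andP[h _]; exists (al' ((q^-1)%g b)); last by rewrite al'K permKV.
  by rewrite inE al'K permKV h.
- by apply: upoly_row_derivation e => //; [exact: y_inj | exact: y_down].
- exact: (upoly_col_derivation char0 rF cF (@y_inj _ _ la_s) (y_down la_part) _ alK al'K e).
Qed.

Definition good (M : 'X_{1..N}) : bool :=
  [&& [forall i, rc M i (m * s)%N == nth 0%N mu i],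
      [forall j, cc M j (m * r)%N == nth 0%N la j],
      [forall i : 'I_r, [forall i' : 'I_r, [forall L : 'I_(m * s),
         (i' == i.+1 :> nat) ==> (rc M i' L.+1 <= rc M i L)%N]]]
    & [forall j : 'I_s, [forall j' : 'I_s, [forall L : 'I_(m * r),
         (j' == j.+1 :> nat) ==> (cc M j' L.+1 <= cc M j L)%N]]]].

Lemma goodP M : reflect
  [/\ forall i, rc M i (m * s)%N = nth 0%N mu i,
      forall j, cc M j (m * r)%N = nth 0%N la j, row_ballot M & col_ballot M] (good M).
Proof.
apply: (iffP and4P) => -[H1 H2 H3 H4]; split.
- by move=> i; apply/eqP; move/forallP: H1.
- by move=> j; apply/eqP; move/forallP: H2.
- move=> i i' L e h; have := forallP (forallP (forallP H3 i) i') (Ordinal h).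
  by rewrite /= e eqxx.
- move=> i i' L e h; have := forallP (forallP (forallP H4 i) i') (Ordinal h).
  by rewrite /= e eqxx.
- by apply/forallP => i; rewrite H1.
- by apply/forallP => i; rewrite H2.
- apply/forallP => i; apply/forallP => i'; apply/forallP => L.
  by apply/implyP => /eqP e; apply: H3.
- apply/forallP => i; apply/forallP => i'; apply/forallP => L.
  by apply/implyP => /eqP e; apply: H4.
Qed.

Lemma hwv_lead v : hwv v -> v != 0 -> exists2 M, good M & v@_M != 0.
Proof.
move=> [wt rd cd] v0; exists (mlead v); last by rewrite -mcoeff_msupp mlead_supp.
have wtM := wt _ (mlead_supp v0).
have deg M : M \in msupp v -> mdeg M = (\sum_(i < r) nth 0 mu i)%N.
  move=> /wt[h _]; rewrite mdegE.
  have [g gK Kg] : bijective (@vix m r s).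
    by apply: inj_card_bij (@vix_inj _ _ _) _; rewrite !card_prod !card_ord.
  rewrite (reindex (@vix m r s)) /=; last by exists g => u _; rewrite ?gK ?Kg.
  rewrite (partition_big (fun u : T => u.1.2) predT) //=.
  by apply: eq_bigr => i _; rewrite -h.
apply/goodP; split.
- by move=> i; rewrite rc_all wtM.1.
- by move=> i; rewrite cc_all wtM.2.
- exact: row_ballot_mlead deg v0 rd.
- exact: col_ballot_mlead deg v0 cd.
Qed.

Let bound := ((m * s).+1 * #|{: F}|.+1 * (r * #|{: F}|))%N.

Let ctot_bound (M : 'X_{1..N}) : (ctot #|{: F}| M <= bound)%N.
Proof.
rewrite /ctot; apply: leq_trans (_ : \sum_(Ly : 'I_(m * s).+1 * 'I_#|{: F}|.+1) r * #|{: F}| <= _)%N.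
  apply: leq_sum => Ly _; apply: leq_trans (_ : \sum_(i < r) #|{: F}| <= _)%N.
    by apply: leq_sum => i _; apply: leq_trans (geq_minl _ _) _; rewrite -ltnS.
  by rewrite sum_nat_const card_ord.
by rewrite sum_nat_const card_prod !card_ord.
Qed.

(** Lexicographic comparison in one number: [Rtot] first, then [ctot] reversed, with [bound] as the
    largest second digit. *)
Definition stat (M : 'X_{1..N}) : nat := (Rtot M * bound.+1 + (bound - ctot #|{: F}| M))%N.

Lemma stat_lt (M M' : 'X_{1..N}) : (Rtot M' < Rtot M)%N \/
  (Rtot M' = Rtot M /\ ctot #|{: F}| M < ctot #|{: F}| M')%N -> (stat M' < stat M)%N.
Proof.
rewrite /stat; have h := ctot_bound M; have h' := ctot_bound M'; move: h h'.
move: (ctot _ M) (ctot _ M') bound => c c' b h h' [lt|[-> lt]].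
  have : ((Rtot M').+1 * b.+1 <= Rtot M * b.+1)%N by rewrite leq_mul2r lt orbT.
  by rewrite mulSn; lia.
by rewrite ltn_add2l; lia.
Qed.

Lemma generator_for_good M : good M -> exists u, [/\ generator u, u@_M != 0 &
  forall M', good M' -> M' != M -> u@_M' != 0 -> (stat M' < stat M)%N].
Proof.
move=> /goodP[rs cs rb cb].
have [letF [letE [al0 [al0' [al0K al0'K letF_lt letE_lt [HF HE cardF keys]]]]]] :=
  good_data (@y_pos mu) (@y_pos la) (y_card_row mu_r mu_part)
   (y_card_row la_s la_part) rs cs.
have letF_row a a' : rF a = rF a' -> (cF a <= cF a')%N -> (letF a <= letF a')%N.
  by move=> e le; rewrite -ltnS HF e; apply: leq_trans le _; rewrite -HF.
have letE_row b b' : rE b = rE b' -> (cE b <= cE b')%N -> (letE b <= letE b')%N.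
  by move=> e le; rewrite -ltnS HE e; apply: leq_trans le _; rewrite -HE.
have letF_col a a' : cF a = cF a' -> (rF a < rF a')%N -> (letF a < letF a')%N.
  move=> e lt; rewrite HF e; apply: leq_trans (_ : _ <= rc M (rF a') (letF a').+1)%N _.
    by rewrite -HF.
  apply: (@ballot_lt r (m * s) (rc M)) => //.
  by move=> i L L'; apply: leq_rc.
have letE_col b b' : cE b = cE b' -> (rE b < rE b')%N -> (letE b < letE b')%N.
  move=> e lt; rewrite HE e; apply: leq_trans (_ : _ <= cc M (rE b') (letE b').+1)%N _.
    by rewrite -HE.
  apply: (@ballot_lt s (m * r) (cc M)) => //.
  by move=> i L L'; apply: leq_cc.
pose P : tableau E := tabP r letE; pose Q : tableau F := tabQ s letF; pose nu := wt m s letF.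
have sum_nu : sumn nu = sumn mu by rewrite (sumn_wt letF_lt) (card_young mu_r mu_part).
have oP : ordered_tableau P := ordered_tabP r letE_row letE_col.
have oQ : ordered_tableau Q := ordered_tabQ s letF_row letF_col.
have wQ : has_weight Q nu := tabQ_weight letF_lt.
have wP : has_weight P nu := tabP_weight al0K al0'K letF_lt keys.
have [_ exr] := repsP sum_nu oP oQ wP wQ.
have spec := special_tabS al0K al0'K letF_row letF_col letE_col keys.
(* The matching [al0] serves only to show that the tuple is special; the prescribed representative
   [alpha] may be a different map. *)
have [alpha [[al_in [al_bij PQ restr]] _]] := exr _ (spec m).
have [al' alK al'K] := al_bij.
have Qlt a : ((Q a).-1 < m)%N.
  have s0 : (0 < s)%N by have := letF_lt a; case: (s) => //; rewrite muln0.
  by rewrite ffunE /= ltn_divLR.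
have Q1 a : Q a = (entry_index Q a).+1.
  by rewrite /entry_index val_insubd Qlt ffunE.
have fibQ a : val a \in fibre Q (entry_index Q a).+1 by rewrite -Q1 in_fibre.
have al_row a : rE (alpha a) = (letF a %% s)%N :> nat.
  have [be [res _ Sbe]] := restr (entry_index Q a).
  have := Sbe [` fibQ a]%fset; rewrite (tabSE (a := a)) // ffunE.
  by rewrite -(res a [` fibQ a]%fset erefl) -(yrowE la_s) => -[].
have adm a a' : cE (alpha a) = cE (alpha a') -> entry_index Q a = entry_index Q a' ->
    (rE (alpha a) < rE (alpha a'))%N -> (cF a' <= cF a)%N.
  move=> ec eQ er; have [be [res [_ ad] _]] := restr (entry_index Q a).
  have fa' : val a' \in fibre Q (entry_index Q a).+1 by rewrite eQ.
  have [|//] := ad [` fibQ a]%fset [` fa']%fset; rewrite /strictly_below_in_column.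
  rewrite -(res a [` fibQ a]%fset erefl) -(res a' [` fa']%fset erefl) -!(yrowE la_s).
  by split.
(* The tuple fixes the row of [alpha a], and with the entry of [Q] this recovers the letter. So the
   diagonal monomial is [M] whichever representative is prescribed. *)
have let_eq a : letF a = (entry_index Q a * s + rE (alpha a))%N.
  by rewrite al_row; have := Q1 a; rewrite {1}ffunE => -[<-]; apply: divn_eq.
exists (up (entry_index Q) alpha).
have M_mon : M = mon (ukey rF rE (entry_index Q) alpha 1 1).
  apply/mnmP => z; have [u ->] := vix_surj z; rewrite -cardF.
  have := msum_mon (ukey rF rE (entry_index Q) alpha 1 1) (pred1 u).
  rewrite /msum big_pred1_eq => ->; apply: eq_card => a; rewrite !inE /ukey !perm1.
  rewrite let_eq -[(_ + _)%N]/(row_letter (entry_index Q a, rF a, rE (alpha a))).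
  apply/andP/eqP => [[/eqP e1 /eqP/row_letter_inj[e2 e3]]|<-]; last by rewrite !eqxx.
  by case: u e1 e2 e3 => [[l i] j] /= -> -> ->.
have P_ord b b' : cE b = cE b' -> (rE b <= rE b')%N ->
    (entry_index Q (al' b) <= entry_index Q (al' b'))%N.
  move=> ec er; rewrite -ltnS -!Q1 -!PQ !al'K; have [_ _ H] := oP; apply: H => //.
  by rewrite -!(yrowE la_s).
have letter_row i L y :
  #|[set a | [&& rF a == i, entry_index Q a * s + rE (alpha a) < L & cF a <= y]]|%N =
  minn y #|[set a | (rF a == i) && (entry_index Q a * s + rE (alpha a) < L)]|%N.
  have e K : #|[set a | (rF a == i) && ((entry_index Q a * s + rE (alpha a) < L)%N && K (cF a))]| =
      count (fun x => (x <= rc M i L)%N && K x) (iota 1 (nth 0%N mu i)).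
    rewrite -(y_card_row mu_r mu_part i (fun x => (x <= rc M i L)%N && K x)); apply: eq_card => a.
    by rewrite !inE -let_eq HF; case: eqP => // ->.
  rewrite (e (fun x => x <= y)%N).
  have -> : #|[set a | (rF a == i) && (entry_index Q a * s + rE (alpha a) < L)%N]| =
      count (fun x => (x <= rc M i L)%N && true) (iota 1 (nth 0%N mu i)).
    by rewrite -(e predT); apply: eq_card => a; rewrite !inE andbT.
  rewrite (eq_count (a2 := fun x => x <= minn y (rc M i L))%N) => [|x]; last by rewrite leq_min andbC.
  rewrite [in RHS](eq_count (a2 := fun x => x <= rc M i L)%N) => [|x]; last by rewrite andbT.
  by rewrite !count_leq_iota minnA.
have letter_col a a' : cF a = cF a' -> (rF a < rF a')%N ->
    (entry_index Q a * s + rE (alpha a) < entry_index Q a' * s + rE (alpha a'))%N.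
  by rewrite -!let_eq; apply: letF_col.
rewrite M_mon in rb *; split.
- by exists nu, P, Q, alpha.
- apply: (upoly_diagonal char0 alK al'K) => //; try exact: y_inj.
  + exact: (@y_pos mu).
  + exact: (y_card_le mu_r mu_part).
- move=> M' /goodP[_ _ rb' _] ne h; apply: stat_lt.
  apply: (upoly_triangular alK al'K) h ne => //; try exact: y_inj.
  exact: (@y_pos mu).
Qed.

Theorem span_generators Q al al' : cancel al al' -> cancel al' al ->
  in_span generator (up Q al).
Proof.
move=> alK al'K; apply: (@span_triangular k N generator hwv good stat).
- move=> u [nu [P [Qt [alpha [sn [oP oQ] [wP wQ] ain ->]]]]].
  have [H _] := repsP sn oP oQ wP wQ; have [S _ [bij _ _]] := H _ ain.
  by have [a' aK a'K] := bij; apply: hwv_upoly aK a'K.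
- move=> c u v [wu ru cu] [wv rv cv]; split.
  + move=> M; rewrite mcoeff_msupp mcoeffB mcoeffZ => h.
    have [uM|uM] := boolP (M \in msupp u); first exact: wu.
    apply: wv; apply: contraNT h => vM.
    by rewrite !memN_msupp_eq0 // mulr0 subr0.
  + move=> i i' e; under eq_bigr => z _ do rewrite mderivB mderivZ mulrBr -scalerAr.
    by rewrite sumrB -scaler_sumr ru // rv // scaler0 subr0.
  + move=> i i' e; under eq_bigr => z _ do rewrite mderivB mderivZ mulrBr -scalerAr.
    by rewrite sumrB -scaler_sumr cu // cv // scaler0 subr0.
- exact: hwv_lead.
- exact: generator_for_good.
- exact: hwv_upoly alK al'K.
Qed.

End SpanByRepresentatives.

(** * Elimination of repeated indices *)

Section Elimination.
Variables (k : fieldType) (n : nat) (B C : finType).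
Hypothesis cardBC : #|B| = #|C|.
Local Notation V := 'I_n.

Definition row_val (X : Type) (I : X -> V) (rr : B -> V) (y : X + B) :=
  match y with inl x => I x | inr b => rr b end.
Definition col_val (X : Type) (I : X -> V) (cc : C -> V) (y : X + C) :=
  match y with inl x => I x | inr c => cc c end.

Definition traceless (A : 'M[k]_n) := forall e, (0 < e)%N -> \tr (A ^+ e) = 0.

(** Each element of [X] is a summed index, used once as a row and once as a column when [th] is a
    bijection. The elements of [B] and [C] are free rows and columns, and [th] assigns its column to
    the factor with a given row. *)
Definition contraction (X : finType) (th : X + B -> X + C) (eps : X + B -> nat)
    (A : 'M[k]_n) (rr : B -> V) (cc : C -> V) : k :=
  \sum_(I : {ffun X -> V}) \prod_(y : X + B)
     (A ^+ eps y) (row_val I rr y) (col_val I cc (th y)).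

(** The data [a], [E], [al] precede [A], so that one formula holds for all traceless matrices. *)
Definition reducible X th eps := exists (a : k) (E : B -> nat) (al : B -> C),
  injective al /\ forall A, traceless A -> forall rr cc,
    @contraction X th eps A rr cc = a * \prod_b (A ^+ E b) (rr b) (cc (al b)).

(* Summing over one index of X either closes a loop, giving a trace, or merges
   two factors into one factor with a larger exponent. *)
Let fcons K (z : V) (I : {ffun 'I_K -> V}) : {ffun 'I_K.+1 -> V} :=
  [ffun i => oapp I z (unlift ord0 i)].

Let sum_fcons K (G : {ffun 'I_K.+1 -> V} -> k) :
  \sum_I G I = \sum_z \sum_(I : {ffun 'I_K -> V}) G (fcons z I).
Proof.
rewrite pair_bigA (reindex (fun zI : V * {ffun 'I_K -> V} => fcons zI.1 zI.2)) //=.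
exists (fun I : {ffun 'I_K.+1 -> V} => (I ord0, [ffun i => I (lift ord0 i)])).
  move=> [z I] _ /=; rewrite ffunE unlift_none /=; congr (_, _).
  by apply/ffunP => i; rewrite !ffunE liftK.
move=> I _; apply/ffunP => i; rewrite ffunE /=.
by case: unliftP => [j ->|->] //=; rewrite ffunE.
Qed.

Let up K (D : Type) (y : 'I_K + D) : 'I_K.+1 + D :=
  match y with inl i => inl (lift ord0 i) | inr d => inr d end.

Let up_inj K D : injective (@up K D).
Proof. by move=> [i|d] [i'|d'] //= [] => [e|->] //; congr inl; apply/val_inj. Qed.

Let up_neq0 K D (y : 'I_K + D) : up y <> inl ord0.
Proof. by case: y => [i|d] //= [] /(congr1 val). Qed.

Let not0_up K D (y : 'I_K.+1 + D) : y <> inl ord0 -> exists y', up y' = y.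
Proof.
case: y => [i|d] ne; last by exists (inr d).
by case: (unliftP ord0 i) => [j e|e]; [exists (inl j); rewrite /= e | case: ne; rewrite e].
Qed.

Let prod_up K (D : finType) (G : 'I_K.+1 + D -> k) :
  \prod_y G y = G (inl ord0) * \prod_(y : 'I_K + D) G (up y).
Proof. by rewrite !big_sumType big_ord_recl /= mulrA. Qed.

Let row_up K z (I : {ffun 'I_K -> V}) rr y :
  row_val (fcons z I) rr (up y) = row_val I rr y.
Proof. by case: y => [i|b] //=; rewrite ffunE liftK. Qed.

Let col_up K z (I : {ffun 'I_K -> V}) cc y :
  col_val (fcons z I) cc (up y) = col_val I cc y.
Proof. by case: y => [i|b] //=; rewrite ffunE liftK. Qed.

Lemma reducible_ord K (th : 'I_K + B -> 'I_K + C) eps : injective th -> reducible th eps.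
Proof.
elim: K th eps => [|K IH] th eps th_inj.
  have exal b : exists c, th (inr b) = inr c.
    by case: (th (inr b)) => [[]|c] //; exists c.
  have [al alP] := fin_all_exists exal.
  exists 1, (fun b => eps (inr b)), al; split=> [b b' e|A _ rr cc].
    by have := th_inj (inr b) (inr b'); rewrite !alP e => /(_ erefl)[].
  have I0 : {ffun 'I_0 -> V} := ffun0 (card_ord 0).
  rewrite /contraction (bigD1 I0) //= [X in _ + X]big1 ?addr0; last first.
    by move=> I /eqP[]; apply/ffunP => -[].
  rewrite big_sumType /= big_ord0 !mul1r; apply: eq_bigr => b _.
  by rewrite alP.
have th_bij : bijective th.
  by apply: inj_card_bij => //; rewrite !card_sum !card_ord cardBC.
have [th' thK th'K] := th_bij.
pose merged (y : 'I_K + B) := if th (up y) == inl ord0 then th (inl ord0) else th (up y).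
have exw y : exists w, up w = merged y.
  apply: not0_up; rewrite /merged; case: eqP => // e e'.
  by have := th_inj (up y) (inl ord0); rewrite e e' => /(_ erefl) /up_neq0.
have [th1 th1P] := fin_all_exists exw.
pose eps1 y := (eps (up y) + if th (up y) == inl ord0 then eps (inl ord0) else 0)%N.
have th1_inj : injective th1.
  move=> y y' e; have : merged y = merged y' by rewrite -!th1P e.
  rewrite /merged; case: eqP => h; case: eqP => h'.
  - by move=> _; apply/up_inj/th_inj; rewrite h h'.
  - by move/th_inj => e0; case: (up_neq0 (esym e0)).
  - by move/th_inj => e0; case: (up_neq0 e0).
  - by move/th_inj/up_inj.
have [a [E [al [al_inj IHA]]]] := IH th1 eps1 th1_inj.
have [loop|noloop] := eqVneq (th (inl ord0)) (inl ord0).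
  (* The trace of [A ^+ 0] is [n], the only trace that survives; it does not depend on [A]. *)
  pose t : k := if eps (inl ord0) == 0%N then n%:R else 0.
  exists (t * a), E, al; split=> // A trA rr cc.
  rewrite -mulrA -(IHA A trA) /contraction sum_fcons exchange_big mulr_sumr /=.
  apply: eq_bigr => I _.
  have ne y : (th (up y) == inl ord0) = false.
    by apply/eqP; rewrite -loop => /th_inj/up_neq0.
  transitivity (\sum_z (A ^+ eps (inl ord0)) z z *
    \prod_y (A ^+ eps1 y) (row_val I rr y) (col_val I cc (th1 y))).
    apply: eq_bigr => z _; rewrite prod_up loop /= ffunE unlift_none /=; congr (_ * _).
    apply: eq_bigr => y _; rewrite row_up /eps1 ne addn0 -[col_val I cc (th1 _)](col_up z) th1P.
    by rewrite /merged ne.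
  rewrite -mulr_suml -/(\tr _); congr (_ * _); rewrite /t.
  by case: eqP => [->|/eqP h]; [rewrite expr0 mxtrace1 | rewrite trA // lt0n].
exists a, E, al; split=> // A trA rr cc.
rewrite -(IHA A trA) /contraction sum_fcons exchange_big /=; apply: eq_bigr => I _.
have [y1 y1P] : exists y1, up y1 = th' (inl ord0).
  by apply: not0_up => e; case/eqP: noloop; rewrite -e th'K.
have th1y : th (up y1) = inl ord0 by rewrite y1P th'K.
have ne y : y != y1 -> (th (up y) == inl ord0) = false.
  by move=> ny; apply/eqP; rewrite -th1y => /th_inj/up_inj/eqP; rewrite (negPf ny).
rewrite [RHS](bigD1 y1) //= {1}/eps1 th1y eqxx exprD mxE mulr_suml.
apply: eq_bigr => z _; rewrite prod_up (bigD1 y1) //= ffunE unlift_none /= row_up.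
rewrite th1y /= ffunE unlift_none /= mulrCA -mulrA; congr (_ * (_ * _)).
  by rewrite -[col_val I cc (th1 _)](col_up z) th1P /merged th1y eqxx.
apply: eq_bigr => y ny; rewrite row_up /eps1 ne // addn0 -[col_val I cc (th1 _)](col_up z) th1P.
by rewrite /merged ne.
Qed.

Lemma reducible_fin (X : finType) (th : X + B -> X + C) eps : injective th -> reducible th eps.
Proof.
move=> th_inj.
pose f (D : Type) (y : X + D) : 'I_#|X| + D :=
  match y with inl x => inl (enum_rank x) | inr d => inr d end.
pose g (D : Type) (y : 'I_#|X| + D) : X + D :=
  match y with inl i => inl (enum_val i) | inr d => inr d end.
have fK D : cancel (@f D) (@g D) by case=> [x|d] //=; rewrite enum_rankK.
have gK D : cancel (@g D) (@f D) by case=> [x|d] //=; rewrite enum_valK.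
have inj : injective (fun y => f C (th (g B y))).
  by move=> y y' /(can_inj (fK _))/th_inj/(can_inj (gK _)).
have [a [E [al [al_inj H]]]] := reducible_ord (fun y => eps (g B y)) inj.
exists a, E, al; split=> // A trA rr cc; rewrite -(H A trA) /contraction.
rewrite (reindex (fun I : {ffun 'I_#|X| -> V} => [ffun x => I (enum_rank x)])) /=; last first.
  exists (fun I : {ffun X -> V} => [ffun i => I (enum_val i)]) => I _.
    by apply/ffunP => i; rewrite !ffunE enum_valK.
  by apply/ffunP => i; rewrite !ffunE enum_rankK.
apply: eq_bigr => I _; rewrite (reindex (g B)) /=; last first.
  by exists (f B) => y _; rewrite ?fK ?gK.
apply: eq_bigr => y _; congr (fun_of_matrix _ _ _).
  by case: y => [i|b] //=; rewrite ffunE enum_valK.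
by rewrite -{1}(fK _ (th (g B y))); case: (f _ _) => [i|c] //=; rewrite ffunE enum_valK.
Qed.

End Elimination.

(** Composition with the transposition of a moved box and its preimage creates a fixed point and
    destroys none; hence an induction on the number of moved boxes. *)
Lemma colstab_ind (Z : finType) (c : Z -> nat) (P : {perm Z} -> Prop) :
  P 1%g ->
  (forall p a b, c a = c b -> a != b -> p \in colstab c -> P p -> P (tperm a b * p)%g) ->
  forall p, p \in colstab c -> P p.
Proof.
move=> P1 PM p; move sz : #|[set a | p a != a]| => d.
elim/ltn_ind: d p sz => d IH p sz pc; have cp := colstabP _ _ pc.
have [a pa|fix_all] := pickP (fun a => p a != a); last first.
  rewrite (_ : p = 1%g) //; apply/perm.permP => a; rewrite perm1.
  by apply/eqP; have := fix_all a; rewrite /= => /negbFE.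
pose b := (p^-1)%g a; have pb : p b = a by rewrite permKV.
have ab : a != b by apply: contraNneq pa => ab; rewrite {1}ab pb.
have cab : c a = c b by rewrite -{1}pb cp.
have tc : (tperm a b * p)%g \in colstab c by apply: colstabM => //; apply: colstab_tperm.
rewrite -[p](mulKg (tperm a b)) tpermV; apply: PM => //.
apply: (IH #|[set x | (tperm a b * p)%g x != x]|) => //; rewrite -sz.
apply: proper_card; apply/properP; split; last first.
  by exists a; rewrite !inE // permM tpermL pb eqxx.
apply/subsetP => x; rewrite !inE permM; case: tpermP => [->|->|_ _] //.
by rewrite pb eq_sym ab.
Qed.

(** * Expansion of the minors and determinants *)

Section Blocks.
Variables (k : fieldType) (e n : nat).
Hypothesis char0 : [pchar k] =i pred0.
Local Notation V := 'I_n.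
Local Notation X := ('I_e * 'I_n)%type.
Implicit Types (t rho pi : {ffun 'I_e -> 'S_n}).

Definition flat t : {ffun X -> V} := [ffun x => t x.1 x.2].
Definition block_sign t : k := \prod_l (-1) ^+ odd_perm (t l).

Definition swap_in l i i' t : {ffun 'I_e -> 'S_n} :=
  [ffun j => if j == l then (tperm i i' * t j)%g else t j].
Definition swap_out l i i' t : {ffun 'I_e -> 'S_n} :=
  [ffun j => if j == l then (t j * tperm i i')%g else t j].

Lemma swap_inK l i i' : involutive (swap_in l i i').
Proof.
move=> t; apply/ffunP => j; rewrite !ffunE; case: eqP => // _.
by rewrite mulgA tperm2 mul1g.
Qed.

Lemma swap_outK l i i' : involutive (swap_out l i i').
Proof.
move=> t; apply/ffunP => j; rewrite !ffunE; case: eqP => // _.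
by rewrite -mulgA tperm2 mulg1.
Qed.

Let sign_eq l t t' : odd_perm (t l) = ~~ odd_perm (t' l) ->
  (forall j, j != l -> t j = t' j) -> block_sign t = - block_sign t'.
Proof.
move=> ol oj; rewrite /block_sign (bigD1 l) //= [in RHS](bigD1 l) //= ol signrN mulNr.
by congr (- (_ * _)); apply: eq_bigr => j /oj ->.
Qed.

Lemma swap_in_sign l i i' t : i != i' -> block_sign (swap_in l i i' t) = - block_sign t.
Proof.
move=> ii; apply: (@sign_eq l) => [|j /negPf jl]; rewrite ffunE ?eqxx ?jl //.
by rewrite odd_permM odd_tperm ii addTb.
Qed.

Lemma swap_out_sign l i i' t : i != i' -> block_sign (swap_out l i i' t) = - block_sign t.
Proof.
move=> ii; apply: (@sign_eq l) => [|j /negPf jl]; rewrite ffunE ?eqxx ?jl //.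
by rewrite odd_permM odd_tperm ii addbT.
Qed.

Let opp_eq0 (x : k) : x = - x -> x = 0.
Proof.
move/eqP; rewrite -addr_eq0 -mulr2n -mulr_natr mulf_eq0.
by rewrite (negPf (natr_neq0 char0 _)) // orbF => /eqP.
Qed.

Lemma flat_inj : injective flat.
Proof.
move=> t t' /ffunP H; apply/ffunP => l; apply/perm.permP => i.
by have := H (l, i); rewrite !ffunE.
Qed.

(** Writing [t] as [pi] followed by [rho] leaves one sign. The sum over [rho] may then be extended
    to all index functions, because one that repeats a value in a block cancels under a
    transposition. This turns sums over permutations into the free sums of matrix products. *)
Lemma pair_alternation (K : {ffun X -> V} -> {ffun X -> V} -> k) :
  \sum_rho \sum_t block_sign rho * block_sign t * K (flat rho) (flat t) =
  \sum_pi block_sign pi * \sum_(I : {ffun X -> V}) K I [ffun x => I (x.1, pi x.1 x.2)].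
Proof.
under [RHS]eq_bigr => pi _ do rewrite mulr_sumr.
rewrite [RHS]exchange_big /= [RHS](bigID (mem (flat @: setT))) /= [X in _ = _ + X]big1 ?addr0.
  rewrite big_imset /=; last by move=> ? ? _ _; apply: flat_inj.
  apply: eq_big => [rho|rho _]; first by rewrite inE.
  rewrite (reindex (fun pi => [ffun l => (pi l * rho l)%g])) /=; last first.
    exists (fun t => [ffun l => (t l * (rho l)^-1)%g]) => t _; apply/ffunP => l;
      by rewrite !ffunE ?mulgK ?mulgKV.
  apply: eq_bigr => pi _; congr (_ * K _ _).
    rewrite /block_sign -big_split; apply: eq_bigr => l _ /=.
    by rewrite ffunE odd_permM signr_addb mulrCA -signr_addb addbb mulr1.
  by apply/ffunP => -[l i]; rewrite !ffunE permM.
move=> I nI; have [l inj] : exists l, ~~ injectiveb (fun i => I (l, i)).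
  apply/existsP; apply: contraR nI; rewrite negb_exists => /forallP H.
  have Hi l : injective (fun i => I (l, i)) by apply/injectiveP; have := H l; rewrite negbK.
  apply/imsetP; exists [ffun l => perm (Hi l)]; rewrite ?inE //.
  by apply/ffunP => -[l i]; rewrite !ffunE permE.
have [i [i' ii eI]] := injectivePn _ inj; set S := \sum_pi _.
apply: opp_eq0; rewrite {1}/S (reindex_inj (inv_inj (@swap_outK l i i'))) -sumrN.
apply: eq_bigr => pi _; rewrite swap_out_sign // mulNr; congr (- (_ * K I _)).
apply/ffunP => -[j a]; rewrite !ffunE /=; case: eqP => // ->.
by rewrite permM; case: tpermP => [->|->|].
Qed.

Section ColumnAlternation.
Variables (Z : finType) (rw : Z -> V) (cl : Z -> 'I_e) (cn : Z -> nat) (c : 'I_e -> nat).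
Hypothesis cnE : forall b, cn b = (cl b).+1.
Hypothesis rc_inj : forall b b', rw b = rw b' -> cl b = cl b' -> b = b'.
Hypothesis below : forall b, (rw b < c (cl b))%N.
Hypothesis fill : forall l (i : V), (i < c l)%N -> exists2 b, cl b = l & rw b = i.

Let constr := family (fun l => [pred s : 'S_n | perm_on (first_cols n (c l)) s]).

Let im (q : {perm Z}) : {ffun Z -> V} := [ffun b => rw (q b)].
Let val_of t : {ffun Z -> V} := [ffun b => t (cl b) (rw b)].
Let coef (h : {ffun Z -> V}) : k := \sum_(t in constr | val_of t == h) block_sign t.

Let cl_perm q b : q \in colstab cn -> cl (q b) = cl b.
Proof. by move=> /colstabP/(_ b); rewrite !cnE => -[/val_inj]. Qed.

Let coef_swap (h : {ffun Z -> V}) a b : cn a = cn b -> a != b ->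
  coef [ffun z => h (tperm a b z)] = - coef h.
Proof.
rewrite !cnE => -[/val_inj cab] ab.
have rab : rw a != rw b by apply: contra ab => /eqP E; rewrite (rc_inj E cab).
rewrite {1}/coef (reindex_inj (inv_inj (@swap_inK (cl a) (rw a) (rw b)))) -sumrN /=.
apply: eq_big => [t|t _]; last by rewrite swap_in_sign.
congr (_ && _).
  apply/familyP/familyP => H l; have := H l; rewrite !inE ffunE //; case: eqP => // -> on.
    have t_on : perm_on (first_cols n (c (cl a))) (tperm (rw a) (rw b)).
      apply/subsetP => x; rewrite !inE; case: tpermP => [->|->|]; rewrite ?eqxx //.
      by rewrite cab.
    by rewrite -[t _](mulKg (tperm (rw a) (rw b))) tpermV perm_onM.
  apply: perm_onM => //; apply/subsetP => x; rewrite !inE.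
  by case: tpermP => [->|->|]; rewrite ?eqxx // cab.
apply/eqP/eqP => /ffunP H; apply/ffunP => z.
  have := H (tperm a b z); rewrite !ffunE tpermK => <-.
  case: tpermP => [->|->|/eqP za /eqP zb].
  - by rewrite -cab eqxx permM tpermR.
  - by rewrite eqxx permM tpermL cab.
  case: eqP => // cz; rewrite permM tpermD //.
    by apply: contra za => /eqP E; apply/eqP/esym/rc_inj; rewrite ?cz.
  by apply: contra zb => /eqP E; apply/eqP/esym/rc_inj; rewrite ?cz.
have := H (tperm a b z); rewrite !ffunE => <-.
case: tpermP => [->|->|/eqP za /eqP zb].
- by rewrite eqxx permM tpermL cab.
- by rewrite -cab eqxx permM tpermR.
case: eqP => // cz; rewrite permM tpermD //.
  by apply: contra za => /eqP E; apply/eqP/esym/rc_inj; rewrite ?cz.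
by apply: contra zb => /eqP E; apply/eqP/esym/rc_inj; rewrite ?cz.
Qed.

Let coef_im q : q \in colstab cn -> coef (im q) = (-1) ^+ odd_perm q.
Proof.
move: q; apply: colstab_ind => [|p a b cab ab pc IH]; last first.
  have -> : im (tperm a b * p)%g = [ffun z => im p (tperm a b z)].
    by apply/ffunP => z; rewrite !ffunE permM.
  by rewrite coef_swap // IH odd_permM odd_tperm ab signr_addb mulN1r.
rewrite odd_perm1 expr0 /coef (bigD1 [ffun=> 1%g]) /=; last first.
  apply/andP; split; first by apply/familyP => l; rewrite inE ffunE perm_on1.
  by apply/eqP/ffunP => b; rewrite !ffunE !perm1.
rewrite big1 ?addr0 => [|t /andP[/andP[/familyP tc /eqP/ffunP tv] /eqP[]]].
  by rewrite /block_sign big1 // => l _; rewrite ffunE odd_perm1.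
apply/ffunP => l; rewrite ffunE; apply/perm.permP => i; rewrite perm1.
have [ic|ci] := ltnP i (c l).
  have [b bl br] := fill ic; have := tv b.
  by rewrite !ffunE perm1 bl br.
by have := tc l; rewrite inE => /out_perm -> //; rewrite inE -leqNgt.
Qed.

(* As a function of the values at the boxes, the signed sum over constrained
   t is alternating in each column, hence supported on rearrangements. *)
Lemma column_alternation (H : {ffun Z -> V} -> k) :
  \sum_(t in constr) block_sign t * H (val_of t) =
  \sum_(q in colstab cn) (-1) ^+ odd_perm q * H (im q).
Proof.
have im_inj : {in colstab cn &, injective im}.
  move=> p q pc qc /ffunP E; apply/perm.permP => b; apply: rc_inj.
    by have := E b; rewrite !ffunE.
  by rewrite !cl_perm.
transitivity (\sum_(h : {ffun Z -> V}) coef h * H h).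
  rewrite (partition_big val_of predT) //=; apply: eq_bigr => h _.
  by rewrite /coef mulr_suml; apply: eq_bigr => t /andP[_ /eqP ->].
rewrite (bigID (mem (im @: colstab cn))) /= [X in _ + X]big1 ?addr0.
  by rewrite big_imset //=; apply: eq_bigr => q qc; rewrite coef_im.
move=> h nh; rewrite /coef big_pred0 ?mul0r // => t; apply/negP => /andP[tc /eqP th].
case/negP: nh; pose f b := odflt b [pick z | (cl z == cl b) && (rw z == t (cl b) (rw b))].
have fP b : cl (f b) = cl b /\ rw (f b) = t (cl b) (rw b).
  rewrite /f; case: pickP => [z /andP[/eqP-> /eqP->] //|no].
  have /familyP/(_ (cl b)) := tc; rewrite inE => /perm_closed pc.
  have lt : (t (cl b) (rw b) < c (cl b))%N.
    by have := pc (rw b); rewrite !inE below.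
  by have [z zc zr] := fill lt; have := no z; rewrite zc zr !eqxx.
have f_inj : injective f.
  move=> b b' E; have [c1 r1] := fP b; have [c2 r2] := fP b'.
  have cc : cl b = cl b' by rewrite -c1 E c2.
  by apply: rc_inj => //; apply: (@perm_inj _ (t (cl b))); rewrite -r1 E r2 cc.
apply/imsetP; exists (perm f_inj).
  by apply/colstabP => b; rewrite !cnE permE (fP b).1.
by rewrite -th; apply/ffunP => b; rewrite !ffunE permE (fP b).2.
Qed.

End ColumnAlternation.

End Blocks.

Section Matchings.
Variables (k : fieldType) (N : nat) (U X : finType) (f0 : {ffun U -> X}).

Lemma mderiv_prod_seq (xs : seq X) (F : X -> {mpoly k[N]}) i : uniq xs ->
  (\prod_(x <- xs) F x)^`M(i) = \sum_(x <- xs) (F x)^`M(i) * \prod_(y <- rem x xs) F y.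
Proof.
elim: xs => [|x xs IH] /=; first by rewrite !big_nil -mpolyC1 mderivC.
move=> /andP[nx ux]; rewrite !big_cons mderivM IH // eqxx; congr (_ + _).
rewrite mulr_sumr big_seq [RHS]big_seq; apply: eq_bigr => y yx.
have /negPf -> : x != y by apply: contraNneq nx => ->.
by rewrite big_cons mulrCA.
Qed.

(** Leibniz's rule: each derivation is spent on a different factor. The list [ms] of matchings
    depends neither on the forms nor on the variables, so it is fixed before [A]. *)
Lemma linear_form_products (us : seq U) (xs : seq X) : uniq us -> uniq xs ->
  size us = size xs -> exists ms : seq {ffun U -> X},
   (forall f, f \in ms -> {in us &, injective f} /\ {in us, forall u, f u \in xs}) /\
   forall (z : U -> 'I_N) (a : X -> 'I_N -> k),
    dop (\prod_(u <- us) 'X_(z u)) (\prod_(x <- xs) (\sum_j a x j *: 'X_j)) =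
    (\sum_(f <- ms) \prod_(u <- us) a (f u) (z u))%:MP.
Proof.
elim: us xs => [|u us IH] xs /=.
  move=> _ _ /esym/size0nil ->; exists [:: f0]; split=> // z a.
  by rewrite !big_nil dop1 big_seq1 big_nil mpolyC1.
move=> /andP[nu uus] uxs sz.
have exms x : exists ms : seq {ffun U -> X}, x \in xs ->
   (forall f, f \in ms -> {in us &, injective f} /\ {in us, forall u, f u \in rem x xs}) /\
   forall (z : U -> 'I_N) (a : X -> 'I_N -> k),
    dop (\prod_(u <- us) 'X_(z u)) (\prod_(y <- rem x xs) (\sum_j a y j *: 'X_j)) =
    (\sum_(f <- ms) \prod_(u <- us) a (f u) (z u))%:MP.
  have [xx|] := boolP (x \in xs); last by exists [::].
  have [||ms H] := IH (rem x xs) uus; [exact: rem_uniq | by rewrite size_rem // -sz |].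
  by exists ms.
have [ms msP] := fin_all_exists exms.
pose up x (f : {ffun U -> X}) := [ffun v => if v == u then x else f v].
have upE x f v : v \in us -> up x f v = f v.
  by move=> vu; rewrite ffunE; case: eqP => // e; rewrite -e vu in nu.
exists (flatten [seq [seq up x f | f <- ms x] | x <- xs]); split.
  move=> g /flatten_mapP[x xx /mapP[f fm ->]].
  have [/(_ f fm)[f_inj fin] _] := msP x xx.
  have upu : up x f u = x by rewrite ffunE eqxx.
  have ne v : v \in us -> f v != x.
    by move=> /fin; rewrite mem_rem_uniq // => /andP[].
  split.
    move=> v w; rewrite !inE => /orP[/eqP->|vu] /orP[/eqP->|wu] //.
    - by rewrite upu upE // => E; have := ne w wu; rewrite -E eqxx.
    - by rewrite upu upE // => E; have := ne v vu; rewrite E eqxx.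
    - by rewrite !upE //; apply: f_inj.
  move=> v; rewrite inE => /orP[/eqP->|vu]; first by rewrite upu.
  by rewrite upE //; apply: mem_rem; apply: fin.
move=> z a; rewrite big_cons dopM dopXU mderiv_prod_seq // dop_sumr.
rewrite big_flatten /= big_map -[RHS]/(mpolyC N _) rmorph_sum /=.
rewrite big_seq [RHS]big_seq; apply: eq_bigr => x xx.
have -> : (\sum_j a x j *: 'X_j)^`M(z u) = (a x (z u))%:MP :> {mpoly k[N]}.
  rewrite raddf_sum /= (bigD1 (z u)) //= mderivZ mderivX mnm1E eqxx.
  have -> : (U_(z u) - U_(z u) = 0)%MM by apply/mnmP => j; rewrite !mnmE subnn.
  rewrite mpolyX0 scale1r -mul_mpolyC mulr1 big1 ?addr0 // => j ju.
  by rewrite mderivZ mderivX mnm1E (negPf ju) scale0r scaler0.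
rewrite mul_mpolyC dopZr (proj2 (msP x xx)) big_map -mul_mpolyC -mpolyCM mulr_sumr.
congr (_ %:MP); apply: eq_bigr => f _; rewrite big_cons ffunE eqxx; congr (_ * _).
by rewrite big_seq [RHS]big_seq; apply: eq_bigr => v vu; rewrite upE.
Qed.

End Matchings.

Section MinorsOnBlocks.
Variables (k : fieldType) (e n : nat).
Hypothesis char0 : [pchar k] =i pred0.
Local Notation V := 'I_n.
Local Notation X := ('I_e * 'I_n)%type.
Variables (B C : finType) (rB : B -> V) (cB : B -> 'I_e) (rC : C -> V) (cC : C -> 'I_e).
Variables (nB : B -> nat) (nC : C -> nat) (d c : 'I_e -> nat).
Hypothesis nBE : forall b, nB b = (cB b).+1.
Hypothesis nCE : forall b, nC b = (cC b).+1.
Hypothesis rcB_inj : forall b b', rB b = rB b' -> cB b = cB b' -> b = b'.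
Hypothesis rcC_inj : forall b b', rC b = rC b' -> cC b = cC b' -> b = b'.
Hypothesis aboveB : forall b, (d (cB b) <= rB b)%N.
Hypothesis belowC : forall b, (rC b < c (cC b))%N.
Hypothesis fillB : forall l (i : V), (d l <= i)%N -> exists2 b, cB b = l & rB b = i.
Hypothesis fillC : forall l (i : V), (i < c l)%N -> exists2 b, cC b = l & rC b = i.
Hypothesis cardBC : #|B| = #|C|.
Implicit Types (t rho pi : {ffun 'I_e -> 'S_n}) (A : 'M[k]_n).

Definition term_data : Type := (k * {ffun B -> nat} * {ffun B -> C})%type.
(** Only the rows in [B] are antisymmetrised; [h] is a choice of columns that [column_alternation]
    treats afterwards. *)
Definition half_alternation (w : term_data) A (h : C -> V) : k :=
  w.1.1 * \sum_(p in colstab nB) (-1) ^+ odd_perm p *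
    \prod_b (A ^+ w.1.2 b) (rB (p b)) (h (w.2 b)).

Let us : seq (X + C) :=
  [seq inl x | x <- enum [pred x : X | (x.2 < d x.1)%N]] ++ [seq inr z | z <- enum C].

Let mem_inl x : (inl x \in us) = (x.2 < d x.1)%N.
Proof.
rewrite mem_cat; apply/orP/idP => [[/mapP[y]|/mapP[y _] //]|h].
  by rewrite mem_enum => h [->].
by left; apply/mapP; exists x; rewrite ?mem_enum.
Qed.

Let us_uniq : uniq us.
Proof.
have inl_inj : injective (inl : X -> X + C) by move=> ? ? [].
have inr_inj : injective (inr : C -> X + C) by move=> ? ? [].
rewrite cat_uniq !map_inj_uniq ?enum_uniq //= -enumT enum_uniq andbT.
by apply/hasPn => u /mapP[z _ ->]; apply/mapP => -[].
Qed.

(** The positions of the blocks from [d] on are the boxes of [B], and [B] has as many elements as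
    [C]. So there are as many derivations as determinant columns, and differentiation leaves a
    constant. *)
Let size_us : size us = #|{: X}|.
Proof.
have sC : size (Finite.enum C) = #|B| by rewrite -enumT -cardT cardBC.
rewrite size_cat !size_map sC -cardE.
have bx_inj : injective (fun b => (cB b, rB b)) by move=> b b' [ec er]; apply: rcB_inj.
rewrite -(card_codom bx_inj) -[RHS](cardC [pred x : X | (x.2 < d x.1)%N]); congr (_ + _)%N.
apply: eq_card => -[l i]; rewrite !inE /= -leqNgt; apply/codomP/idP => [[b [-> ->]]|h] //.
by have [b cb rb] := fillB h; exists b => //; rewrite cb rb.
Qed.

Section Matching.
Variables (f : X + C -> X) (eps : X -> nat).
Hypothesis f_inj : {in us &, injective f}.

Let target (J : X -> V) (h : C -> V) (u : X + C) : V :=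
  match u with inl x => J x | inr z => h z end.

Definition matched A (h : C -> V) : k :=
  \sum_rho \sum_(t in family (fun l => [pred s : 'S_n | perm_on (first_cols n (d l)) s]))
    block_sign k rho * block_sign k t *
    \prod_(u <- us) (A ^+ eps (f u)) (flat rho (f u)) (target (flat t) h u).

(* The factors A ^+ 0 are Kronecker deltas: they enforce the constraint on t,
   and turn matched into an unconstrained double alternation. *)
Let full (r : B -> V) A h (I J : {ffun X -> V}) : k :=
  (\prod_(u <- us) (A ^+ eps (f u)) (I (f u)) (target J h u)) *
  \prod_b (A ^+ 0) (r b) (J (cB b, rB b)).

Let Psi r A h :=
  \sum_rho \sum_t block_sign k rho * block_sign k t * full r A h (flat rho) (flat t).

Let matched_Psi A h : matched A h = Psi rB A h.
Proof.
apply: eq_bigr => rho _; rewrite [RHS](bigID (mem (family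
  (fun l => [pred s : 'S_n | perm_on (first_cols n (d l)) s])))) /= [X in _ + X]big1 ?addr0.
  apply: eq_bigr => t /familyP tc; rewrite /full [X in _ * (_ * X)]big1 ?mulr1 // => b _.
  have /out_perm tb : perm_on (first_cols n (d (cB b))) (t (cB b)) by have := tc (cB b).
  by rewrite expr0 mxE ffunE /= tb ?eqxx // inE -leqNgt.
move=> t ntc; rewrite /full.
have [b tb] : exists b, t (cB b) (rB b) != rB b.
  move: ntc; rewrite negb_forall => /existsP[l]; rewrite inE => /subsetPn[i].
  rewrite !inE -leqNgt => ti di; have [b cb rb] := fillB di.
  by exists b; rewrite cb rb.
by rewrite (bigD1 b) //= expr0 mxE ffunE /= eq_sym (negPf tb) mul0r !mulr0.
Qed.

(** Exchanging two boxes of a column in [r] amounts to exchanging two positions of [t] in that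
    block, which changes the sign. The positions before [d] are not touched, because boxes of [B]
    lie beyond them. *)
Let Psi_tperm r A h a b : nB a = nB b -> a != b ->
  Psi (fun z => r (tperm a b z)) A h = - Psi r A h.
Proof.
rewrite !nBE => -[/val_inj cab] ab.
have rab : rB a != rB b by apply: contra ab => /eqP E; rewrite (rcB_inj E cab).
rewrite /Psi -sumrN; apply: eq_bigr => rho _.
rewrite (reindex_inj (inv_inj (@swap_inK _ _ (cB a) (rB a) (rB b)))) -sumrN /=.
apply: eq_bigr => t _; rewrite swap_in_sign // mulrN !mulNr; congr (- (_ * _)).
rewrite /full; congr (_ * _).
  rewrite big_seq [RHS]big_seq; apply: eq_bigr => -[[l i]|z] //=; rewrite mem_inl /= => il.
  rewrite !ffunE /=; case: eqP => // El; rewrite permM tpermD //.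
    by apply: contraTneq il => <-; rewrite El -leqNgt.
  by apply: contraTneq il => <-; rewrite El cab -leqNgt.
rewrite (reindex_inj (@perm_inj _ (tperm a b))) /=; apply: eq_bigr => z _.
rewrite tpermK !ffunE /=; case: tpermP => [->|->|/eqP za /eqP zb].
- by rewrite -cab eqxx permM tpermR.
- by rewrite eqxx permM tpermL cab.
case: eqP => // cz; rewrite permM tpermD //.
  by apply: contra za => /eqP E; apply/eqP/esym/rcB_inj; rewrite ?cz.
by apply: contra zb => /eqP E; apply/eqP/esym/rcB_inj; rewrite ?cz.
Qed.

Let Psi_colstab r A h p : p \in colstab nB ->
  Psi (fun z => r (p z)) A h = (-1) ^+ odd_perm p * Psi r A h.
Proof.
move: p; apply: colstab_ind => [|p a b cab ab pc IH].
  rewrite odd_perm1 mul1r; apply: eq_bigr => rho _; apply: eq_bigr => t _.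
  by congr (_ * (_ * _)); apply: eq_bigr => z _; rewrite perm1.
transitivity (Psi (fun z => r (p (tperm a b z))) A h).
  apply: eq_bigr => rho _; apply: eq_bigr => t _.
  by congr (_ * (_ * _)); apply: eq_bigr => z _; rewrite permM.
by rewrite (Psi_tperm (fun z => r (p z))) // IH odd_permM odd_tperm ab signr_addb mulN1r mulNr.
Qed.

Let fimage : perm_eq [seq f u | u <- us] (enum {: X}).
Proof.
have fu : uniq [seq f u | u <- us] by rewrite map_inj_in_uniq.
apply: uniq_perm; rewrite ?enum_uniq // => x; rewrite mem_enum.
have [||_ ->] := uniq_min_size fu (s2 := enum {: X}); last by rewrite mem_enum.
  by move=> y _; rewrite mem_enum.
by rewrite [X in (_ <= X)%N]size_map size_us cardE.
Qed.

Let finv_ex x : exists u, (u \in us) && (f u == x).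
Proof.
have /mapP[u uu ->] : x \in [seq f u | u <- us] by rewrite (perm_mem fimage) mem_enum.
by exists u; rewrite uu eqxx.
Qed.

(** Each [pi] gives a contraction, which reduces to a product over [B]. Averaging over the column
    stabiliser makes every single term antisymmetric in the rows of [B], a property known at first
    only for their sum. *)
Lemma matched_alternation : exists ws : seq term_data,
  (forall w, w \in ws -> injective w.2) /\
  forall A, traceless A -> forall h, matched A h = \sum_(w <- ws) half_alternation w A h.
Proof.
have [finv finvP] := fin_all_exists finv_ex.
have fu x : finv x \in us by have /andP[] := finvP x.
have fK x : f (finv x) = x by have /andP[_ /eqP] := finvP x.
have Kf u : u \in us -> finv (f u) = u by move=> uu; apply: f_inj; rewrite ?fK ?fu.
(* The factor with row index [x] comes from the derivation [finv x]; its column is an index moved by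
   [pi], or a free column. The Kronecker deltas have the free rows. *)
pose th pi (y : X + B) : X + C := match y with
  | inl x => match finv x with inl x' => inl (x'.1, pi x'.1 x'.2) | inr z => inr z end
  | inr b => inl (cB b, pi (cB b) (rB b)) end.
pose ep (y : X + B) := match y with inl x => eps x | inr _ => 0%N end.
have th_inj pi : injective (th pi).
  have xb x b : th pi (inl x) <> inl (cB b, pi (cB b) (rB b)).
    rewrite /th; have := fu x; case: (finv x) => [[l i]|z] //=; rewrite mem_inl /= => il.
    by move=> [El Ei]; subst l; move/perm_inj: Ei il => ->; rewrite ltnNge aboveB.
  move=> [x|b] [x'|b'] => [|/xb|/esym/xb|] //.
    rewrite /th => E; congr inl; rewrite -[x]fK -[x']fK; congr f; move: E.
    case: (finv x) => [[l i]|z]; case: (finv x') => [[l' i']|z'] //= [].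
    by move=> -> /perm_inj ->.
  by move=> [/= cc]; rewrite cc => /perm_inj rr; rewrite (rcB_inj rr cc).
have exw pi := @reducible_fin k n B C cardBC X (th pi) ep (th_inj pi).
have exw1 pi : exists w : term_data, injective w.2 /\
    forall A, traceless A -> forall rr cc, contraction (th pi) ep A rr cc =
      w.1.1 * \prod_b (A ^+ w.1.2 b) (rr b) (cc (w.2 b)).
  have [a [E [al [al_inj H]]]] := exw pi.
  exists (a, [ffun b => E b], [ffun b => al b]); split=> [b b'|A tA rr cc].
    by rewrite !ffunE => /al_inj.
  by rewrite H //=; congr (_ * _); apply: eq_bigr => b _; rewrite !ffunE.
have [w wP] := fin_all_exists exw1.
pose K : k := #|colstab nB|%:R^-1.
exists [seq (block_sign k pi * (w pi).1.1 * K, (w pi).1.2, (w pi).2) | pi : {ffun 'I_e -> 'S_n}].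
split=> [_ /mapP[pi _ ->]|A tA h]; first exact: (wP pi).1.
have PsiE r : Psi r A h = \sum_pi block_sign k pi * ((w pi).1.1 *
    \prod_b (A ^+ (w pi).1.2 b) (r b) (h ((w pi).2 b))).
  rewrite /Psi pair_alternation //; apply: eq_bigr => pi _; congr (_ * _).
  rewrite -(wP pi).2 //; apply: eq_bigr => I _; rewrite /full big_sumType /=; congr (_ * _).
    pose G x := (A ^+ eps x) (I x) (target [ffun x => I (x.1, pi x.1 x.2)] h (finv x)).
    transitivity (\prod_(u <- us) G (f u)).
      by rewrite big_seq [RHS]big_seq; apply: eq_bigr => u uu; rewrite /G Kf.
    rewrite -(big_map f predT G) (perm_big _ fimage) big_enum /=; apply: eq_bigr => x _.
    by rewrite /G; case: (finv x) => [y|z] //=; rewrite ffunE.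
  by apply: eq_bigr => b _; rewrite ffunE.
have K0 : #|colstab nB|%:R != 0 :> k.
  by apply: natr_neq0 => //; apply/card_gt0P; exists 1%g; apply: colstab1.
have -> : matched A h = K * \sum_(p in colstab nB) (-1) ^+ odd_perm p * Psi (fun b => rB (p b)) A h.
  rewrite matched_Psi (eq_bigr (fun=> Psi rB A h)) => [|p pc]; last first.
    by rewrite Psi_colstab // mulrA -signr_addb addbb mul1r.
  by rewrite sumr_const -mulr_natl mulrA mulVf ?mul1r.
rewrite big_image /= mulr_sumr /half_alternation /=.
under [RHS]eq_bigr => pi _ do rewrite mulr_sumr.
rewrite [RHS]exchange_big /=; apply: eq_bigr => p _; rewrite PsiE !mulr_sumr.
apply: eq_bigr => pi _; move: K (block_sign _ _) (w pi).1.1 ((-1) ^+ _) (\prod_b _).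
by clear => x y z u t; ring.
Qed.

End Matching.

Hypotheses (e_gt0 : (0 < e)%N) (n_gt0 : (0 < n)%N).
Variables (N : nat) (xv : V -> V -> 'I_N) (eps : X -> nat) (beta : X -> V).
Hypothesis xv_inj : forall a b a' b', xv a b = xv a' b' -> a = a' /\ b = b'.

Definition block_det A (l : 'I_e) : {mpoly k[N]} :=
  \det (\matrix_(i, x) \sum_z (A ^+ eps (l, i)) x z *: 'X_(xv z (beta (l, i)))).

Definition alternation (w : term_data) A : k := w.1.1 *
  \sum_(p in colstab nB) \sum_(q in colstab nC) (-1) ^+ odd_perm p * (-1) ^+ odd_perm q *
    \prod_b (A ^+ w.1.2 b) (rB (p b)) (rC (q (w.2 b))).

Let form A (s : V) (x : X) (j : 'I_N) : k :=
  \sum_z (A ^+ eps x) s z * (j == xv z (beta x))%:R.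

Let formE A s x z b : form A s x (xv z b) = (A ^+ eps x) s z * (b == beta x)%:R.
Proof.
rewrite /form (bigD1 z) //= big1 ?addr0 => [|y yz].
  congr (_ * (nat_of_bool _)%:R); apply/eqP/eqP => [/xv_inj[]//|->//].
by case: eqP => [/xv_inj[/esym/eqP]|_]; rewrite ?(negPf yz) ?mulr0.
Qed.

Let block_detE A : \prod_l block_det A l = \sum_rho block_sign k rho *:
  \prod_(x <- enum {: X}) \sum_j form A (flat rho x) x j *: 'X_j.
Proof.
have detE l : block_det A l = \sum_(s : 'S_n) (-1) ^+ s *:
    \prod_i \sum_j form A (s i) (l, i) j *: 'X_j.
  rewrite /block_det /determinant; apply: eq_bigr => s _.
  rewrite -mul_mpolyC rmorphXn rmorphN1; congr (_ * _); apply: eq_bigr => i _.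
  rewrite mxE; under [RHS]eq_bigr => j _ do rewrite scaler_suml.
  rewrite exchange_big /=; apply: eq_bigr => z _.
  rewrite (bigD1 (xv z (beta (l, i)))) //= eqxx mulr1 big1 ?addr0 // => j /negPf ->.
  by rewrite mulr0 scale0r.
under eq_bigr => l _ do rewrite detE.
rewrite bigA_distr_bigA /=; apply: eq_bigr => rho _; rewrite scaler_prod; congr (_ *: _).
rewrite big_enum /= pair_bigA /=; apply: eq_bigr => -[l i] _ /=.
by apply: eq_bigr => j _; rewrite ffunE.
Qed.

Let constr (g : 'I_e -> nat) := family (fun l => [pred s : 'S_n | perm_on (first_cols n (g l)) s]).

Let minorsE (g : 'I_e -> nat) : \prod_l minor k xv (g l) = \sum_(t in constr g)
   block_sign k t *: \prod_(x : X | (x.2 < g x.1)%N) 'X_(xv (flat t x) x.2).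
Proof.
rewrite /minor bigA_distr_big_dep; apply: eq_bigr => t _.
rewrite scaler_prod; congr (_ *: _).
rewrite (pair_big_dep predT (fun l (i : V) => (i < g l)%N)) /=.
by apply: eq_bigr => -[l i] _ /=; rewrite ffunE.
Qed.

Lemma minors_on_blocks (v : 'I_N -> k) : exists ws : seq term_data,
  (forall w, w \in ws -> injective w.2) /\
  forall A, traceless A ->
    (dop ((\prod_l minor k xv (d l)) * \prod_l minor k xv (c l)) (\prod_l block_det A l)).@[v] =
    \sum_(w <- ws) alternation w A.
Proof.
have X0 : X := (Ordinal e_gt0, Ordinal n_gt0).
have us_enum : size us = size (enum {: X}) by rewrite size_us cardE.
have [ms [msP H]] := @linear_form_products k N (X + C)%type {: X} [ffun=> X0] us _ us_uniq
  (enum_uniq _) us_enum.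
pose z (t : {ffun 'I_e -> 'S_n}) (h : C -> V) (u : X + C) :=
  match u with inl x => xv (flat t x) x.2 | inr y => xv (h y) (rC y) end.
pose col (u : X + C) := match u with inl x => x.2 | inr y => rC y end.
(* A derivation in column [col u] kills the linear forms in the variables of any other column. *)
pose kappa (f : {ffun X + C -> X}) : k := \prod_(u <- us) (col u == beta (f u))%:R.
have exws (f : {ffun X + C -> X}) : exists ws : seq term_data, f \in ms ->
  (forall w, w \in ws -> injective w.2) /\
  forall A, traceless A -> forall h, matched f eps A h = \sum_(w <- ws) half_alternation w A h.
  have [fm|] := boolP (f \in ms); last by exists [::].
  by have [ws wsP] := matched_alternation eps (msP f fm).1; exists ws.
have [ws wsP] := fin_all_exists exws.
exists (flatten [seq [seq (kappa f * w.1.1, w.1.2, w.2) | w <- ws f] | f <- ms]).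
split=> [_ /flatten_mapP[f fm /mapP[w ww ->]]|A tA]; first exact: (wsP f fm).1 w ww.
pose hC (t : {ffun 'I_e -> 'S_n}) : {ffun C -> V} := [ffun b => t (cC b) (rC b)].
have prodE t t2 : (\prod_(x : X | (x.2 < d x.1)%N) 'X_(xv (flat t x) x.2)) *
    (\prod_(x : X | (x.2 < c x.1)%N) 'X_(xv (flat t2 x) x.2)) =
    \prod_(u <- us) 'X_(z t (hC t2) u) :> {mpoly k[N]}.
  rewrite /us big_cat !big_map !big_enum /=; congr (_ * _).
  rewrite (eq_bigl (mem [set (cC b, rC b) | b in C])); last first.
    move=> [l i]; rewrite !inE /=; apply/idP/imsetP => [ic|[b _ [-> ->]] //].
    by have [b cb rb] := fillC ic; exists b; rewrite ?cb ?rb.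
  rewrite big_imset /=; last by move=> b b' _ _ [cc rr]; apply: rcC_inj.
  by apply: eq_bigr => b _; rewrite !ffunE.
have step t t2 rho : (dop ((\prod_(x : X | (x.2 < d x.1)%N) 'X_(xv (flat t x) x.2)) *
      (\prod_(x : X | (x.2 < c x.1)%N) 'X_(xv (flat t2 x) x.2)))
    (\prod_(x <- enum {: X}) \sum_j form A (flat rho x) x j *: 'X_j)).@[v] =
    \sum_(f <- ms) kappa f * \prod_(u <- us) (A ^+ eps (f u)) (flat rho (f u))
       (match u with inl x => flat t x | inr y => hC t2 y end).
  rewrite prodE (H _ (fun x => form A (flat rho x) x)) mevalC; apply: eq_bigr => f _.
  rewrite -big_split; apply: eq_bigr => u _; rewrite /= mulrC.
  by case: u => [x|y] /=; rewrite formE.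
transitivity (\sum_(f <- ms) kappa f * \sum_(t2 in constr c) block_sign k t2 *
    matched f eps A (hC t2)).
  rewrite block_detE !minorsE big_distrlr /= dop_suml raddf_sum /=.
  rewrite (eq_bigr (fun t => \sum_(f <- ms) \sum_(t2 in constr c) \sum_rho
    kappa f * (block_sign k t2 * (block_sign k rho * block_sign k t *
      \prod_(u <- us) (A ^+ eps (f u)) (flat rho (f u))
       (match u with inl x => flat t x | inr y => hC t2 y end))))) => [|t _]; last first.
    rewrite dop_suml raddf_sum /= [RHS]exchange_big /=; apply: eq_bigr => t2 _.
    rewrite [RHS]exchange_big /= -scalerAl -scalerAr !dopZl dop_sumr !scaler_sumr raddf_sum /=.
    apply: eq_bigr => rho _; rewrite dopZr !mevalZ step !mulr_sumr; apply: eq_bigr => f _.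
    move: (kappa f) (block_sign k t) (block_sign k t2) (block_sign k rho) (\prod_(u <- us) _).
    by clear=> *; ring.
  rewrite exchange_big /=; apply: eq_bigr => f _; rewrite mulr_sumr exchange_big /=.
  apply: eq_bigr => t2 _; rewrite exchange_big /= /matched !mulr_sumr.
  by apply: eq_bigr => rho _; rewrite !mulr_sumr.
rewrite big_flatten /= big_map big_seq [RHS]big_seq; apply: eq_bigr => f fm.
rewrite (column_alternation nCE rcC_inj belowC fillC (fun h => matched f eps A h)).
rewrite /= big_map; under eq_bigr => q _ do rewrite (wsP f fm).2 // mulr_sumr.
rewrite exchange_big /= mulr_sumr; apply: eq_bigr => w _.
rewrite /alternation /half_alternation /= -mulrA; congr (_ * _).
rewrite exchange_big /= mulr_sumr; apply: eq_bigr => q _; rewrite !mulr_sumr.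
apply: eq_bigr => p _.
rewrite mulrCA; congr (_ * _); rewrite mulrA [_ * (-1) ^+ _]mulrC; congr (_ * _).
by apply: eq_bigr => b _; rewrite ffunE.
Qed.

End MinorsOnBlocks.

(** * Transport along conjugation *)

Section GenericMatrix.
Variables (k : fieldType) (n : nat).
Hypothesis char0 : [pchar k] =i pred0.
Local Notation V := 'I_n.
Local Notation N := (n * n)%N.

Definition xv (i j : V) : 'I_N := mxvec_index i j.

Lemma xv_inj i j i' j' : xv i j = xv i' j' -> i = i' /\ j = j'.
Proof. by move/cast_ord_inj/enum_rank_inj => [-> ->]. Qed.

Definition coords (h : 'M[k]_n) : 'I_N -> k := fun u => mxvec h 0 u.

Lemma coordsE h i j : coords h (xv i j) = h i j.
Proof. exact: mxvecE. Qed.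

Lemma coords_surj (v : 'I_N -> k) : exists h, coords h =1 v.
Proof.
exists (\matrix_(i, j) v (xv i j)) => u; case/mxvec_indexP: u => i j.
by rewrite coordsE mxE.
Qed.

(** The product of [q] with the generic determinant vanishes at singular matrices as well, and the
    determinant is a nonzero polynomial. *)
Lemma eq0_on_units (q : {mpoly k[N]}) :
  (forall h : 'M[k]_n, h \in unitmx -> q.@[coords h] = 0) -> q = 0.
Proof.
move=> q0; pose D : {mpoly k[N]} := \det (\matrix_(i, j) 'X_(xv i j)).
have DE h : D.@[coords h] = \det h.
  rewrite /D -(det_map_mx (meval (coords h))); congr (\det _); apply/matrixP => i j.
  by rewrite !mxE /= mevalXU coordsE.
have /eqP : D * q = 0.
  apply: (meval_eq0 char0) => v; have [h hv] := coords_surj v.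
  rewrite mevalM -!(meval_eq _ hv) DE.
  have [/eqP ->|uh] := boolP (\det h == 0); first by rewrite mul0r.
  by rewrite q0 ?mulr0 // unitmxE unitfE.
rewrite mulf_eq0 => /orP[/eqP D0|/eqP //].
by have := DE 1%:M; rewrite D0 meval0 det1 => /esym/eqP; rewrite oner_eq0.
Qed.

Lemma mul_delta_entry (h : 'M[k]_n) (a b i j : V) : (h *m delta_mx a b) i j = h i a *+ (j == b).
Proof.
rewrite !mxE (bigD1 a) //= big1 ?addr0 => [|x xa]; last by rewrite mxE (negPf xa) mulr0.
by rewrite mxE eqxx mulr_natr.
Qed.

Definition dilation (a : V) (s : k) : 'M[k]_n :=
  diag_mx (\row_(j < n) (if j == a then s else 1)%R).

(** The first half differentiates at [t = 0]. For weights, [P] on the curve dilating column [a] is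
    compared with a multiple of ['X^(kap a)] at nonzero parameters, and differentiation takes place
    at [1], since the dilation by [0] is not invertible. *)
Lemma highest_of_equivariance (kap : V -> nat) (P : {mpoly k[N]}) :
  (forall (h : 'M_n) (a b : V) (t : k), h \in unitmx -> (a < b)%N ->
     P.@[coords (h *m (1%:M + t *: delta_mx a b))] = P.@[coords h]) ->
  (forall (h : 'M_n) (a : V) (s : k), h \in unitmx -> s != 0 ->
     P.@[coords (h *m dilation a s)] = s ^+ kap a * P.@[coords h]) ->
  highest xv kap P.
Proof.
move=> Punip Pdil; split=> [a b ab|a].
  apply: eq0_on_units => h uh.
  apply: (@shift_derivation_at k N char0 _ (fun c => xv c a) (fun c => xv c b)) => t.
  rewrite -[RHS](Punip _ a b t) //; apply: meval_eq => u; case/mxvec_indexP: u => i j.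
  rewrite -/(xv i j) coordsE mulmxDr mulmx1 -scalemxAr [RHS]mxE /shift_along coordsE.
  congr (_ + _); rewrite [RHS]mxE mul_delta_entry; congr (_ * _).
  have [->|jb] := eqVneq j b.
    by rewrite (big_pred1 i) ?coordsE // => c; apply/eqP/eqP => [/xv_inj[]//|->].
  by rewrite big_pred0 // => c; apply: contraNF jb => /eqP/xv_inj[_ ->].
apply/eqP; rewrite -subr_eq0; apply/eqP/eq0_on_units => h uh.
pose w u : {poly k} := (coords h u) *: (if [exists i, u == xv i a] then 'X else 1).
have ex i j : [exists i', xv i j == xv i' a] = (j == a).
  by apply/existsP/eqP => [[i' /eqP/xv_inj[]//]|->]; exists i.
have wE s u : (w u).[s] = coords (h *m dilation a s) u.
  case/mxvec_indexP: u => i j; rewrite -/(xv i j) /w ex !coordsE /dilation mul_mx_diag !mxE.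
  by case: eqP => _; rewrite !hornerE.
have q0 : curve_eval w P - P.@[coords h] *: 'X^(kap a) = 0.
  apply: (poly_eq0_nonzero_points char0) => s s0.
  by rewrite !hornerE horner_curve (meval_eq _ (wE s)) Pdil // mulrC subrr.
have := congr1 (fun q : {poly k} => q^`().[1]) q0.
rewrite /= derivB deriv0 horner0 derivZ derivXn hornerD hornerN hornerZ hornerMn hornerXn expr1n.
rewrite mevalB mevalZ => E; rewrite -[RHS]E mulr_natr mulr_natl; congr (_ - _).
rewrite deriv_curve horner_sum raddf_sum /=.
transitivity (\sum_(u | [exists i, u == xv i a]) coords h u * P^`M(u).@[coords h]).
  have xva_inj : injective (xv^~ a) by move=> i i' /xv_inj[].
  rewrite (eq_bigl (mem [set xv i a | i : V])) => [|u]; last first.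
    by rewrite inE; apply/existsP/imsetP => [[i /eqP->]|[i _ ->]]; exists i.
  rewrite big_imset /=; last by move=> i i' _ _ /xva_inj.
  by apply: eq_big => [i|i _]; rewrite ?inE // mevalM mevalXU.
rewrite big_mkcond; apply: eq_bigr => u _; rewrite hornerM horner_curve /w derivZ hornerZ.
have -> : P^`M(u).@[fun i => (w i).[1]] = P^`M(u).@[coords h].
  apply: meval_eq => u'; rewrite -/(w u') wE; congr coords.
  rewrite /dilation (_ : \row__ _ = const_mx 1) ?diag_const_mx ?mulmx1 //.
  by apply/rowP => j; rewrite !mxE if_same.
by case: existsP => _; rewrite ?derivX ?derivC ?hornerE /= ?mulr0 ?mulr1 // mulrC.
Qed.

End GenericMatrix.

Section Cramer.
Variables (k : fieldType) (n : nat).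
Local Notation V := 'I_n.
Local Notation N := (n * n)%N.

Lemma det_replaced_column (Y : 'M[k]_n) (a b : V) :
  \det (\matrix_(i, j) (if j == a then Y i b else (i == j)%:R)) = Y a b.
Proof.
set M := \matrix_(i, j) _; rewrite (expand_det_col M a) (bigD1 a) //=.
have cof i : cofactor M i a = (i == a)%:R.
  have -> : cofactor M i a = cofactor 1%:M i a.
    rewrite /cofactor; congr (_ * \det _); apply/matrixP => x y.
    by rewrite !mxE eq_sym (negPf (neq_lift _ _)).
  have := mulmx1 (\adj (1%:M : 'M[k]_n)); rewrite -{1}(mul1mx (_ *m _)) mulmxA.
  by rewrite mul1mx mul_adj_mx det1 => /matrixP/(_ a i); rewrite !mxE eq_sym.
rewrite cof eqxx mulr1 mxE eqxx big1 ?addr0 // => i ia.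
by rewrite cof (negPf ia) mulr0.
Qed.

Lemma prod_onth (K : pzSemiRingType) (T : Type) (e : nat) (s : seq T) (F : T -> K) :
  (size s <= e)%N -> \prod_(i < e) (if onth s i is Some u then F u else 1) = \prod_(u <- s) F u.
Proof.
elim: s e => [|u s IH] e /=; first by rewrite big_nil big1 // => -[[|i] ?].
by case: e => // e se; rewrite big_ord_recl big_cons /= IH.
Qed.

Variable e : nat.
Local Notation X := ('I_e * V)%type.

Lemma meval_block_det (eps : X -> nat) (beta : X -> V) (A h : 'M[k]_n) l :
  (block_det (xv (n := n)) eps beta A l).@[coords h] =
  \det (\matrix_(x, i) (A ^+ eps (l, i) *m h) x (beta (l, i))).
Proof.
rewrite /block_det -(det_map_mx (meval (coords h))) -det_tr; congr (\det _).
apply/matrixP => i x; rewrite !mxE raddf_sum /=; apply: eq_bigr => z _.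
by rewrite mevalZ mevalXU coordsE.
Qed.

(** Cramer's rule without inverses: replacing column [a] of [h] by column [b] of [A h = h Y] gives
    [h] times the identity whose column [a] is replaced by column [b] of [Y]. *)
Lemma block_det_entry (eps : X -> nat) (beta : X -> V) (A h Y : 'M[k]_n) l a b :
  A *m h = h *m Y ->
  (forall i, eps (l, i) = (i == a)) ->
  (forall i, beta (l, i) = if i == a then b else i) ->
  (block_det (xv (n := n)) eps beta A l).@[coords h] = \det h * Y a b.
Proof.
move=> AhY He Hb; rewrite meval_block_det -det_replaced_column -det_mulmx.
congr (\det _); apply/matrixP => x i; rewrite [LHS]mxE He Hb.
have [->|ia] := eqVneq i a.
  by rewrite expr1 AhY !mxE; apply: eq_bigr => z _; rewrite mxE eqxx.
rewrite expr0 mul1mx [RHS]mxE (bigD1 i) //= mxE (negPf ia) eqxx mulr1 big1 ?addr0 // => z zi.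
by rewrite mxE (negPf ia) (negPf zi) mulr0.
Qed.

Lemma block_det_pad (eps : X -> nat) (beta : X -> V) (A h : 'M[k]_n) l :
  (forall i, eps (l, i) = 0%N) -> (forall i, beta (l, i) = i) ->
  (block_det (xv (n := n)) eps beta A l).@[coords h] = \det h.
Proof.
move=> He Hb; rewrite meval_block_det; congr (\det _); apply/matrixP => x i.
by rewrite mxE He Hb expr0 mul1mx.
Qed.

Lemma block_det_monomial (mm : 'X_{1..N}) : (mdeg mm <= e)%N ->
  exists (eps : X -> nat) (beta : X -> V), forall A h Y : 'M[k]_n, A *m h = h *m Y ->
    (\prod_l block_det (xv (n := n)) eps beta A l).@[coords h] =
    \det h ^+ e * \prod_u coords Y u ^+ mm u.
Proof.
move=> me; have exab (u : 'I_N) : exists ab : V * V, xv ab.1 ab.2 = u.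
  by case/mxvec_indexP: u => i j; exists (i, j).
have [ab abP] := fin_all_exists exab.
pose s := flatten [seq nseq (mm u) u | u <- enum 'I_N].
have s_size : size s = mdeg mm.
  rewrite size_flatten /shape -map_comp mdegE sumnE big_map big_enum /=.
  by apply: eq_bigr => u _; rewrite size_nseq.
have s_prod (F : 'I_N -> k) : \prod_(u <- s) F u = \prod_u F u ^+ mm u.
  rewrite big_flatten /= big_map big_enum /=; apply: eq_bigr => u _.
  by rewrite big_nseq iter_mulr_1.
(* Block [l] carries the [l]-th variable of the monomial; the blocks beyond its degree are plain
   determinants of [h], so the power of the determinant is always [e]. *)
pose sl (l : 'I_e) := onth s l.
exists (fun x => if sl x.1 is Some u then nat_of_bool (x.2 == (ab u).1) else 0%N).
exists (fun x => if sl x.1 is Some u then (if x.2 == (ab u).1 then (ab u).2 else x.2) else x.2).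
move=> A h Y AhY; rewrite rmorph_prod /=.
rewrite (eq_bigr (fun l => \det h * (if sl l is Some u then coords Y u else 1))).
  rewrite big_split /= prodr_const card_ord; congr (_ * _); rewrite -s_prod /sl.
  by rewrite prod_onth ?s_size.
move=> l _; case E: (sl l) => [u|]; last first.
  by rewrite (@block_det_pad _ _ _ _ l) ?mulr1 // => i; rewrite /= E.
rewrite -(abP u) coordsE.
by apply: block_det_entry => // i; rewrite /= E.
Qed.

Lemma transported_polynomial (p : {mpoly k[N]}) : (msize p <= e.+1)%N ->
  exists L : seq (k * (X -> nat) * (X -> V)), forall A h Y : 'M[k]_n, A *m h = h *m Y ->
    (\sum_(w <- L) w.1.1 *: \prod_l block_det (xv (n := n)) w.1.2 w.2 A l).@[coords h] =
    \det h ^+ e * p.@[coords Y].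
Proof.
move=> pe; have : {in msupp p, forall mm, mdeg mm <= e}%N.
  by move=> mm /msize_mdeg_lt/leq_trans/(_ pe).
suff H r : {in r, forall mm, mdeg mm <= e}%N ->
  exists L : seq (k * (X -> nat) * (X -> V)), forall A h Y : 'M[k]_n, A *m h = h *m Y ->
    (\sum_(w <- L) w.1.1 *: \prod_l block_det (xv (n := n)) w.1.2 w.2 A l).@[coords h] =
    \det h ^+ e * \sum_(mm <- r) p@_mm * \prod_u coords Y u ^+ mm u.
  by move=> /H[L HL]; exists L => A h Y /HL; rewrite mevalE.
elim: r => [|mm r IH] re.
  by exists [::] => A h Y _; rewrite !big_nil mulr0 meval0.
have [|L HL] := IH; first by move=> x xr; apply: re; rewrite inE xr orbT.
have [|eps [beta H]] := @block_det_monomial mm; first by apply: re; rewrite inE eqxx.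
exists ((p@_mm, eps, beta) :: L) => A h Y AhY.
by rewrite !big_cons mevalD (HL _ _ _ AhY) mulrDr mevalZ (H _ _ _ AhY) mulrCA.
Qed.
End Cramer.

(** The eigenvalues of a power of [A] are zero, so over an algebraically closed field its
    characteristic polynomial is a power of ['X], and the trace is a coefficient of it up to
    sign. *)
Lemma nilpotent_traceless (k : closedFieldType) (n : nat) (A : 'M[k]_n) :
  A ^+ n = 0 -> traceless A.
Proof.
move=> An e e0; case: n A An => [|n] A An; first by rewrite /mxtrace big_ord0.
set M := A ^+ e; have Mn : M ^+ n.+1 = 0 by rewrite -exprM mulnC exprM An expr0n gtn_eqF.
have roots0 z : root (char_poly M) z -> z = 0.
  rewrite -eigenvalue_root_char => /eigenvalueP[v vM v0].
  have vMj j : v *m M ^+ j = z ^+ j *: v.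
    elim: j => [|j IH]; first by rewrite !expr0 mulmx1 scale1r.
    by rewrite exprS mulmxA vM -scalemxAl IH scalerA -exprS.
  have := vMj n.+1; rewrite Mn mulmx0 => /esym/eqP; rewrite scaler_eq0 (negPf v0) orbF.
  by rewrite expf_eq0 => /andP[_ /eqP].
have [rs rsE] := closed_field_poly_normal (char_poly M).
have rs0 z : z \in rs -> z = 0.
  move=> zrs; apply: roots0; rewrite rsE rootZ ?lead_coef_eq0 ?monic_neq0 ?char_poly_monic //.
  by rewrite root_prod_XsubC.
have ME : char_poly M = 'X^(size rs).
  rewrite rsE (monicP (char_poly_monic M)) scale1r big_seq (eq_bigr (fun=> 'X)).
    by rewrite -big_seq big_const_seq count_predT iter_mulr_1.
  by move=> z /rs0 ->; rewrite subr0.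
have sz : size rs = n.+1 by have := size_char_poly M; rewrite ME size_polyXn => -[].
have := char_poly_trace M (ltn0Sn n); rewrite ME sz coefXn /= eqn_leq ltnn andbF.
by move/esym/eqP; rewrite oppr_eq0 => /eqP.
Qed.

Section TransportedHighest.
Variables (k : fieldType) (n m : nat).
Hypothesis char0 : [pchar k] =i pred0.
Local Notation V := 'I_n.
Local Notation N := (n * n)%N.
Variables (chi : V -> int) (f : nilvar k n m -> k) (p : {mpoly k[N]}) (e : nat) (kap : V -> nat).
Hypothesis f_hw : highest_weight_space chi f.
Hypothesis f_p : forall A : nilvar k n m, f A = p.@[coords (val A)].
Hypothesis kapE : forall a, (kap a)%:Z = e%:Z + chi a.

(** Right multiplication of [h] by [S] conjugates [h^-1 A h] by [S], where the hypothesis on [f]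
    applies. The determinant contributes [s ^+ e] under a dilation, whence the weight
    [e + chi a]. *)
Lemma transported_highest (A : nilvar k n m) (P : {mpoly k[N]}) :
  (forall h Y : 'M[k]_n, val A *m h = h *m Y -> P.@[coords h] = \det h ^+ e * p.@[coords Y]) ->
  highest (@xv n) kap P.
Proof.
move=> PE; have [_ fU fT] := f_hw.
have conjE h S (uh : h \in unitmx) (uS : S \in unitmx) :
    P.@[coords (h *m S)] = \det (h *m S) ^+ e *
      f (conj_nil (exist _ S uS : GL k n) (conj_nil (exist _ h uh : GL k n) A)).
  rewrite f_p /=; apply: PE; rewrite !mulmxA -(mulmxA h S (invmx S)) mulmxV // mulmx1.
  by rewrite mulmxV // mul1mx.
have conj1 h (uh : h \in unitmx) :
    P.@[coords h] = \det h ^+ e * f (conj_nil (exist _ h uh : GL k n) A).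
  by rewrite f_p /=; apply: PE; rewrite !mulmxA mulmxV // mul1mx.
apply: highest_of_equivariance => // [h a b t uh ab|h a s uh s0].
  set S := 1%:M + _; have S1 i : S i i = 1.
    rewrite !mxE eqxx; case: eqP => [->|_] /=; last by rewrite mulr0 addr0.
    by rewrite -val_eqE (ltn_eqF ab) mulr0 addr0.
  have S0 (i j : V) : (j < i)%N -> S i j = 0.
    move=> ji; rewrite !mxE -val_eqE gtn_eqF // add0r.
    case: eqP => [ia|_] /=; last by rewrite mulr0.
    case: eqP => [jb|_] /=; last by rewrite mulr0.
    by move: ji; rewrite ia jb; lia.
  have dS : \det S = 1.
    rewrite -det_tr det_trig; first by rewrite big1 // => i _; rewrite mxE S1.
    by apply/is_trig_mxP => i j ij; rewrite mxE S0.
  have uS : S \in unitmx by rewrite unitmxE dS unitr1.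
  rewrite (conjE h S uh uS) (conj1 h uh) det_mulmx dS mulr1; congr (_ * _).
  by apply: (fU (exist _ S uS : GL k n)); split.
set S := dilation a s; have dS : \det S = s.
  rewrite det_diag (bigD1 a) //= mxE eqxx big1 ?mulr1 // => i ia.
  by rewrite mxE (negPf ia).
have uS : S \in unitmx by rewrite unitmxE dS unitfE.
rewrite (conjE h S uh uS) (conj1 h uh) det_mulmx dS.
rewrite -[f (conj_nil _ _)]/(Defs.act (exist _ S uS : GL k n) f _) fT; last exact: diag_mx_is_diag.
have -> : character_of chi (exist _ S uS : GL k n) = s ^ chi a.
  rewrite /character_of (bigD1 a) //= !mxE !eqxx big1 ?mulr1 ?mulr1n // => i ia.
  by rewrite !mxE (negPf ia) eqxx mulr1n exp1rz.
rewrite exprMn [s ^+ kap a](_ : _ = s ^+ e * s ^ chi a).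
  by rewrite -!mulrA mulrCA; congr (_ * _); rewrite mulrCA.
by rewrite -[s ^+ kap a]/(s ^ (kap a)%:Z) kapE expfzDr.
Qed.

End TransportedHighest.

(** * Weights and the spanning set *)

Definition conj_part (la : seq nat) (l : nat) : nat := count (fun x => l < x)%N la.

Lemma lt_conj_part la a l : is_partition la -> (a < conj_part la l)%N = (l < nth 0%N la a)%N.
Proof.
case/andP=> srt _; rewrite /conj_part; elim: la a srt => [|x la IH] a srt /=.
  by rewrite nth_nil.
have tr : transitive geq by move=> b c d h1 h2; exact: leq_trans h2 h1.
have le_x y : y \in la -> (y <= x)%N by have /allP H := order_path_min tr srt; apply: H.
have IH' := IH _ (path_sorted srt).
have count0 : (x <= l)%N -> count (fun y => l < y)%N la = 0%N.
  move=> xl; apply/eqP; rewrite -leqn0 leqNgt -has_count.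
  by apply/hasPn => y /le_x yx; rewrite -leqNgt (leq_trans yx).
case: a => [|a] /=; case: (ltnP l x) => lx //; first by rewrite count0.
  by rewrite add1n ltnS IH'.
rewrite count0 //; have [h|h] := ltnP a (size la); last by rewrite nth_default.
by apply/esym/negbTE; rewrite -leqNgt (leq_trans (le_x _ (mem_nth _ h))).
Qed.

Lemma count_lt_iota e b : (count (fun l => l < b) (iota 0 e) = minn e b)%N.
Proof.
elim: e => [|e IH]; first by rewrite min0n.
by rewrite -addn1 iotaD count_cat IH /= add0n addn0; case: ltnP; lia.
Qed.

Lemma sumn_ge_nth la i : (nth 0 la i <= sumn la)%N.
Proof.
elim: la i => [|x la IH] [|i] //=; first exact: leq_addr.
exact: leq_trans (IH i) (leq_addl _ _).
Qed.

(** The default value of [nth] supplies the zeros, so that one formula covers the three segments of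
    the weight. *)
Lemma weight_pairE (n : nat) (la mu : seq nat) (a : 'I_n) : (size la + size mu <= n)%N ->
  weight_pair la mu a = (nth 0%N la a)%:Z - (nth 0%N mu (n - a.+1))%:Z.
Proof.
move=> lamu_n; rewrite /weight_pair nth_cat size_map; have [h|h] := ltnP a (size la).
  rewrite (nth_map 0%N) // [nth 0%N mu _]nth_default ?subr0 //.
  by have := ltn_ord a; lia.
rewrite [nth 0%N la _]nth_default // add0r nth_cat size_nseq.
have [h1|h1] := ltnP (a - size la)%N (n - size la - size mu)%N.
  rewrite nth_nseq h1 nth_default ?oppr0 //; by have := ltn_ord a; lia.
have an := ltn_ord a.
rewrite nth_rev size_map; last by lia.
by rewrite (nth_map 0%N); [congr (- (nth _ _ _)%:Z) | ]; lia.
Qed.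

Section Alternations.
Variables (k : closedFieldType) (n m : nat).
Hypothesis char0 : [pchar k] =i pred0.
Variables (la mu : seq nat).
Hypotheses (la_part : is_partition la) (mu_part : is_partition mu).
Hypotheses (la_n : (size la <= n)%N) (mu_n : (size mu <= n)%N).
Hypothesis lamu_n : (size la + size mu <= n)%N.
Hypothesis la_mu : sumn la = sumn mu.
Hypothesis n_gt0 : (0 < n)%N.
Local Notation V := 'I_n.
Local Notation N := (n * n)%N.

(** Rows of [mu] are counted from the bottom of the matrix, since a minor of size [n] minus a column
    length of [mu] leaves out the last rows. *)
Let mu_row (b : young mu) : V := rev_ord (yrow mu_n b).
Let la_row (b : young la) : V := yrow la_n b.

Definition signed_sum (w : k * {ffun young mu -> nat} * {ffun young mu -> young la})
    (A : 'M[k]_n) : k :=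
  w.1.1 * \sum_(p in column_stabiliser (young mu)) \sum_(q in column_stabiliser (young la))
    (-1) ^+ odd_perm p * (-1) ^+ odd_perm q *
    \prod_b (A ^+ w.1.2 b) (mu_row (p b)) (la_row (q (w.2 b))).

Theorem highest_weight_signed_sums (f : nilvar k n m -> k) :
  highest_weight_space (@weight_pair n la mu) f ->
  exists ws : seq (k * {ffun young mu -> nat} * {ffun young mu -> young la}),
    (forall w, w \in ws -> injective w.2) /\
    forall A : nilvar k n m, f A = \sum_(w <- ws) signed_sum w (val A).
Proof.
move=> f_hw; have [[p f_p] _ _] := f_hw.
(* At least [msize p], for the transport, and larger than every part of [la] and of [mu], so that
   all columns of both diagrams are numbered below [e]. *)
pose e := (maxn 1 (msize p) + sumn la)%N.
have e_gt0 : (0 < e)%N by rewrite /e; lia.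
have pe : (msize p <= e.+1)%N by rewrite /e; lia.
have [L LP] := @transported_polynomial k n e p pe.
pose d (l : nat) := (n - conj_part mu l)%N.
pose c (l : nat) := conj_part la l.
pose cs := sort geq ([seq d l | l <- iota 0 e] ++ [seq c l | l <- iota 0 e]).
pose kap (a : V) := count (fun x : nat => a < x)%N cs.
have kapE (a : V) : (kap a)%:Z = e%:Z + weight_pair la mu a.
  rewrite weight_pairE // /kap (seq.permP (permEl (perm_sort _ _))) count_cat !count_map.
  rewrite (eq_count (a2 := fun l => (l < nth 0 la a)%N) (a1 := preim c _)); last first.
    by move=> l /=; rewrite lt_conj_part.
  rewrite (eq_count (a2 := predC (fun l => (l < nth 0 mu (n - a.+1))%N))); last first.
    move=> l /=; rewrite -lt_conj_part // /d; have := ltn_ord a; lia.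
  rewrite -[X in (X + _)%N](addKn (count (fun l => l < nth 0 mu (n - a.+1))%N (iota 0 e))).
  rewrite count_predC size_iota !count_lt_iota.
  by have := sumn_ge_nth la a; have := sumn_ge_nth mu (n - a.+1)%N; rewrite /e; lia.
have coords1 i j : coords (1%:M : 'M[k]_n) (xv i j) = (i == j)%:R by rewrite coordsE mxE.
have cs_sorted : sorted geq cs by apply: sort_sorted => x y; exact: leq_total.
have [D D_gt0 DP] := capelli_columns char0 (@xv_inj n) coords1 cs_sorted (fun=> erefl).
have minorsE : \prod_(x <- cs) minor k (@xv n) x =
    (\prod_(l < e) minor k (@xv n) (d l)) * \prod_(l < e) minor k (@xv n) (c l).
  rewrite (perm_big _ (permEl (perm_sort _ _))) big_cat !big_map.
  by rewrite -[in iota 0 e](subn0 e) -/(index_iota 0 e) !big_mkord.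
have col_lt (nu : seq nat) (b : young nu) : (sumn nu < e)%N -> ((col_of (val b)).-1 < e)%N.
  have /and3P[_ _ h] := youngP b; have := sumn_ge_nth nu (row_of (val b)).-1; lia.
have mu_e : (sumn mu < e)%N by rewrite /e; lia.
have la_e : (sumn la < e)%N by rewrite /e; lia.
pose mu_col (b : young mu) : 'I_e := Ordinal (col_lt _ b mu_e).
pose la_col (b : young la) : 'I_e := Ordinal (col_lt _ b la_e).
have mu_colE b : col_of (val b) = (mu_col b).+1.
  by have /and3P[_ h _] := youngP b; rewrite /= prednK.
have la_colE b : col_of (val b) = (la_col b).+1.
  by have /and3P[_ h _] := youngP b; rewrite /= prednK.
have mu_inj b b' : mu_row b = mu_row b' -> mu_col b = mu_col b' -> b = b'.
  move=> /rev_ord_inj r1 c1; apply: (y_inj r1).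
  by rewrite /ycol !mu_colE c1.
have la_inj b b' : la_row b = la_row b' -> la_col b = la_col b' -> b = b'.
  by move=> r1 c1; apply: (y_inj r1); rewrite /ycol !la_colE c1.
have mu_above b : (d (mu_col b) <= mu_row b)%N.
  have /and3P[h1 h2 h3] := youngP b; have := yrowE mu_n b.
  have := ltn_ord (yrow mu_n b).
  have : ((yrow mu_n b) < conj_part mu (mu_col b))%N by rewrite lt_conj_part //= prednK.
  by rewrite /d /=; lia.
have la_below b : (la_row b < c (la_col b))%N.
  by have /and3P[h1 h2 h3] := youngP b; rewrite /c lt_conj_part //= prednK.
have la_fill (l : 'I_e) (i : V) : (i < c l)%N -> exists2 b, la_col b = l & la_row b = i.
  rewrite /c lt_conj_part // => h.
  have bin : (i.+1, l.+1) \in young la by rewrite in_young.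
  by exists [` bin]%fset; apply/val_inj.
have mu_fill (l : 'I_e) (i : V) : (d l <= i)%N -> exists2 b, mu_col b = l & mu_row b = i.
  move=> h; have h1 : (n - i.+1 < conj_part mu l)%N by have := ltn_ord i; rewrite /d in h; lia.
  have bin : ((n - i.+1).+1, l.+1) \in young mu by rewrite in_young /= -lt_conj_part.
  exists [` bin]%fset; apply/val_inj => //=.
  by have := ltn_ord i; lia.
have card_mu_la : #|{: young mu}| = #|{: young la}|.
  by rewrite (card_young mu_n) // (card_young la_n).
have single eps beta := minors_on_blocks char0 mu_colE la_colE mu_inj la_inj mu_above la_below
  mu_fill la_fill card_mu_la e_gt0 n_gt0 eps beta (@xv_inj n) (coords 1%:M).
suff [ws [ws_inj wsP]] : exists ws : seq (k * {ffun young mu -> nat} * {ffun young mu -> young la}),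
    (forall w, w \in ws -> injective w.2) /\ forall A, traceless A ->
    (dop (\prod_(x <- cs) minor k (@xv n) x) (\sum_(w <- L) w.1.1 *:
        \prod_l block_det (xv (n:=n)) w.1.2 w.2 A l)).@[coords 1%:M] =
    \sum_(w <- ws) signed_sum w A.
  (* The Capelli scalar [D] depends on the weight only and is divided out once for all [A]. *)
  exists [seq (D%:R^-1 * w.1.1, w.1.2, w.2) | w <- ws]; split=> [_ /mapP[w ww ->]|A].
    exact: ws_inj ww.
  have tA : traceless (val A).
    by apply: nilpotent_traceless; have /andP[/eqP] := valP A.
  have D0 : D%:R != 0 :> k by apply: natr_neq0.
  rewrite big_map /signed_sum /=; under eq_bigr => w _ do rewrite -mulrA.
  rewrite -mulr_sumr -wsP // -DP.
    by rewrite mulKf // (LP _ _ (val A)) ?mulmx1 ?mul1mx // det1 expr1n mul1r f_p.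
  by apply: (transported_highest char0 f_hw f_p kapE) => h Y; apply: LP.
rewrite minorsE; elim: (L) => [|[[x eps] beta] L' [ws [ws_inj wsP]]].
  by exists [::]; split=> // A _; rewrite !big_nil dop0r meval0.
have [ws1 [ws1_inj ws1P]] := single eps beta.
exists ([seq (x * w.1.1, w.1.2, w.2) | w <- ws1] ++ ws); split=> [w|A tA].
  rewrite mem_cat => /orP[/mapP[w1 ww ->]|/ws_inj //]; exact: ws1_inj ww.
rewrite big_cons dopDr mevalD wsP // big_cat big_map /= dopZr mevalZ ws1P // mulr_sumr.
by congr (_ + _); apply: eq_bigr => w _; rewrite /signed_sum /= -mulrA.
Qed.

End Alternations.

(** * Pull-backs of the generators to the nilpotent variety *)

Lemma entryE (k : fieldType) (p q : nat) (A : 'M[k]_(p, q)) (i : 'I_p) (j : 'I_q) :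
  entry A i.+1 j.+1 = A i j.
Proof. by rewrite /entry /= !valK. Qed.

Section LinearSpan.
Variables (k : fieldType) (n m : nat) (G : (nilvar k n m -> k) -> Prop).
Implicit Types f g : nilvar k n m -> k.

Lemma linear_span0 : linear_span G (fun=> 0).
Proof. by exists 0%N, (fun=> 0), (fun _ _ => 0); split=> [[]|A] //; rewrite big_ord0. Qed.

Lemma linear_span_cons c g f : G g -> linear_span G f ->
  linear_span G (fun A => c * g A + f A).
Proof.
move=> Gg [d [c' [g' [Gg' fE]]]].
exists d.+1, (fun i => oapp c' c (unlift ord0 i)), (fun i => oapp g' g (unlift ord0 i)).
split=> [i|A]; first by case: unliftP => [j _|_] /=.
rewrite big_ord_recl unlift_none /= fE; congr (_ + _); apply: eq_bigr => i _.
by rewrite liftK.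
Qed.

Lemma linear_span_comb c f1 f2 : linear_span G f1 -> linear_span G f2 ->
  linear_span G (fun A => c * f1 A + f2 A).
Proof.
move=> [d [c1 [g1 [Gg1 f1E]]]] f2S.
have [d' [c' [g' [Gg' H]]]] : linear_span G (fun A => c * (\sum_(i < d) c1 i * g1 i A) + f2 A).
  elim: d c1 g1 Gg1 {f1E} => [|d IH] c1 g1 Gg1.
    have [d [c' [g' [Gg' f2E]]]] := f2S.
    by exists d, c', g'; split=> // A; rewrite big_ord0 mulr0 add0r.
  have := linear_span_cons (c * c1 ord0) (Gg1 ord0)
    (IH (fun i => c1 (lift ord0 i)) (fun i => g1 (lift ord0 i)) (fun i => Gg1 _)).
  move=> [d' [c' [g' [Gg' H]]]]; exists d', c', g'; split=> // A.
  by rewrite -H big_ord_recl mulrDr mulrA addrA.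
by exists d', c', g'; split=> // A; rewrite f1E.
Qed.

End LinearSpan.

Section PullBack.
Variables (k : fieldType) (n m : nat).
Variables (la mu : seq nat).
Hypotheses (la_n : (size la <= n)%N) (mu_n : (size mu <= n)%N).
Local Notation N := (n * n)%N.

(** With rows counted from the bottom, the lower left corner is the corner of small indices, and its
    size disappears from the formulas. *)
Definition power_entries (A : 'M[k]_n) (l : 'I_m) (i j : 'I_n) : k := (A ^+ l.+1) (rev_ord i) j.

Definition pull_back (Q : young mu -> 'I_m) (al : young mu -> young la) (A : 'M[k]_n) : k :=
  usum (yrow mu_n) (@ycol mu) (yrow la_n) (@ycol la) Q al (power_entries A).

Section Corner.
Variables r s : nat.
Hypotheses (mu_r : (size mu <= r)%N) (la_s : (size la <= s)%N) (rs_n : (r + s <= n)%N).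

Lemma u_fun_phi (m1 : (0 < m)%N) (Q : tableau (young mu)) (al : {ffun young mu -> young la})
    (A : 'M[k]_n) : (forall a, (0 < Q a <= m)%N) ->
  u_fun Q al (phi m r s A) = pull_back (entry_index m1 Q) al A.
Proof.
move=> Qm; apply: eq_bigr => p _; apply: eq_bigr => q _; congr (_ * _).
apply: eq_bigr => a _; have /andP[Q0 Q1] := Qm a.
have Qlt : ((Q a).-1 < m)%N by rewrite prednK.
rewrite /xcoord -[(Q a).-1]/(nat_of_ord (Ordinal Qlt)) -tnth_nth tnth_mktuple /=.
have rowr := yrowE mu_r (p a); have rown := yrowE mu_n (p a).
have := ltn_ord (yrow mu_r (p a)) => lt_r.
rewrite (_ : (r - row_of (val (p a)) + 1)%N = (rev_ord (yrow mu_r (p a))).+1); last first.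
  by rewrite /= -rowr; lia.
rewrite -(yrowE la_s (q (al a))) entryE mxE.
rewrite (_ : (n - r + _)%N = (rev_ord (yrow mu_n (p a))).+1); last first.
  by rewrite /=; move: lt_r rs_n; rewrite /=; lia.
rewrite -[(yrow la_s _).+1]/((yrow la_n (q (al a))).+1) entryE /power_entries.
by congr (fun_of_matrix (_ ^+ _) _ _); rewrite /entry_index val_insubd Qlt.
Qed.

Lemma upoly_pull_back Q al (A : 'M[k]_n) (v : 'I_(m * r * s) -> k) :
  (forall l i j, v (vix (l, i, j)) = (A ^+ (l : 'I_m).+1)
     (rev_ord (widen_ord (leq_trans (leq_addr _ _) rs_n) i))
     (widen_ord (leq_trans (leq_addl _ _) rs_n) j)) ->
  (upoly k (yrow mu_r) (@ycol mu) (yrow la_s) (@ycol la) Q al).@[v] = pull_back Q al A.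
Proof.
move=> vE; rewrite meval_upoly; apply: eq_bigr => p _; apply: eq_bigr => q _; congr (_ * _).
apply: eq_bigr => a _; rewrite vE /power_entries.
by congr (fun_of_matrix _ _ _); apply/val_inj.
Qed.

End Corner.

Lemma regular_pull_back Q al : regular (fun A : nilvar k n m => pull_back Q al (val A)).
Proof.
pose MX : 'M[{mpoly k[N]}]_n := \matrix_(i, j) 'X_(xv i j).
exists (\sum_(p in colstab (@ycol mu)) \sum_(q in colstab (@ycol la))
    (-1) ^+ odd_perm p * (-1) ^+ odd_perm q *
    \prod_a (MX ^+ (Q a).+1) (rev_ord (yrow mu_n (p a))) (yrow la_n (q (al a)))).
move=> A; rewrite raddf_sum; apply: eq_bigr => p _ /=; rewrite raddf_sum; apply: eq_bigr => q _ /=.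
rewrite !rmorphM !rmorph_sign rmorph_prod; congr (_ * _); apply: eq_bigr => a _ /=.
have MXE d : map_mx (meval (coords (val A))) (MX ^+ d) = val A ^+ d.
  elim: d => [|d IH]; first by rewrite !expr0 map_mx1.
  rewrite !exprS map_mxM IH; congr (_ *m _); apply/matrixP => i j.
  by rewrite !mxE /= mevalXU coordsE.
by rewrite /power_entries -MXE mxE.
Qed.

Hypothesis char0 : [pchar k] =i pred0.
Hypotheses (la_part : is_partition la) (mu_part : is_partition mu).
Hypothesis lamu_n : (size la + size mu <= n)%N.
Variables (Q : young mu -> 'I_m) (al : young mu -> young la) (al' : young la -> young mu).
Hypotheses (alK : cancel al al') (al'K : cancel al' al).

(** The powers of [A] and of its conjugate are compared through [S (S^-1 A S)^l = A^l S]: one side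
    is a unitriangular row operation, the other a unitriangular column operation, and [usum] ignores
    both. *)
Lemma pull_back_unitriangular (S : GL k n) (A : nilvar k n m) : upper_unitriangular S ->
  pull_back Q al (val (conj_nil S A)) = pull_back Q al (val A).
Proof.
move=> [S1 S0]; have uS := valP S.
transitivity (usum (yrow mu_n) (@ycol mu) (yrow la_n) (@ycol la) Q al
   (fun l i j => \sum_i' val S (rev_ord i) (rev_ord i') * power_entries (val (conj_nil S A)) l i' j)).
  symmetry; apply: usum_rows => //; [exact: y_inj | exact: y_down |].
  by move=> i i' ii; apply: S0 => /=; have := ltn_ord i'; lia.
transitivity (usum (yrow mu_n) (@ycol mu) (yrow la_n) (@ycol la) Q al
   (fun l i j => \sum_j' val S j' j * power_entries (val A) l i j')).
  apply: usum_eq => l i j; rewrite /power_entries.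
  transitivity ((val S *m val (conj_nil S A) ^+ l.+1) (rev_ord i) j).
    by rewrite mxE [RHS](reindex_inj rev_ord_inj).
  rewrite /= conj_expr !mulmxA mulmxV // mul1mx mxE; apply: eq_bigr => j' _.
  by rewrite mulrC.
apply: usum_cols => //; [exact: y_inj | exact: y_down |].
by move=> j j' jj; apply: S0.
Qed.

Lemma prod_yrow (nu : seq nat) (nu_n : (size nu <= n)%N) (F : 'I_n -> k) :
  is_partition nu -> \prod_(b : young nu) F (yrow nu_n b) = \prod_i F i ^+ nth 0%N nu i.
Proof.
move=> nu_part; rewrite (partition_big (yrow nu_n) predT) //=; apply: eq_bigr => i _.
rewrite (eq_bigr (fun=> F i)) => [|b /eqP -> //]; rewrite prodr_const; congr (_ ^+ _).
rewrite -[RHS](size_iota 1) -(count_predT (iota _ _)) -(y_card_row nu_n nu_part).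
by apply: eq_card => b; rewrite !inE andbT.
Qed.

(** An entry of a power scales by the inverse of its row factor times its column factor. The
    multisets of rows and of columns are the same in every term, and give [-mu] and [la]. *)
Lemma pull_back_weight (D : GL k n) (A : nilvar k n m) : diagonal D ->
  pull_back Q al (val (conj_nil D A)) = character_of (@weight_pair n la mu) D * pull_back Q al (val A).
Proof.
move=> /is_diag_mxP Ddiag; have uD := valP D.
pose t i := val D i i.
have mulDl (M : 'M[k]_n) i j : (val D *m M) i j = t i * M i j.
  rewrite mxE (bigD1 i) //= big1 ?addr0 // => x xi.
  by rewrite Ddiag ?mul0r // val_eqE eq_sym.
have mulDr (M : 'M[k]_n) i j : (M *m val D) i j = M i j * t j.
  by rewrite mxE (bigD1 j) //= big1 ?addr0 // => x xi; rewrite Ddiag ?mulr0 // val_eqE.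
have t0 i : t i != 0.
  apply/eqP => ti; have := mulDl (invmx (val D)) i i.
  by rewrite ti mul0r mulmxV // mxE eqxx => /eqP; rewrite oner_eq0.
have powE l i j : power_entries (val (conj_nil D A)) l i j =
    (t (rev_ord i))^-1 * t j * power_entries (val A) l i j.
  have : t (rev_ord i) * power_entries (val (conj_nil D A)) l i j = power_entries (val A) l i j * t j.
    rewrite /power_entries -mulDl -mulDr /= conj_expr !mulmxA mulmxV // mul1mx //.
  by move/(canRL (mulKf (t0 _))) ->; rewrite -[RHS]mulrA [t j * _]mulrC.
have chiE : character_of (@weight_pair n la mu) D =
    (\prod_(b : young mu) (t (rev_ord (yrow mu_n b)))^-1) * \prod_(c : young la) t (yrow la_n c).
  rewrite (prod_yrow mu_n (fun i => (t (rev_ord i))^-1)) // (prod_yrow la_n) //.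
  rewrite (reindex_inj rev_ord_inj) /= -big_split; apply: eq_bigr => i _ /=.
  rewrite rev_ordK weight_pairE //.
  by rewrite expfzDr ?t0 // mulrC exprVn -exprnN.
rewrite chiE /pull_back /usum mulr_sumr; apply: eq_bigr => p _.
rewrite mulr_sumr; apply: eq_bigr => q _; rewrite [RHS]mulrCA; congr (_ * _).
under eq_bigr => a _ do rewrite powE; rewrite !big_split /=; congr (_ * _ * _).
  by rewrite [RHS](reindex_inj (@perm_inj _ p)).
rewrite [RHS](reindex (fun a => q (al a))) //=; exists (fun c => al' ((q^-1)%g c)) => c _.
  by rewrite permK alK.
by rewrite al'K permKV.
Qed.

Lemma highest_weight_pull_back :
  highest_weight_space (@weight_pair n la mu) (fun A : nilvar k n m => pull_back Q al (val A)).
Proof.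
split; first exact: regular_pull_back.
  by move=> S US A; apply: pull_back_unitriangular.
by move=> D diagD A; apply: pull_back_weight.
Qed.

End PullBack.

Lemma highest_weight_sum (k : fieldType) (n m d : nat) (chi : 'I_n -> int)
    (c : 'I_d -> k) (g : 'I_d -> nilvar k n m -> k) (f : nilvar k n m -> k) :
  (forall i, highest_weight_space chi (g i)) -> (forall A, f A = \sum_(i < d) c i * g i A) ->
  highest_weight_space chi f.
Proof.
move=> g_hw fE; split.
- have [p pP] := fin_all_exists (fun i => let: And3 gr _ _ := g_hw i in gr).
  exists (\sum_i c i *: p i) => A; rewrite fE raddf_sum /=; apply: eq_bigr => i _.
  by rewrite mevalZ -pP.
- move=> S US A; rewrite /Defs.act !fE; apply: eq_bigr => i _; congr (_ * _).
  by have [_ H _] := g_hw i; apply: H.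
- move=> D diagD A; rewrite /Defs.act !fE mulr_sumr; apply: eq_bigr => i _.
  by rewrite mulrCA; congr (_ * _); have [_ _ H] := g_hw i; apply: H.
Qed.

Lemma weight_bound (E : {fset box}) (Q : tableau E) (m : nat) (nu : m.-tuple nat) :
  (forall b, 0 < Q b)%N -> has_weight Q nu -> forall a, (0 < Q a <= m)%N.
Proof.
move=> Q0 wQ a; rewrite Q0 leqNgt; apply/negP => mQ.
have := wQ (Q a).-1; rewrite nth_default ?size_tuple ?prednK //; last by lia.
move/eqP; rewrite cards_eq0 => /eqP/setP/(_ a); by rewrite !inE eqxx.
Qed.

(** Exponent zero gives an entry of the identity matrix in the last [size mu] rows and the first
    [size la] columns, which is never diagonal; an exponent above [m] gives the zero matrix. *)
Lemma signed_sum_eq0 (k : closedFieldType) (n m : nat) (la mu : seq nat)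
    (la_n : (size la <= n)%N) (mu_n : (size mu <= n)%N)
    (w : k * {ffun young mu -> nat} * {ffun young mu -> young la}) (A : nilvar k n m) b :
  (size mu + size la <= n)%N -> ~~ (0 < w.1.2 b <= m)%N ->
  signed_sum la_n mu_n w (val A) = 0.
Proof.
move=> lamu_n wb; rewrite /signed_sum big1 ?mulr0 // => p _; rewrite big1 // => q _.
rewrite (bigD1 b) //= [X in _ * (X * _)](_ : _ = 0) ?mul0r ?mulr0 //.
move: wb; rewrite negb_and -leqNgt leqn0 -ltnNge => /orP[/eqP ->|mb].
  rewrite expr0 mxE -val_eqE /= (_ : (_ == _) = false) //.
  have /and3P[h1 h2 h3] := youngP (p b); have /and3P[h1' h2' h3'] := youngP (q (w.2 b)).
  have len (nu : seq nat) i j : (0 < j <= nth 0 nu i -> i < size nu)%N.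
    by move=> h; rewrite ltnNge; apply/negP => le; move: h; rewrite nth_default // leqn0; case: j.
  have l1 := len _ _ _ (introT andP (conj h2 h3)).
  have l2 := len _ _ _ (introT andP (conj h2' h3')).
  by apply/eqP; move: l1 l2 lamu_n => /=; lia.
have /andP[_ /eqP Am] := valP A.
by rewrite -(subnKC mb) exprD Am mul0r mxE.
Qed.

Local Close Scope ring_scope.

Theorem corollary2
  (k : closedFieldType) (char0 : [pchar k]%R =i pred0)
  (n m r s : nat)
  (n_ge1 : 1 <= n) (m_ge1 : 1 <= m) (r_ge1 : 1 <= r) (s_ge1 : 1 <= s)
  (rs_le_n : r + s <= n)
  (t : nat) (la mu : seq nat)
  (la_part : is_partition la) (mu_part : is_partition mu)
  (la_sum : sumn la = t) (mu_sum : sumn mu = t)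
  (mu_len : size mu <= r) (la_len : size la <= s)
  (reps : m.-tuple nat -> tableau (young la) -> tableau (young mu) ->
          {set {ffun young mu -> young la}})
  (repsP : forall (nu : m.-tuple nat) (P : tableau (young la))
                  (Q : tableau (young mu)),
     sumn nu = t ->
     ordered_tableau P -> ordered_tableau Q ->
     has_weight P nu -> has_weight Q nu ->
     set_of_representatives m P Q (reps nu P Q)) :
  spans
    (fun f : nilvar k n m -> k =>
       exists (nu : m.-tuple nat) (P : tableau (young la))
              (Q : tableau (young mu)) (alpha : {ffun young mu -> young la}),
         [/\ sumn nu = t,
             ordered_tableau P /\ ordered_tableau Q,
             has_weight P nu /\ has_weight Q nu,
             alpha \in reps nu P Q
           & forall A : nilvar k n m,
               f A = u_fun Q alpha (phi m r s (val A))])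
    (highest_weight_space (@weight_pair n la mu)).
Proof.
move: la_sum repsP; case: t / mu_sum => la_mu repsP.
have la_n : size la <= n by lia.
have mu_n : size mu <= n by lia.
have lamu_n : size la + size mu <= n by lia.
have GE (nu : m.-tuple nat) P Q alpha : sumn nu = sumn mu ->
    ordered_tableau P -> ordered_tableau Q -> has_weight P nu -> has_weight Q nu ->
    alpha \in reps nu P Q -> (forall a, 0 < Q a <= m) /\ bijective alpha.
  move=> sn oP oQ wP wQ ain; split.
    by apply: weight_bound wQ; case: oQ.
  by have [H _] := repsP nu P Q sn oP oQ wP wQ; have [S _ []] := H _ ain.
have u_funE (Q : tableau (young mu)) (alpha : {ffun young mu -> young la}) (A : 'M[k]_n) : (forall a, 0 < Q a <= m) ->
    u_fun Q alpha (phi m r s A) = pull_back la_n mu_n (entry_index m_ge1 Q) alpha A.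
  exact: u_fun_phi.
move=> f; split=> [[d [c [g [Gg fE]]]]|f_hw].
  apply: highest_weight_sum fE => i.
  have [nu [P [Q [alpha [sn [oP oQ] [wP wQ] ain gE]]]]] := Gg i.
  have [Qm [al' alK al'K]] := GE _ _ _ _ sn oP oQ wP wQ ain.
  have [[p pE] inv_g wt_g] := highest_weight_pull_back la_n mu_n char0 la_part mu_part
    lamu_n (entry_index m_ge1 Q) alK al'K.
  split=> [|S US A|D diagD A]; rewrite /Defs.act.
  - by exists p => A; rewrite gE u_funE // pE.
  - by rewrite !gE !u_funE //; apply: inv_g.
  - by rewrite !gE !u_funE //; apply: wt_g.
have [ws [ws_inj fE]] := highest_weight_signed_sums char0 la_part mu_part la_n mu_n lamu_n la_mu
  n_ge1 f_hw.
set G := (fun f => _).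
suff [d [c [g [Gg H]]]] : linear_span G (fun A => (\sum_(w <- ws) signed_sum la_n mu_n w (val A))%R).
  by exists d, c, g; split=> // A; rewrite fE.
elim: ws ws_inj {fE} => [|w ws IH] ws_inj.
  have [d [c [g [Gg H]]]] := linear_span0 G.
  by exists d, c, g; split=> // A; rewrite big_nil.
have {IH} IH := IH (fun w' h => ws_inj w' (mem_behead (s := w :: ws) h)).
have al_inj := ws_inj w (mem_head _ _).
(* Terms with an exponent outside the range from [1] to [m] vanish; in the others the exponents are
   the entries of a filling [Q]. *)
have [/forallP Em|] := boolP [forall b, 0 < w.1.2 b <= m]; last first.
  rewrite negb_forall => /existsP[b wb]; have [d [c [g [Gg H]]]] := IH.
  exists d, c, g; split=> // A.
  by rewrite big_cons (signed_sum_eq0 _ _ _ _ wb) ?add0r //; rewrite addnC.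
have Qlt b : (w.1.2 b).-1 < m by have /andP[w0 wm] := Em b; rewrite prednK.
pose Q b := Ordinal (Qlt b).
have [al' alK al'K] : bijective w.2.
  by apply: inj_card_bij al_inj _; rewrite (card_young mu_n) // (card_young la_n) // la_mu.
have [vinv vinvK] := fin_all_exists (@vix_surj m r s).
(* The coordinates of [phi A], with rows counted from the bottom: evaluation at this point is the
   pull-back along [phi], and it carries the straightening of [upoly] to functions on the
   variety. *)
pose v (A : 'M[k]_n) (u : 'I_(m * r * s)) : k := let: (l, i, j) := vinv u in
  (A ^+ l.+1)%R (rev_ord (widen_ord (leq_trans (leq_addr _ _) rs_le_n) i))
    (widen_ord (leq_trans (leq_addl _ _) rs_le_n) j).
have vE A l i j : v A (vix (l, i, j)) =
  (A ^+ l.+1)%R (rev_ord (widen_ord (leq_trans (leq_addr _ _) rs_le_n) i))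
    (widen_ord (leq_trans (leq_addl _ _) rs_le_n) j).
  by rewrite /v -(vix_inj (vinvK (vix (l, i, j)))).
have span_eval u : in_span (generator m_ge1 mu_len la_len reps) u ->
    linear_span G (fun A => u.@[v (val A)])%R.
  elim=> [|c u1 u2 [nu [P [Q1 [alpha [sn [oP oQ] [wP wQ] ain u1E]]]]] _ IH2].
    have [d [c [g [Gg H]]]] := linear_span0 G.
    by exists d, c, g; split=> // A; rewrite meval0 -(H A).
  have Gu1 : G (fun A => u1.@[v (val A)])%R.
    exists nu, P, Q1, alpha; split=> // A; have [Qm _] := GE _ _ _ _ sn oP oQ wP wQ ain.
    by rewrite u_funE // u1E; apply: upoly_pull_back => l i j; apply: vE.
  have [d [c' [g [Gg H]]]] := linear_span_cons c Gu1 IH2.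
  by exists d, c', g; split=> // A; rewrite mevalD mevalZ -(H A).
have := span_generators char0 m_ge1 la_part mu_part mu_len la_len repsP Q alK al'K.
move=> /span_eval/(linear_span_comb w.1.1)/(_ IH)[d [c [g [Gg H]]]].
exists d, c, g; split=> // A; rewrite big_cons -H; congr (_ + _)%R.
rewrite (upoly_pull_back la_n mu_n mu_len la_len (rs_n := rs_le_n) Q w.2 (vE (val A))).
rewrite /signed_sum; congr (_ * _)%R; apply: eq_bigr => p _; apply: eq_bigr => q _.
congr (_ * _)%R; apply: eq_bigr => b _.
by have /andP[w0 _] := Em b; rewrite /power_entries /= prednK.
Qed.
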